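(* Let a Lie group $G$ act on a manifold $M$ by two actions, and for $a=1,2$ let $X^a:\mathfrak g\to\mathfrak X(M)$ be the map associating to an element of $\mathfrak g$ its infinitesimal generator for the $a$-th action. Let $X=X^1-X^2:\mathfrak g\to\mathfrak X(M)$ be the difference. Then the two Poisson brackets on $C^\infty(M\times\mathfrak g^*,\mathbb R)$ determined by the two actions are compatible if and only if $X(\mathfrak g)$ is a commutative algebra of vector fields (i.e. $[X(v),X(w)]=0$ for all $v,w\in\mathfrak g$) and the actions differ by a translation (at the infinitesimal level, near generic points).
   Context: Let $G$ be a Lie group of dimension $r$ with Lie algebra $\mathfrak g=T_eG$, bracket $[v,w]=\frac{d}{dt}|_{t=0}\mathrm{Ad}(\exp(tv))w$, and basis $v_1,\dots,v_r$. A left action satisfies $h\cdot(g\cdot z)=(hg)\cdot z$ and a right action satisfies $h\cdot(g\cdot z)=(gh)\cdot z$. Everything is local: $M$ is an open subset of $\mathbb R^p$ with coordinates $z$. The infinitesimal generator of $v$ is the vector field $z\mapsto\frac{d}{dt}|_{t=0}\exp(tv)\cdot z$. For a right action, $X^a(v)$ is taken to be minus this field, i.e. the right action is first converted to the left action $(g,z)\mapsto g^{-1}\cdot z$. Poisson bracket determined by an action: let $\Phi$ be the $p\times r$ matrix whose $k$-th column consists of the components of $X^a(v_k)$, let $\xi_i(\theta)=\theta(v_i)$ be coordinates on $\mathfrak g^*$, and let $\Lambda(\mathfrak g^* )_{ij}=\sum_kc_{ij}^k\xi_k$ with $[v_i,v_j]=\sum_kc_{ij}^kv_k$. Then $$\{F,H\}=\begin{pmatrix}\nabla_zF^T&\nabla_\xi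 F^T\end{pmatrix}\begin{pmatrix}0&\Phi\\-\Phi^T&\Lambda(\mathfrak g^* )\end{pmatrix}\begin{pmatrix}\nabla_zH\\\nabla_\xi H\end{pmatrix},$$ which is a Poisson bracket. Two Poisson brackets are compatible if their sum is also a Poisson bracket. Differing by a translation: let $\ell$ be the dimension of the vector space $X(\mathfrak g)$. Call $z_0\in M$ generic if the vectors $X(v)(z_0)$, $v\in\mathfrak g$, span a subspace of $T_{z_0}M$ of dimension $\ell$. The two actions differ by a translation (at the infinitesimal level) if around every generic point there are local coordinates $u=(u_1,\dots,u_p)$ of $M$, and a basis $w_1,\dots,w_r$ of $\mathfrak g$, such that $X^1(w_i)=X^2(w_i)+\frac{\partial}{\partial u_i}$ for $i=1,\dots,\ell$ and $X^1(w_j)=X^2(w_j)$ for $j=\ell+1,\dots,r$. *)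

(* Defs.v *)
From HB Require Import structures.
From mathcomp Require Import all_boot all_order all_algebra.
From mathcomp Require Import all_classical all_reals all_analysis.

Set Implicit Arguments.
Unset Strict Implicit.
Unset Printing Implicit Defensive.

Import Order.TTheory GRing.Theory Num.Theory.
Import numFieldNormedType.Exports.

Local Open Scope classical_set_scope.
Local Open Scope ring_scope.

(** * Smooth maps between open subsets of Euclidean spaces *)

Definition iter_partial (R : realType) (n : nat) (W : normedModType R)
    (s : seq 'I_n) (f : 'rV[R]_n -> W) : 'rV[R]_n -> W :=
  foldr (fun i g x => 'D_(delta_mx 0 i) g x) f s.

(* C^oo on an open set U: all iterated partial derivatives exist and are
   continuous at the points of U.  The values of f outside U are irrelevant. *)
Definition smooth_on (R : realType) (n : nat) (W : normedModType R)
    (U : set 'rV[R]_n) (f : 'rV[R]_n -> W) : Prop :=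
  forall (s : seq 'I_n) (x : 'rV[R]_n), U x ->
    {for x, continuous (iter_partial s f)} /\
    forall i : 'I_n, derivable (iter_partial s f) x (delta_mx 0 i).

(** * Lie groups *)

Record chart (R : realType) (n : nat) (T : topologicalType) := Chart {
  chart_dom : set T;
  chart_map :> T -> 'rV[R]_n;
  chart_inv : 'rV[R]_n -> T;
  chart_dom_open : open chart_dom;
  chart_cod_open : open (chart_map @` chart_dom);
  chart_mapK : forall g, chart_dom g -> chart_inv (chart_map g) = g;
  chart_map_continuous : forall g, chart_dom g -> {for g, continuous chart_map};
  chart_inv_continuous : forall x, (chart_map @` chart_dom) x ->
    {for x, continuous chart_inv} }.

HB.structure Definition TopGroup := {G of Group G & Topological G}.

(* The atlas is {chart_at g | g in G}; [chart_at g] is a preferred chart around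
   g.  A point of G * G is represented in charts by a row vector of
   length r + r. *)
HB.mixin Record isLieGroup (R : realType) (r : nat) G of TopGroup G := {
  lie_hausdorff : hausdorff_space G;
  lie_second_countable : @second_countable G;
  chart_at : G -> chart R r G;
  chart_at_mem : forall g, chart_dom (chart_at g) g;
  chart_at_smooth : forall a b : G,
    smooth_on (chart_at a @` (chart_dom (chart_at a) `&` chart_dom (chart_at b)))
      (fun x => chart_at b (chart_inv (chart_at a) x));
  lie_mul_continuous : continuous (fun gh : G * G => (gh.1 * gh.2)%g);
  lie_inv_continuous : continuous (fun g : G => (g^-1)%g);
  lie_mul_smooth : forall a b c : G,
    smooth_on
      [set x : 'rV[R]_(r + r) |
        [/\ (chart_at a @` chart_dom (chart_at a)) (lsubmx x),
            (chart_at b @` chart_dom (chart_at b)) (rsubmx x) &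
            chart_dom (chart_at c) (chart_inv (chart_at a) (lsubmx x) *
                                    chart_inv (chart_at b) (rsubmx x))%g]]
      (fun x => chart_at c (chart_inv (chart_at a) (lsubmx x) *
                            chart_inv (chart_at b) (rsubmx x))%g);
  lie_inv_smooth : forall a b : G,
    smooth_on
      [set x : 'rV[R]_r |
        (chart_at a @` chart_dom (chart_at a)) x /\
        chart_dom (chart_at b) ((chart_inv (chart_at a) x)^-1)%g]
      (fun x => chart_at b ((chart_inv (chart_at a) x)^-1)%g) }.

#[short(type="lieGroupType")]
HB.structure Definition LieGroup (R : realType) (r : nat) :=
  {G of TopGroup G & isLieGroup R r G}.

Definition chart1 (R : realType) (r : nat) (G : lieGroupType R r) : chart R r G :=
  chart_at (1%g : G).

(* T_e G is identified with 'rV[R]_r through the preferred chart at the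
   identity: v stands for the tangent vector of components v in that chart. *)

(* Continuous homomorphisms R -> G, which are automatically smooth. *)
Definition one_param_subgroup (R : realType) (r : nat) (G : lieGroupType R r)
    (v : 'rV[R]_r) (gamma : R -> G) : Prop :=
  [/\ continuous gamma,
      forall s t : R, gamma (s + t) = (gamma s * gamma t)%g &
      is_derive (0 : R) 1 (fun t => chart1 G (gamma t)) v].

(* The one-parameter subgroup with initial velocity v exists and is unique, so
   the default value of xget is never used. *)
Definition lie_exp (R : realType) (r : nat) (G : lieGroupType R r)
    (v : 'rV[R]_r) : G :=
  @xget (R -> G) (fun=> 1%g) [set gamma | one_param_subgroup v gamma] 1.

Definition lie_Ad (R : realType) (r : nat) (G : lieGroupType R r)
    (g : G) (w : 'rV[R]_r) : 'rV[R]_r :=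
  'D_w (fun x => chart1 G (g * chart_inv (chart1 G) x * g^-1)%g)
       (chart1 G 1%g).

Definition lie_bracket (R : realType) (r : nat) (G : lieGroupType R r)
    (v w : 'rV[R]_r) : 'rV[R]_r :=
  derive1 (fun t : R => lie_Ad (lie_exp G (t *: v)) w) 0.

(* struct_const G v i j k is c_ij^k, where [v_i,v_j] = \sum_k c_ij^k v_k. *)
Definition struct_const (R : realType) (r : nat) (G : lieGroupType R r)
    (v : r.-tuple 'rV[R]_r) (i j k : 'I_r) : R :=
  coord v k (lie_bracket G (tnth v i) (tnth v j)).

(** * Actions on an open subset M of R^p *)

Variant action_side := LeftAction | RightAction.

(* Left and right actions, defined on an open neighbourhood act_dom of
   {e} * M in G * M.  A global action is one with
   act_dom = [set gz | M gz.2].  Allowing smaller domains covers the restriction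
   of an action on a manifold to a coordinate domain M, which need not be
   stable under G. *)
Record local_action (R : realType) (r p : nat) (G : lieGroupType R r)
    (M : set 'rV[R]_p) := LocalAction {
  act_side : action_side;
  act_dom : set (G * 'rV[R]_p);
  act : G -> 'rV[R]_p -> 'rV[R]_p;
  act_dom_open : open act_dom;
  act_dom_sub : forall g z, act_dom (g, z) -> M z;
  act_dom1 : forall z, M z -> act_dom (1%g, z);
  act_stable : forall g z, act_dom (g, z) -> M (act g z);
  act1 : forall z, M z -> act 1%g z = z;
  actM : forall h g z,
    let hg := match act_side with
              | LeftAction => (h * g)%g
              | RightAction => (g * h)%g
              end in
    act_dom (g, z) -> act_dom (h, act g z) -> act_dom (hg, z) ->
    act h (act g z) = act hg z;
  act_smooth : forall a : G,
    smooth_on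
      [set x : 'rV[R]_(r + p) |
        (chart_at a @` chart_dom (chart_at a)) (lsubmx x) /\
        act_dom (chart_inv (chart_at a) (lsubmx x), rsubmx x)]
      (fun x => act (chart_inv (chart_at a) (lsubmx x)) (rsubmx x)) }.

Definition inf_generator (R : realType) (r p : nat) (G : lieGroupType R r)
    (M : set 'rV[R]_p) (A : local_action G M) (v : 'rV[R]_r) (z : 'rV[R]_p) :
    'rV[R]_p :=
  derive1 (fun t : R => act A (lie_exp G (t *: v)) z) 0.

(* For a right action, the generator of the left action (g, z) |-> g^-1 . z. *)
Definition action_field (R : realType) (r p : nat) (G : lieGroupType R r)
    (M : set 'rV[R]_p) (A : local_action G M) (v : 'rV[R]_r) (z : 'rV[R]_p) :
    'rV[R]_p :=
  match act_side A with
  | LeftAction => inf_generator A v z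
  | RightAction => - inf_generator A v z
  end.

(** * Poisson brackets *)

(* Functions on U are represented by functions on R^n, compared on U. *)
Record poisson_bracket (R : realType) (n : nat) (U : set 'rV[R]_n)
    (B : ('rV[R]_n -> R) -> ('rV[R]_n -> R) -> 'rV[R]_n -> R) : Prop :=
  PoissonBracket {
  pb_ext : forall F F' H H' : 'rV[R]_n -> R,
    smooth_on U F -> smooth_on U H ->
    {in U, F =1 F'} -> {in U, H =1 H'} -> {in U, B F H =1 B F' H'};
  pb_smooth : forall F H : 'rV[R]_n -> R,
    smooth_on U F -> smooth_on U H -> smooth_on U (B F H);
  pb_linear : forall (a : R) (F H K : 'rV[R]_n -> R),
    smooth_on U F -> smooth_on U H -> smooth_on U K ->
    {in U, B (fun x => a * F x + H x) K =1 fun x => a * B F K x + B H K x};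
  pb_antisym : forall F H : 'rV[R]_n -> R,
    smooth_on U F -> smooth_on U H ->
    {in U, B F H =1 fun x => - B H F x};
  pb_leibniz : forall F H K : 'rV[R]_n -> R,
    smooth_on U F -> smooth_on U H -> smooth_on U K ->
    {in U, B (fun x => F x * H x) K =1 fun x => F x * B H K x + B F K x * H x};
  pb_jacobi : forall F H K : 'rV[R]_n -> R,
    smooth_on U F -> smooth_on U H -> smooth_on U K ->
    {in U, forall x, B F (B H K) x + B H (B K F) x + B K (B F H) x = 0} }.

Definition poisson_compatible (R : realType) (n : nat) (U : set 'rV[R]_n)
    (B1 B2 : ('rV[R]_n -> R) -> ('rV[R]_n -> R) -> 'rV[R]_n -> R) : Prop :=
  poisson_bracket U (fun F H x => B1 F H x + B2 F H x).

Definition gradient (R : realType) (n : nat) (F : 'rV[R]_n -> R)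
    (x : 'rV[R]_n) : 'rV[R]_n :=
  \row_i 'D_(delta_mx 0 i) F x.

(* M * g^* in the coordinates (z, xi), where xi_i(theta) = theta(v_i). *)
Definition phase_space (R : realType) (r p : nat) (M : set 'rV[R]_p) :
    set 'rV[R]_(p + r) :=
  [set x | M (lsubmx x)].

Definition action_Phi (R : realType) (r p : nat) (G : lieGroupType R r)
    (M : set 'rV[R]_p) (v : r.-tuple 'rV[R]_r) (A : local_action G M)
    (z : 'rV[R]_p) : 'M[R]_(p, r) :=
  \matrix_(a < p, k < r) action_field A (tnth v k) z 0 a.

Definition lie_Lambda (R : realType) (r : nat) (G : lieGroupType R r)
    (v : r.-tuple 'rV[R]_r) (xi : 'rV[R]_r) : 'M[R]_r :=
  \matrix_(i, j) \sum_k struct_const G v i j k * xi 0 k.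

Definition action_bracket (R : realType) (r p : nat) (G : lieGroupType R r)
    (M : set 'rV[R]_p) (v : r.-tuple 'rV[R]_r) (A : local_action G M)
    (F H : 'rV[R]_(p + r) -> R) (x : 'rV[R]_(p + r)) : R :=
  let Phi := action_Phi v A (lsubmx x) in
  let P := block_mx 0 Phi (- Phi^T) (lie_Lambda G v (rsubmx x)) in
  (gradient F x *m P *m (gradient H x)^T) 0 0.

(** * Vector fields *)

Definition field_bracket (R : realType) (p : nat)
    (X Y : 'rV[R]_p -> 'rV[R]_p) (z : 'rV[R]_p) : 'rV[R]_p :=
  'D_(X z) Y z - 'D_(Y z) X z.

Definition commutative_fields (R : realType) (r p : nat) (M : set 'rV[R]_p)
    (X : 'rV[R]_r -> 'rV[R]_p -> 'rV[R]_p) : Prop :=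
  forall v w z, M z -> field_bracket (X v) (X w) z = 0.

(* The vector space of vector fields {X(v) | v} on M has dimension l: it has a
   basis X(w_1), ..., X(w_l), freeness and span being taken as fields on M. *)
Definition fields_dim (R : realType) (r p : nat) (M : set 'rV[R]_p)
    (X : 'rV[R]_r -> 'rV[R]_p -> 'rV[R]_p) (l : nat) : Prop :=
  exists w : l.-tuple 'rV[R]_r,
    (forall a : 'I_l -> R,
       (forall z, M z -> \sum_i a i *: X (tnth w i) z = 0) ->
       forall i, a i = 0) /\
    (forall v, exists a : 'I_l -> R,
       forall z, M z -> X v z = \sum_i a i *: X (tnth w i) z).

Definition generic_point (R : realType) (r p : nat)
    (X : 'rV[R]_r -> 'rV[R]_p -> 'rV[R]_p) (l : nat) (z0 : 'rV[R]_p) : Prop :=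
  exists S : {vspace 'rV[R]_p},
    [/\ forall v, X v z0 \in S,
        forall T : {vspace 'rV[R]_p}, (forall v, X v z0 \in T) -> (S <= T)%VS &
        \dim S = l].

Record local_coordinates (R : realType) (p : nat) := LocalCoordinates {
  lc_dom : set 'rV[R]_p;
  lc_map :> 'rV[R]_p -> 'rV[R]_p;
  lc_inv : 'rV[R]_p -> 'rV[R]_p;
  lc_dom_open : open lc_dom;
  lc_cod_open : open (lc_map @` lc_dom);
  lc_mapK : forall z, lc_dom z -> lc_inv (lc_map z) = z;
  lc_map_smooth : smooth_on lc_dom lc_map;
  lc_inv_smooth : smooth_on (lc_map @` lc_dom) lc_inv }.

(* The field d/du_k on the domain of the coordinates u, in the standard
   coordinates of R^p. *)
Definition coordinate_field (R : realType) (p : nat)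
    (u : local_coordinates R p) (k : 'I_p) (z : 'rV[R]_p) : 'rV[R]_p :=
  'D_(delta_mx 0 k) (lc_inv u) (u z).

(* Indices are 0-based: i < l is i = 1, ..., l. *)
Definition differ_by_translation (R : realType) (r p : nat)
    (M : set 'rV[R]_p) (X1 X2 : 'rV[R]_r -> 'rV[R]_p -> 'rV[R]_p) : Prop :=
  let X := fun v z => X1 v z - X2 v z in
  exists2 l : nat, fields_dim M X l &
  forall z0, M z0 -> generic_point X l z0 ->
  exists (u : local_coordinates R p) (w : r.-tuple 'rV[R]_r),
    [/\ lc_dom u z0 /\ lc_dom u `<=` M,
        basis_of fullv w,
        forall i : 'I_r, (i < l)%N ->
          exists2 k : 'I_p, k = i :> nat &
          forall z, lc_dom u z ->
            X1 (tnth w i) z = X2 (tnth w i) z + coordinate_field u k z &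
        forall j : 'I_r, (l <= j)%N ->
          forall z, lc_dom u z -> X1 (tnth w j) z = X2 (tnth w j) z].

(* Main.v *)
Require Import Defs.
From HB Require Import structures.
From mathcomp Require Import all_boot all_order all_algebra.
From mathcomp Require Import all_classical all_reals all_analysis.
From mathcomp Require Import ring lra.
Set Implicit Arguments.
Unset Strict Implicit.
Unset Printing Implicit Defensive.
Import Order.TTheory GRing.Theory Num.Theory.
Import numFieldNormedType.Exports.
Local Open Scope classical_set_scope.
Local Open Scope ring_scope.

(* Write S = X^1 + X^2 and X = X^1 - X^2.  The sum of the two brackets is given by
   the matrix with blocks 0, S, -S^T and 2 Lambda.  A bracket given by an
   antisymmetric matrix P satisfies the Jacobi identity iff the cyclic sum of
   (f P).grad P vanishes, and for this matrix that means
   [S(v), S(w)] = - 2 S([v, w]).  Since each X^a satisfies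
   [X^a(v), X^a(w)] = - X^a([v, w]), the parallelogram identity
   [S(v), S(w)] + [X(v), X(w)] = 2 ([X^1(v), X^1(w)] + [X^2(v), X^2(w)])
   turns this condition into [X(v), X(w)] = 0.  Finally, if X(g) is commutative,
   a basis of a complement of ker X gives l commuting fields which are independent
   at every generic point, and commuting independent fields are coordinate fields. *)

(** The minus sign in [X^a(v), X^a(w)] = - X^a([v, w]) is the one of a left action. A right action
    is a left action of the opposite group law, and the sign in [action_field] compensates for the
    exchange of factors. The definitions of [lie_bracket] and [inf_generator] go through
    one-parameter subgroups chosen by [xget], so existence and uniqueness of these must be
    established. They are integral curves of left-invariant fields in the chart. After that only
    their velocity at 0 counts: bracket and generators become derivatives, at the unit, of the group
    law and of the action read in the chart. Both brackets carry the same block Lambda, which is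
    where the 2 in 2 Lambda comes from; it is matched by the 2 of the parallelogram identity. Terms
    quadratic in Lambda cancel by the Jacobi identity of the Lie algebra, which is transferred from
    vector fields. The straightening coordinates invert a flow map with respect to parameters. Hence
    flows must be smooth in the initial point, on one time interval for all orders, although each
    C^k argument shrinks the interval with k. *)

(** * Germs of maps of class C^k *)

(* Iterating the tangent map (x, h) |-> D_h f x, instead of derivatives in fixed
   directions, needs no coordinates and makes stability under composition an
   induction on k. *)
Fixpoint Cn (R : realType) (k : nat) (V W : normedModType R) (f : V -> W) (x : V)
    {struct k} : Prop :=
  match k with
  | 0%N => {for x, continuous f}
  | k'.+1 => (\forall y \near x, differentiable f y) /\
      forall h, Cn k' (fun q : (V * V)%type => 'D_q.2 f q.1) (x, h)
  end.

Definition smooth (R : realType) (V W : normedModType R) (f : V -> W) (x : V) :=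
  forall k, Cn k f x.

Section SmoothCalculus.
Context {R : realType}.
Implicit Types (U V W : normedModType R).

Lemma near_eq_differentiable V W (f g : V -> W) (x : V) :
  (\forall y \near x, f y = g y) -> differentiable f x -> differentiable g x.
Proof.
move=> fg df; have fgx := nbhs_singleton fg.
have dfc := diff_continuous df.
have E : g \o shift x = cst (g x) + 'd f x +o_ 0 id.
  apply/eqaddoP => e e0.
  have : \forall h \near (0 : V), f (h + x) = g (h + x).
    by move: fg; rewrite (near_shift 0) /=; apply: filterS => h; rewrite subr0.
  have /eqaddoP /(_ e e0) := diff_locally df.
  apply: filterS2 => h + fgh.
  by rewrite !fctE /= -fgh -fgx.
have dg := diff_unique dfc E.
by apply/diff_locallyP; rewrite dg; split.
Qed.

Lemma near_eq_near V W (f g : V -> W) (x : V) :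
  (\forall y \near x, f y = g y) ->
  \forall y \near x, \forall z \near y, f z = g z.
Proof. by move=> fg; apply/near_join. Qed.

Lemma Cn_near_eq k V W (f g : V -> W) (x : V) :
  (\forall y \near x, f y = g y) -> Cn k f x -> Cn k g x.
Proof.
elim: k V W f g x => [|k IH] V W f g x fg.
  rewrite /= /prop_for /continuous_at (nbhs_singleton fg); apply: cvg_trans.
  exact: near_eq_cvg.
have fg2 := near_eq_near fg.
move=> [df tf]; split.
  by apply: filterS2 fg2 df => y; apply: near_eq_differentiable.
move=> h; apply: IH (tf h).
have : \forall q \near (x, h), \forall z \near q.1, f z = g z.
  by exact: (@cvg_fst _ _ (nbhs x) (nbhs h) _ _ fg2).
by apply: filterS => q Hq; exact: near_eq_derive.
Qed.

(** Tangent maps are compared in this form: a formula for the derivative at y is known for y near x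
    and for all directions at once. *)
Lemma Cn_near_eq1 k U V W (f g : U * V -> W) (x : U) (h : V) :
  (\forall y \near x, forall z, f (y, z) = g (y, z)) ->
  Cn k f (x, h) -> Cn k g (x, h).
Proof.
move=> fg; apply: Cn_near_eq.
have : \forall q \near (x, h), forall z, f (q.1, z) = g (q.1, z).
  by exact: (@cvg_fst _ _ (nbhs x) (nbhs h) _ _ fg).
by apply: filterS => -[y z] /= ->.
Qed.

Lemma Cn_ext k V W (f g : V -> W) (x : V) : f =1 g -> Cn k f x -> Cn k g x.
Proof. by move=> /funext ->. Qed.

Lemma near_le_differentiable V W (f : V -> W) (L : {linear V -> W}) (x : V) :
  continuous L ->
  (forall e : R, 0 < e -> \forall h \near (0 : V), `|f (x + h) - f x - L h| <= e * `|h|) ->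
  differentiable f x /\ 'd f x = L :> (V -> W).
Proof.
move=> Lc H.
have E : f \o shift x = cst (f x) + L +o_ 0 id.
  apply/eqaddoP => e e0; apply: filterS (H e e0) => h.
  by rewrite !fctE /= opprD addrA (addrC h).
by have D := diff_unique Lc E; split=> //; apply/diff_locallyP; rewrite D.
Qed.

Lemma Cn_S k V W (f : V -> W) (x : V) : Cn k.+1 f x -> Cn k f x.
Proof.
elim: k V W f x => [|k IH] V W f x /=.
  by move=> [/nbhs_singleton df _]; apply: differentiable_continuous.
move=> [df tf]; split=> // h; exact/IH/tf.
Qed.

Lemma Cn_le k j V W (f : V -> W) (x : V) : (j <= k)%N -> Cn k f x -> Cn j f x.
Proof.
move=> /subnK <-; elim: (k - j)%N => // n IH; rewrite addSn => /Cn_S; exact: IH.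
Qed.

Lemma Cn_continuous k V W (f : V -> W) (x : V) : Cn k f x -> {for x, continuous f}.
Proof. exact: (@Cn_le k 0). Qed.

Lemma smooth_continuous V W (f : V -> W) (x : V) : smooth f x -> {for x, continuous f}.
Proof. by move=> /(_ 0%N). Qed.

Lemma smooth_diff V W (f : V -> W) (x : V) : smooth f x -> differentiable f x.
Proof. by move=> /(_ 1%N) [/nbhs_singleton]. Qed.

Lemma smooth_near_diff V W (f : V -> W) (x : V) : smooth f x ->
  \forall y \near x, differentiable f y.
Proof. by move=> /(_ 1%N) []. Qed.

Lemma Cn_cst k V W (c : W) (x : V) : Cn k (fun=> c) x.
Proof.
elim: k V W c x => [|k IH] V W c x /=; first exact: cst_continuous.
split; first by apply: nearW => y; exact: differentiable_cst.
move=> h; apply: Cn_near_eq1 (IH _ _ 0 _).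
by apply: nearW => y z /=; rewrite derive_cst.
Qed.

Lemma Cn_lin k V W (L : {linear V -> W}) (x : V) : continuous L -> Cn k L x.
Proof.
elim: k V W L x => [|k IH] V W L x cL /=; first exact: cL.
split; first by apply: nearW => y; exact: linear_differentiable.
move=> h; apply: (@Cn_near_eq1 _ _ _ _ (L \o snd)).
  apply: nearW => y z /=; rewrite deriveE; first by rewrite diff_lin.
  exact: linear_differentiable.
apply: (IH _ _ (L \o snd : {linear _ -> _})) => q.
by apply: continuous_comp; [exact: cvg_snd|exact: cL].
Qed.

Lemma Cn_fst k V W (x : V * W) : Cn k fst x.
Proof. by apply: (@Cn_lin k _ _ fst) => q; exact: cvg_fst. Qed.

Lemma Cn_snd k V W (x : V * W) : Cn k snd x.
Proof. by apply: (@Cn_lin k _ _ snd) => q; exact: cvg_snd. Qed.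

Lemma Cn_id k V (x : V) : Cn k id x.
Proof. by apply: (@Cn_lin k _ _ idfun) => q; exact: cvg_id. Qed.

Lemma Cn_pair k U V W (f : U -> V) (g : U -> W) (x : U) :
  Cn k f x -> Cn k g x -> Cn k (fun y => (f y, g y)) x.
Proof.
elim: k U V W f g x => [|k IH] U V W f g x /=; first exact: cvg_pair.
move=> [df tf] [dg tg]; split.
  by apply: filterS2 df dg => y; exact: differentiable_pair.
move=> h; apply: Cn_near_eq1 (IH _ _ _ _ _ _ (tf h) (tg h)).
apply: filterS2 df dg => y dfy dgy k' /=.
rewrite !deriveE // ?diff_pair //; exact: differentiable_pair.
Qed.

Lemma derive_comp U V W (f : U -> V) (g : V -> W) (x h : U) :
  differentiable f x -> differentiable g (f x) ->
  'D_h (fun y => g (f y)) x = 'D_('D_h f x) g (f x).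
Proof.
move=> df dg; rewrite (deriveE h df) (deriveE _ dg) deriveE.
  by rewrite -[fun y => _]/(g \o f) diff_comp.
exact: differentiable_comp.
Qed.

(** By the chain rule the tangent map of a composite is the composite of the tangent maps, to which
    the induction hypothesis applies. *)
Lemma Cn_comp k U V W (f : U -> V) (g : V -> W) (x : U) :
  Cn k f x -> Cn k g (f x) -> Cn k (fun y => g (f y)) x.
Proof.
elim: k U V W f g x => [|k IH] U V W f g x /=.
  by move=> cf cg; exact: continuous_comp.
move=> Hf Hg; have cf := @Cn_continuous k.+1 _ _ _ _ Hf.
move: (Hf) (Hg) => [df tf] [dg tg].
have dgf : \forall y \near x, differentiable g (f y) by exact: (cf _ dg).
split.
  by apply: filterS2 df dgf => y; exact: differentiable_comp.
move=> h; apply: (@Cn_near_eq1 _ _ _ _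
  (fun q => (fun p => 'D_p.2 g p.1) ((fun q => (f q.1, 'D_q.2 f q.1)) q))).
  apply: filterS2 df dgf => y dfy dgy z /=.
  by rewrite (derive_comp z dfy dgy).
apply: (IH _ _ _ (fun q => (f q.1, 'D_q.2 f q.1)) (fun p => 'D_p.2 g p.1)).
  apply: Cn_pair; last exact: tf.
  by apply: (IH _ _ _ fst f); [exact: Cn_fst | exact/Cn_S].
exact: tg.
Qed.

Lemma smooth_comp U V W (f : U -> V) (g : V -> W) (x : U) :
  smooth f x -> smooth g (f x) -> smooth (fun y => g (f y)) x.
Proof. by move=> sf sg k; exact: Cn_comp. Qed.

Lemma smooth_pair U V W (f : U -> V) (g : U -> W) (x : U) :
  smooth f x -> smooth g x -> smooth (fun y => (f y, g y)) x.
Proof. by move=> sf sg k; exact: Cn_pair. Qed.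

Lemma Cn_D k V W (f g : V -> W) (x : V) :
  Cn k f x -> Cn k g x -> Cn k (fun y => f y + g y) x.
Proof.
elim: k V W f g x => [|k IH] V W f g x /=; first exact: cvgD.
move=> [df tf] [dg tg]; split.
  by apply: filterS2 df dg => y; exact: differentiableD.
move=> h; apply: Cn_near_eq1 (IH _ _ _ _ _ (tf h) (tg h)).
apply: filterS2 df dg => y dfy dgy k' /=.
by rewrite -[fun y => _]/(f + g) deriveD //; exact: diff_derivable.
Qed.

Lemma Cn_sum k V W (I : Type) (s : seq I) (P : pred I) (f : I -> V -> W) (x : V) :
  (forall i, P i -> Cn k (f i) x) -> Cn k (fun y => \sum_(i <- s | P i) f i y) x.
Proof.
move=> H; elim: s => [|i s IH].
  by apply: Cn_near_eq (Cn_cst _ 0 _); apply: nearW => y; rewrite big_nil.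
case Pi: (P i).
  by apply: Cn_near_eq (Cn_D (H _ Pi) IH); apply: nearW => y; rewrite big_cons Pi.
by apply: Cn_near_eq IH; apply: nearW => y; rewrite big_cons Pi.
Qed.

Lemma Cn_M k V (f g : V -> R) (x : V) :
  Cn k f x -> Cn k g x -> Cn k (fun y => f y * g y) x.
Proof.
elim: k V f g x => [|k IH] V f g x /=; first exact: cvgM.
move=> Hf Hg; have := Hf; have := Hg; move=> [dg tg] [df tf]; split.
  by apply: filterS2 df dg => y; exact: differentiableM.
move=> h; apply: (@Cn_near_eq1 _ _ _ _
  (fun q => f q.1 * 'D_q.2 g q.1 + g q.1 * 'D_q.2 f q.1)).
  apply: filterS2 df dg => y dfy dgy k' /=.
  by rewrite -[fun y => _]/(f * g) deriveM //; exact: diff_derivable.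
apply: Cn_D; (apply: IH; last by [exact: tf | exact: tg]).
  by apply: (@Cn_comp _ _ _ _ fst f); [exact: Cn_fst | exact/Cn_S].
by apply: (@Cn_comp _ _ _ _ fst g); [exact: Cn_fst | exact/Cn_S].
Qed.

Lemma Cn_prod k V (I : Type) (s : seq I) (P : pred I) (f : I -> V -> R) (x : V) :
  (forall i, P i -> Cn k (f i) x) -> Cn k (fun y => \prod_(i <- s | P i) f i y) x.
Proof.
move=> H; elim: s => [|i s IH].
  by apply: (@Cn_near_eq _ _ _ (fun _ : V => 1 : R)); [apply: nearW => y; rewrite big_nil | exact: Cn_cst].
case Pi: (P i).
  by apply: Cn_near_eq (Cn_M (H _ Pi) IH); apply: nearW => y; rewrite big_cons Pi.
by apply: Cn_near_eq IH; apply: nearW => y; rewrite big_cons Pi.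
Qed.

Lemma Cn_Zl k V W (f : V -> R) (w : W) (x : V) :
  Cn k f x -> Cn k (fun y => f y *: w) x.
Proof.
move=> Hf; apply: (@Cn_comp _ _ _ _ f (fun c => c *: w)) => //.
have L : linear (fun c : R => c *: w) by move=> a b c; rewrite scalerDl scalerA.
pose LM := GRing.isLinear.Build _ _ _ _ _ L.
pose LL : {linear _ -> _} := HB.pack (fun c : R => c *: w) LM.
apply: (@Cn_lin k _ _ LL) => c; exact: scalel_continuous.
Qed.

Lemma Cn_Z k V W (a : R) (f : V -> W) (x : V) :
  Cn k f x -> Cn k (fun y => a *: f y) x.
Proof.
move=> Hf; apply: (@Cn_comp _ _ _ _ f (fun c => a *: c)) => //.
apply: (@Cn_lin k _ _ ( *:%R a : {linear _ -> _})) => c; exact: scaler_continuous.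
Qed.

Lemma Cn_N k V W (f : V -> W) (x : V) : Cn k f x -> Cn k (fun y => - f y) x.
Proof.
move=> /(Cn_Z (-1)); apply: Cn_near_eq; apply: nearW => y; exact: scaleN1r.
Qed.

Lemma Cn_B k V W (f g : V -> W) (x : V) :
  Cn k f x -> Cn k g x -> Cn k (fun y => f y - g y) x.
Proof. by move=> Hf Hg; apply: Cn_D => //; exact: Cn_N. Qed.

Lemma Cn_inv k (x : R) : x != 0 -> Cn k (fun y : R => y^-1) x.
Proof.
elim: k x => [|k IH] x x0 /=; first exact: inv_continuous.
have nz : \forall y \near x, y != 0.
  by have := @open_neq R 0; rewrite openE => /(_ x); apply.
split; first by apply: filterS nz => y; exact: differentiable_Rinv.
move=> h; apply: (@Cn_near_eq1 _ _ _ _ (fun q : R * R => - (q.1^-1 * q.1^-1 * q.2))).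
  apply: filterS nz => y y0 z /=.
  rewrite deriveE ?diff_Rinv //; last exact: differentiable_Rinv.
  by rewrite -mulNr expr2 invfM.
have Hi : Cn k (fun q : R * R => q.1^-1) (x, h).
  by apply: (@Cn_comp _ _ _ _ (fst : R * R -> R) (fun y : R => (y^-1 : R))); [exact: Cn_fst | exact: IH].
apply: Cn_N; apply: Cn_M; [exact: Cn_M | exact: Cn_snd].
Qed.

Lemma smooth_tangent V W (f : V -> W) (x h : V) : smooth f x ->
  smooth (fun q : V * V => 'D_q.2 f q.1) (x, h).
Proof. by move=> sf k; have [_ /(_ h)] := sf k.+1. Qed.

Lemma Cn_derive k V W (f : V -> W) (x h : V) : Cn k.+1 f x ->
  Cn k (fun y => 'D_h f y) x.
Proof.
move=> [_ /(_ h) tf].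
apply: (@Cn_comp _ _ _ _ (fun y => (y, h)) (fun q => 'D_q.2 f q.1)) => //.
by apply: Cn_pair; [exact: Cn_id | exact: Cn_cst].
Qed.

Lemma smooth_derive V W (f : V -> W) (x h : V) : smooth f x ->
  smooth (fun y => 'D_h f y) x.
Proof. by move=> sf k; exact: Cn_derive. Qed.

Lemma smooth_near_eq V W (f g : V -> W) (x : V) :
  (\forall y \near x, f y = g y) -> smooth f x -> smooth g x.
Proof. by move=> fg sf k; exact: Cn_near_eq (sf k). Qed.

End SmoothCalculus.

(** * Row vectors and partial derivatives *)

Section RowVectors.
Context {R : realType}.
Implicit Types (V : normedModType R).

Lemma rv_norm_leP m n (x : 'M[R]_(m, n)) (M : R) : 0 <= M ->
  (`|x| <= M) <-> (forall i j, `|x i j| <= M).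
Proof.
move=> M0; rewrite /Num.Def.normr /= mx_normrE; split.
  move=> /bigmax_leP [_ H] i j; exact: (H (i, j)).
by move=> H; apply/bigmax_leP; split => // -[i j] _; exact: H.
Qed.

Lemma rv_norm_coord m n (x : 'M[R]_(m, n)) i j : `|x i j| <= `|x|.
Proof. by have /rv_norm_leP := lexx `|x|; apply. Qed.

Lemma Cn_coord k V m n (f : V -> 'M[R]_(m, n)) (x : V) i j :
  Cn k f x -> Cn k (fun y => f y i j) x.
Proof.
move=> Hf; apply: (@Cn_comp _ _ _ _ _ f (fun N : 'M[R]_(m, n) => N i j : R)) => //.
have L : linear (fun N : 'M[R]_(m, n) => N i j : R) by move=> a b c; rewrite !mxE.
pose LM := GRing.isLinear.Build _ _ _ _ _ L.
pose LL : {linear 'M[R]_(m, n) -> R} := HB.pack (fun N : 'M[R]_(m, n) => N i j : R) LM.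
apply: (@Cn_lin _ k _ _ LL); exact: coord_continuous.
Qed.

Lemma Cn_mx k V m n (f : V -> 'M[R]_(m, n)) (x : V) :
  (forall i j, Cn k (fun y => f y i j) x) -> Cn k f x.
Proof.
move=> H; apply: (@Cn_near_eq _ _ _ _
  (fun y => \sum_i \sum_j f y i j *: delta_mx i j)).
  by apply: nearW => y; rewrite -matrix_sum_delta.
by apply: Cn_sum => i _; apply: Cn_sum => j _; apply: Cn_Zl.
Qed.

Lemma derive_coord V m n (f : V -> 'M[R]_(m, n)) (x h : V) i j :
  differentiable f x -> 'D_h (fun y => f y i j) x = 'D_h f x i j.
Proof. by move=> df; rewrite derive_mx ?mxE //; exact: diff_derivable. Qed.

Lemma Cn_linmx k m n (W : normedModType R) (L : {linear 'M[R]_(m, n) -> W}) (x : 'M[R]_(m, n)) :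
  Cn k (L : _ -> W) x.
Proof.
apply: (@Cn_ext _ _ _ _ (fun y : 'M[R]_(m, n) => \sum_i \sum_j y i j *: L (delta_mx i j))).
  move=> y; rewrite [in RHS](matrix_sum_delta y) linear_sum.
  by apply: eq_bigr => i _; rewrite linear_sum; apply: eq_bigr => j _; rewrite linearZ.
apply: Cn_sum => i _; apply: Cn_sum => j _; apply: Cn_Zl.
exact/Cn_coord/Cn_id.
Qed.

Lemma Cn_row_mx k V m n (f : V -> 'rV[R]_m) (g : V -> 'rV[R]_n) (x : V) :
  Cn k f x -> Cn k g x -> Cn k (fun y => row_mx (f y) (g y)) x.
Proof.
move=> Hf Hg; apply: Cn_mx => i j; case: (split_ordP j) => j' ->.
  apply: Cn_near_eq (Cn_coord i j' Hf); apply: nearW => y.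
  by rewrite row_mxEl.
apply: Cn_near_eq (Cn_coord i j' Hg); apply: nearW => y.
by rewrite row_mxEr.
Qed.

Lemma Cn_lsubmx k V m n (f : V -> 'rV[R]_(m + n)) (x : V) :
  Cn k f x -> Cn k (fun y => lsubmx (f y)) x.
Proof. by move=> Hf; apply: Cn_comp Hf (Cn_linmx _ (lsubmx : {linear _ -> _}) _). Qed.

Lemma Cn_rsubmx k V m n (f : V -> 'rV[R]_(m + n)) (x : V) :
  Cn k f x -> Cn k (fun y => rsubmx (f y)) x.
Proof. by move=> Hf; apply: Cn_comp Hf (Cn_linmx _ (rsubmx : {linear _ -> _}) _). Qed.

Lemma deriveDl V (W : normedModType R) (f : V -> W) (x h k : V) :
  differentiable f x -> 'D_(h + k) f x = 'D_h f x + 'D_k f x.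
Proof. by move=> df; rewrite !deriveE // linearD. Qed.

Lemma deriveZl V (W : normedModType R) (f : V -> W) (x h : V) (a : R) :
  differentiable f x -> 'D_(a *: h) f x = a *: 'D_h f x.
Proof. by move=> df; rewrite !deriveE // linearZ. Qed.

Lemma deriveBl V (W : normedModType R) (f : V -> W) (x h k : V) :
  differentiable f x -> 'D_(h - k) f x = 'D_h f x - 'D_k f x.
Proof. by move=> df; rewrite !deriveE // linearB. Qed.

Lemma is_derive_ext V (W : normedModType R) (f g : V -> W) (x v : V) (d : W) :
  f =1 g -> is_derive x v f d -> is_derive x v g d.
Proof. by move=> /funext ->. Qed.

Lemma is_derive_line V (W : normedModType R) (f : V -> W) (x h : V) (t : R) :
  differentiable f (x + t *: h) ->
  is_derive t 1 (fun s : R => f (x + s *: h)) ('D_h f (x + t *: h)).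
Proof.
move=> df.
have dg : is_diff t (fun s : R => x + s *: h) (fun s : R => s *: h).
  by apply: is_diff_eq; apply/funext => s; rewrite !fctE add0r.
have dfg := @differentiable_comp _ _ _ _ (fun s : R => x + s *: h) f t _ df.
apply: DeriveDef; first by apply: diff_derivable; exact: dfg.
rewrite (@derive_comp _ _ _ _ (fun s : R => x + s *: h) f) //.
by rewrite (deriveE _ ex_diff) diff_val scale1r.
Qed.

(** Only derivability in the direction h is assumed, in contrast with [is_derive_line]: partial
    derivatives are all that is available while differentiability is still being proved. *)
Lemma is_derive_axis V (W : normedModType R) (f : V -> W) (x h : V) :
  derivable f x h -> is_derive (0 : R) 1 (fun s : R => f (x + s *: h)) ('D_h f x).
Proof.
have E : (fun t : R => t^-1 *: (((fun s : R => f (x + s *: h)) \o shift 0) (t *: 1) -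
    f (x + 0 *: h))) = (fun t : R => t^-1 *: ((f \o shift x) (t *: h) - f x)).
  by apply/funext => t /=; rewrite addr0 scale0r addr0 [x + _]addrC [t *: 1]mulr1.
by move=> df; apply: DeriveDef; rewrite /derivable /derive E.
Qed.

Lemma is_derive1_comp V (u : R -> R) (g : R -> V) (t du : R) (dg : V) :
  is_derive t 1 u du -> is_derive (u t) 1 g dg ->
  is_derive t 1 (fun s : R => g (u s)) (du *: dg).
Proof.
move=> Hu Hg.
have /derivable1_diffP Du := @ex_derive _ _ _ _ _ _ _ Hu.
have /derivable1_diffP Dg := @ex_derive _ _ _ _ _ _ _ Hg.
have Dgu := @differentiable_comp _ _ _ _ u g t Du Dg.
apply: DeriveDef; first exact: diff_derivable.
rewrite (@derive_comp _ _ _ _ u g t 1 Du Dg) (@derive_val _ _ _ _ _ _ _ Hu).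
have -> : du = du *: (1 : R) by rewrite [RHS]mulr1.
by rewrite deriveZl // (@derive_val _ _ _ _ _ _ _ Hg) [_ *: 1]mulr1.
Qed.

Lemma is_derive_scalel V (l : V) (t : R) : is_derive t 1 (fun s : R => s *: l) l.
Proof.
apply: DeriveDef; first by apply: diff_derivable.
by rewrite (deriveE _ ex_diff) diff_val scale1r.
Qed.

Lemma is_derive_continuous (W : normedModType R) (u : R -> W) (t : R) du :
  is_derive t 1 u du -> {for t, continuous u}.
Proof.
move=> H; apply: differentiable_continuous; apply/derivable1_diffP; exact: ex_derive.
Qed.

Lemma is_derive_coord m n (u : R -> 'M[R]_(m, n)) (t : R) du i j :
  is_derive t 1 u du -> is_derive t 1 (fun s => u s i j) (du i j).
Proof.
move=> H; have D := @ex_derive _ _ _ _ _ _ _ H; apply: DeriveDef.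
  by move/derivable_mxP: D; apply.
by have := derive_mx D; rewrite derive_val => ->; rewrite mxE.
Qed.

Lemma is_derive_mx m n (u : R -> 'M[R]_(m, n)) (t : R) (du : 'M[R]_(m, n)) :
  (forall i j, is_derive t 1 (fun s => u s i j) (du i j)) -> is_derive t 1 u du.
Proof.
move=> H.
have D : derivable u t 1 by apply/derivable_mxP => i j; exact: ex_derive.
apply: DeriveDef => //; rewrite derive_mx //; apply/matrixP => i j.
by rewrite mxE; exact: derive_val.
Qed.

Lemma mvt_scalar (u du : R -> R) (a b : R) : a <= b ->
  (forall t, a <= t <= b -> is_derive t 1 u (du t)) ->
  exists2 c, a <= c <= b & u b - u a = du c * (b - a).
Proof.
move=> ab H.
have [||c cab E] := @MVT_segment R u du a b ab.
- by move=> t; rewrite in_itv /= => /andP[/ltW ta /ltW tb]; apply: H; rewrite ta tb.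
- apply: derivable_within_continuous => t; rewrite in_itv /= => tab.
  by have [] := H _ tab.
by exists c => //; move: cab; rewrite in_itv.
Qed.

(** The norm is the maximum of the coordinates, so the scalar mean value theorem can be applied to
    one coordinate at a time. *)
Lemma mvi_curve n (u du : R -> 'rV[R]_n) (a b M : R) : a <= b -> 0 <= M ->
  (forall t, a <= t <= b -> is_derive t 1 u (du t) /\ `|du t| <= M) ->
  `|u b - u a| <= M * (b - a).
Proof.
move=> ab M0 H; apply/rv_norm_leP; first by rewrite mulr_ge0 // subr_ge0.
move=> i j; rewrite !mxE.
have [|c cab ->] := @mvt_scalar (fun s => u s i j) (fun s => du s i j) a b ab.
  by move=> t /H [D _]; exact: is_derive_coord.
have [_ bc] := H _ cab.
rewrite normrM [`|b - a|]ger0_norm ?subr_ge0 //.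
rewrite ler_wpM2r ?subr_ge0 //; exact: le_trans (rv_norm_coord _ _ _) bc.
Qed.

(** The mean value inequality for [f (z + t *: h) - t *: l]. With l = 0 it gives Lipschitz bounds,
    with l the derivative at z the remainder of order two. *)
Lemma mvi_segment V n (f : V -> 'rV[R]_n) (z h : V) (l : 'rV[R]_n) (C : R) : 0 <= C ->
  (forall t : R, 0 <= t <= 1 -> differentiable f (z + t *: h) /\
     `|'D_h f (z + t *: h) - l| <= C) ->
  `|f (z + h) - f z - l| <= C.
Proof.
move=> C0 H.
have := @mvi_curve n (fun t => f (z + t *: h) - t *: l)
  (fun t => 'D_h f (z + t *: h) - l) 0 1 C ler01 C0.
rewrite subr0 mulr1 !scale1r !scale0r addr0 subr0 addrAC; apply => t t01.
have [df bd] := H _ t01; split=> //.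
apply: is_deriveB; first exact: is_derive_line.
exact: is_derive_scalel.
Qed.

Lemma row_sum_scale n (h : 'rV[R]_n) : h = \sum_j h 0 j *: delta_mx 0 j.
Proof. by rewrite {1}(matrix_sum_delta h) big_ord1. Qed.

Lemma derive_sum_coord n (W : normedModType R) (f : 'rV[R]_n -> W) (x h : 'rV[R]_n) :
  differentiable f x -> 'D_h f x = \sum_j h 0 j *: 'D_(delta_mx 0 j) f x.
Proof.
move=> df; rewrite deriveE // {1}(row_sum_scale h) linear_sum.
by apply: eq_bigr => j _; rewrite linearZ deriveE.
Qed.

(* The increment along h is split into n increments parallel to the axes, each
   of which is evaluated by the mean value theorem. *)
Lemma differentiable_partial n (f : 'rV[R]_n -> R) (x : 'rV[R]_n) :
  (\forall y \near x, forall i : 'I_n, derivable f y (delta_mx 0 i)) ->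
  (forall i : 'I_n, {for x, continuous (fun y => 'D_(delta_mx 0 i) f y)}) ->
  differentiable f x.
Proof.
move=> df cf.
pose L (h : 'rV[R]_n) : R := \sum_j h 0 j *: 'D_(delta_mx 0 j) f x.
have Llin : linear L.
  move=> a b c; rewrite /L scaler_sumr -big_split; apply: eq_bigr => j _.
  by rewrite !mxE scalerDl scalerA.
pose LM := GRing.isLinear.Build _ _ _ _ _ Llin.
pose LL : {linear 'rV[R]_n -> R} := HB.pack L LM.
have Lc : continuous LL by move=> y; exact: (Cn_linmx 0 LL y).
suff /(near_le_differentiable Lc)[] : forall e : R, 0 < e -> \forall h \near (0 : 'rV[R]_n),
    `|f (x + h) - f x - LL h| <= e * `|h| by [].
move=> e e0.
(* There are n increments, each with error at most [e'] times the norm of h; dividing by n + 1 also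
   covers n = 0. *)
pose e' := e / (n.+1)%:R.
have e'0 : 0 < e' by rewrite divr_gt0.
have : \forall y \near x, (forall i : 'I_n, derivable f y (delta_mx 0 i)) /\
    forall i : 'I_n, `|'D_(delta_mx 0 i) f y - 'D_(delta_mx 0 i) f x| <= e'.
  have E : \forall y \near x, forall i : 'I_n,
      `|'D_(delta_mx 0 i) f y - 'D_(delta_mx 0 i) f x| <= e'.
    apply: (@filter_forall _ _ (fun (i : 'I_n) y =>
      `|'D_(delta_mx 0 i) f y - 'D_(delta_mx 0 i) f x| <= e') (nbhs x) _).
    move=> i; have /cvgrPdist_le /(_ _ e'0) := cf i.
    by apply: filterS => y; rewrite distrC.
  by apply: filterS2 df E => y.
move=> /nbhs_ballP [r /= r0 Hr].
apply/nbhs_ballP; exists r => //= h; rewrite -ball_normE /= sub0r normrN => hr.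
pose tr (j : nat) : 'rV[R]_n := \row_i (if (i < j)%N then h 0 i else 0).
have trn : tr n = h by apply/rowP => i; rewrite mxE ltn_ord.
have tr0 : tr 0%N = 0 by apply/rowP => i; rewrite !mxE.
have step (j : 'I_n) : `|f (x + tr j.+1) - f (x + tr j) - h 0 j *: 'D_(delta_mx 0 j) f x|
    <= e' * `|h|.
  have trS : tr j.+1 = tr j + h 0 j *: delta_mx 0 j.
    apply/rowP => i; rewrite !mxE eqxx /= ltnS leq_eqVlt.
    case: (eqVneq i j) => [->|ij]; first by rewrite eqxx /= ltnn add0r mulr1.
    by rewrite -val_eqE in ij; rewrite (negbTE ij) /= mulr0 addr0.
  (* Truncating h does not increase its maximum norm, so the whole broken line from x to x + h stays
     in the ball. *)
  have inb (t : R) : 0 <= t <= 1 -> ball x r (x + tr j + (t * h 0 j) *: delta_mx 0 j).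
    move=> /andP[t0 t1]; rewrite -ball_normE /= -addrA opprD addNKr normrN.
    apply: le_lt_trans hr; apply/rv_norm_leP => // i k; rewrite (ord1 i) !mxE eqxx /=.
    have [->|kj] := eqVneq k j.
      rewrite ltnn add0r mulr1 normrM ger0_norm //.
      by rewrite (le_trans _ (rv_norm_coord h 0 j)) // ler_piMl.
    rewrite mulr0 addr0; case: ifP => _; first exact: rv_norm_coord.
    by rewrite normr0.
  have D (t : R) : 0 <= t <= 1 -> is_derive t 1 (fun s : R => f (x + tr j + (s * h 0 j) *: delta_mx 0 j))
     (h 0 j *: 'D_(delta_mx 0 j) f (x + tr j + (t * h 0 j) *: delta_mx 0 j)).
    move=> t01; have [/(_ j) dj _] := Hr _ (inb _ t01).
    set w := x + tr j + _ in dj *.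
    have : is_derive t 1 (fun s => f (w + ((s - t) * h 0 j) *: delta_mx 0 j))
        (h 0 j *: 'D_(delta_mx 0 j) f w).
      pose u (s : R) : R := (s - t) * h 0 j.
      have ut : u t = 0 by rewrite /u subrr mul0r.
      have du : is_derive t 1 u (h 0 j).
        rewrite (_ : u = (h 0 j \*: (id - cst t))); last first.
          by apply/funext => s; rewrite /u mulrC.
        by apply: is_derive_eq; rewrite subr0 /GRing.scale /= mulr1.
      have D0 := is_derive_axis dj; rewrite -ut in D0.
      exact: is_derive1_comp du D0.
    apply: is_derive_ext => s; congr (f _).
    by rewrite /w -addrA -scalerDl -mulrDl subrKC.
  have [c c01] := mvt_scalar ler01 D.
  rewrite mul0r scale0r addr0 mul1r subr0 mulr1 -addrA -trS => ->.
  rewrite -scalerBr normrZ mulrC ler_pM //; last exact: rv_norm_coord.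
  by have [_ /(_ j)] := Hr _ (inb _ c01).
rewrite /=; have -> : f (x + h) - f x - L h = \sum_(j < n)
    (f (x + tr j.+1) - f (x + tr j) - h 0 j *: 'D_(delta_mx 0 j) f x).
  rewrite big_split /= sumrN; congr (_ - _).
  rewrite -(big_mkord xpredT (fun j => f (x + tr j.+1) - f (x + tr j))).
  by rewrite telescope_sumr // trn tr0 addr0.
rewrite (le_trans (ler_norm_sum _ _ _)) //.
rewrite (le_trans (ler_sum _ (fun j _ => step j))) //.
rewrite sumr_const card_ord -mulr_natl mulrA ler_wpM2r // /e' mulrC.
rewrite -mulrA ler_piMr ?(ltW e0) // mulrC ler_pdivrMr // mul1r ler_nat //.
Qed.

(** Continuity of the partial derivatives near x gives differentiability there, and the tangent map
    is then the sum of the products of [h 0 j] with the j-th partial derivative, a C^k function of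
    (y, h). *)
Lemma Cn_partial_scalar k n (f : 'rV[R]_n -> R) (x : 'rV[R]_n) :
  (\forall y \near x, forall i : 'I_n, derivable f y (delta_mx 0 i) /\
     Cn k (fun y => 'D_(delta_mx 0 i) f y) y) -> Cn k.+1 f x.
Proof.
move=> H.
have df : \forall y \near x, differentiable f y.
  have := near_join H; apply: filterS2 H => y Hy Ny.
  apply: differentiable_partial; first by apply: filterS Ny => z Hz i; case: (Hz i).
  by move=> i; case: (Hy i) => _ /Cn_continuous.
split=> // h.
apply: (@Cn_near_eq1 _ _ _ _ _ (fun q : 'rV[R]_n * 'rV[R]_n =>
    \sum_j q.2 0 j * 'D_(delta_mx 0 j) f q.1 : R)).
  by apply: filterS df => y dy z /=; rewrite derive_sum_coord.
apply: Cn_sum => j _; apply: Cn_M; first by apply: Cn_coord; exact: Cn_snd.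
apply: (@Cn_comp _ _ _ _ _ fst ('D_(delta_mx 0 j) f)); first exact: Cn_fst.
by case: (nbhs_singleton H j).
Qed.

Lemma Cn_partial k m n (f : 'rV[R]_n -> 'rV[R]_m) (x : 'rV[R]_n) :
  (\forall y \near x, forall i : 'I_n, derivable f y (delta_mx 0 i) /\
     Cn k (fun y => 'D_(delta_mx 0 i) f y) y) -> Cn k.+1 f x.
Proof.
move=> H; apply: Cn_mx => a b; apply: Cn_partial_scalar.
have := near_join H; apply: filterS2 H => y Hy Ny i; split.
  by have [/derivable_mxP] := Hy i.
have [_ Cy] := Hy i; apply: Cn_near_eq (Cn_coord a b Cy).
apply: filterS Ny => z /(_ i) [dz _].
by rewrite derive_mx // mxE.
Qed.

Lemma iter_partial_rcons n (W : normedModType R) (s : seq 'I_n) i (f : 'rV[R]_n -> W) :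
  iter_partial (rcons s i) f = iter_partial s (fun x => 'D_(delta_mx 0 i) f x).
Proof. by rewrite /iter_partial foldr_rcons. Qed.

Lemma smooth_on_partial n (W : normedModType R) (U : set 'rV[R]_n) i (f : 'rV[R]_n -> W) :
  smooth_on U f -> smooth_on U (fun x => 'D_(delta_mx 0 i) f x).
Proof. by move=> Hf s x Ux; rewrite -iter_partial_rcons; exact: Hf. Qed.

Lemma smooth_on_smooth_scalar n (U : set 'rV[R]_n) (f : 'rV[R]_n -> R) : open U ->
  smooth_on U f -> forall x, U x -> smooth f x.
Proof.
move=> oU + x + k; elim: k f x => [|k IH] f x Hf Ux; first by have [] := Hf [::] x Ux.
apply: Cn_partial_scalar; have : \forall y \near x, U y by exact: open_nbhs_nbhs.
apply: filterS => y Uy i; split; first by have [_] := Hf [::] y Uy; apply.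
exact: IH (smooth_on_partial i Hf) Uy.
Qed.

Lemma smooth_on_smooth m n (U : set 'rV[R]_n) (f : 'rV[R]_n -> 'rV[R]_m) : open U ->
  smooth_on U f -> forall x, U x -> smooth f x.
Proof.
move=> oU + x + k; elim: k f x => [|k IH] f x Hf Ux; first by have [] := Hf [::] x Ux.
apply: Cn_partial; have : \forall y \near x, U y by exact: open_nbhs_nbhs.
apply: filterS => y Uy i; split; first by have [_] := Hf [::] y Uy; apply.
exact: IH (smooth_on_partial i Hf) Uy.
Qed.

Lemma smooth_smooth_on n (W : normedModType R) (U : set 'rV[R]_n) (f : 'rV[R]_n -> W) :
  (forall x, U x -> smooth f x) -> smooth_on U f.
Proof.
move=> Hf s x Ux.
have S : smooth (iter_partial s f) x.
  elim: s => [|i s IH]; [exact: Hf | exact: smooth_derive].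
split; first exact: smooth_continuous.
by move=> i; apply: diff_derivable; exact: smooth_diff.
Qed.

Lemma norm_ball (V : normedModType R) (x y : V) (r : R) : `|x - y| < r -> ball x r y.
Proof. by rewrite -ball_normE. Qed.

Lemma ball_norm_lt (V : normedModType R) (x y : V) (r : R) : ball x r y -> `|x - y| < r.
Proof. by rewrite -ball_normE. Qed.

Lemma near_norm_lt (V : normedModType R) (t : V) (a : R) :
  `|t| < a -> \forall s \near t, `|s| < a.
Proof.
move=> ta; apply/nbhs_ballP; exists (a - `|t|); rewrite /= ?subr_gt0 // => s.
rewrite -ball_normE /= => H; have := ler_normD (s - t) t; rewrite subrK distrC => H'.
by apply: le_lt_trans H' _; rewrite -ltrBrDr.
Qed.

(** Gronwall estimates for flows produce a remainder of exactly this quadratic form. *)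
Lemma quad_is_derive (V W : normedModType R) (F : V -> W) (x h : V) (w : W) (C : R) :
  0 <= C ->
  (\forall s \near (0 : R), `|F (x + s *: h) - F x - s *: w| <= C * `|s| * `|s|) ->
  is_derive x h F w.
Proof.
move=> C0 H.
suff cv : (fun s : R => s^-1 *: ((F \o shift x) (s *: h) - F x)) @ 0^' --> w.
  apply: DeriveDef; first by apply/cvg_ex; exists w.
  by rewrite /derive; exact: cvg_lim cv.
apply/cvgrPdist_le => e e0.
have H2 : \forall s \near (0 : R), `|s| < e / (C + 1).
  by apply: near_norm_lt; rewrite normr0 divr_gt0 // ltr_wpDl.
have [H1 H2'] : (\forall s \near (0 : R)^', `|F (x + s *: h) - F x - s *: w| <= C * `|s| * `|s|)
   /\ (\forall s \near (0 : R)^', `|s| < e / (C + 1)).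
  by split; exact: nbhs_dnbhs.
near=> s.
have s0 : s != 0 by near: s; exact: nbhs_dnbhs_neq.
have h1 : `|F (x + s *: h) - F x - s *: w| <= C * `|s| * `|s| by near: s.
have h2 : `|s| < e / (C + 1) by near: s.
have -> : w - s^-1 *: ((F \o shift x) (s *: h) - F x) =
   - (s^-1 *: (F (x + s *: h) - F x - s *: w)).
  by rewrite /= [s *: h + x]addrC [in RHS]scalerBr scalerA mulVf // scale1r opprB.
rewrite normrN normrZ normfV ler_pdivrMl ?normr_gt0 //.
apply: le_trans h1 _; rewrite mulrAC [_ * e]mulrC ler_wpM2r // mulrC.
move: h2; rewrite ltr_pdivlMr ?ltr_wpDl // => h2.
by apply: le_trans (ltW h2); rewrite ler_wpM2l // lerDl.
Unshelve. all: by end_near. Qed.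

End RowVectors.

(** * Second derivatives *)

(* Unfolding these during unification makes rewriting diverge. *)
#[local] Opaque derive diff.
Section LocalEstimates.
Context {R : realType}.
Implicit Types (V : normedModType R).

Lemma ball_segment n (x z h : 'rV[R]_n) (r t : R) : ball x r z -> ball x r (z + h) ->
  0 <= t <= 1 -> ball x r (z + t *: h).
Proof.
rewrite -!ball_normE /= => H1 H2 /andP[t0 t1].
have -> : x - (z + t *: h) = (1 - t) *: (x - z) + t *: (x - (z + h)).
  by apply/rowP => i; rewrite !mxE; ring.
rewrite (le_lt_trans (ler_normD _ _)) // !normrZ (ger0_norm t0) ger0_norm ?subr_ge0 //.
have [->|tn1] := eqVneq t 1; first by rewrite subrr mul0r add0r mul1r.
have t1' : 0 < 1 - t by rewrite subr_gt0 lt_neqAle tn1.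
have -> : r = (1 - t) * r + t * r by ring.
rewrite ltr_leD //.
  by rewrite ltr_pM2l.
by rewrite ler_wpM2l // ltW.
Qed.

Lemma derive_locally_bounded n W (f : 'rV[R]_n -> (W : normedModType R)) x : smooth f x ->
  exists2 K : R, 0 < K & \forall y \near x,
    differentiable f y /\ forall h, `|'D_h f y| <= K * `|h|.
Proof.
(* The leading 1 keeps K positive in dimension 0; the 1 in each summand absorbs the variation of
   that partial derivative near x. *)
move=> sf; pose K := 1 + \sum_(j < n) (`|'D_(delta_mx 0 j) f x| + 1).
have K0 : 0 < K by rewrite ltr_pwDl // sumr_ge0 // => j _; rewrite addr_ge0.
exists K => //.
have B : \forall y \near x, forall j : 'I_n,
    `|'D_(delta_mx 0 j) f y| <= `|'D_(delta_mx 0 j) f x| + 1.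
  apply: (@filter_forall _ _ (fun (j : 'I_n) y =>
      `|'D_(delta_mx 0 j) f y| <= `|'D_(delta_mx 0 j) f x| + 1) (nbhs x) _) => j.
  have := smooth_continuous (smooth_derive (delta_mx 0 j) sf).
  move=> /cvgrPdist_le /(_ 1 ltr01); apply: filterS => y H.
  rewrite -lerBlDl; apply: le_trans H; rewrite distrC; exact: lerB_dist.
apply: filterS2 (smooth_near_diff sf) B => y dy By; split=> // h.
rewrite derive_sum_coord // (le_trans (ler_norm_sum _ _ _)) //.
rewrite mulrDl mul1r mulr_suml ler_wpDl // ler_sum // => j _.
by rewrite normrZ mulrC ler_pM // rv_norm_coord.
Qed.

Lemma smooth_lipschitz m n (f : 'rV[R]_n -> 'rV[R]_m) x : smooth f x ->
  exists2 K : R, 0 < K & exists2 r : R, 0 < r & forall y z,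
    ball x r y -> ball x r z -> `|f y - f z| <= K * `|y - z|.
Proof.
move=> /derive_locally_bounded [K K0 /nbhs_ballP [r /= r0 H]].
exists K => //; exists r => // y z Hy Hz.
have := @mvi_segment R _ _ f z (y - z) 0 (K * `|y - z|).
rewrite subrKC subr0; apply; first by rewrite mulr_ge0 // ltW.
move=> t t01; have /H[df B] : ball x r (z + t *: (y - z)).
  by apply: ball_segment => //; rewrite subrKC.
by rewrite subr0.
Qed.

Lemma smooth_local_estimates m n (f : 'rV[R]_n -> 'rV[R]_m) x : smooth f x ->
  exists2 K : R, 0 < K & exists2 r : R, 0 < r & forall y, ball x r y ->
   [/\ differentiable f y, forall h, `|'D_h f y| <= K * `|h|,
    forall z, ball x r z -> `|f y - f z| <= K * `|y - z|,
    forall z h, ball x r z -> `|'D_h f y - 'D_h f z| <= K * `|y - z| * `|h| &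
    forall h, ball x r (y + h) -> `|f (y + h) - f y - 'D_h f y| <= K * `|h| * `|h|].
Proof.
move=> sf; have [K1 K10 H1] := derive_locally_bounded sf.
have [K2 K20 [r2 r20 H2]] := smooth_lipschitz sf.
have H3 : exists2 K3 : R, 0 < K3 & exists2 r3 : R, 0 < r3 & forall (j : 'I_n) y z,
    ball x r3 y -> ball x r3 z ->
    `|'D_(delta_mx 0 j) f y - 'D_(delta_mx 0 j) f z| <= K3 * `|y - z|.
  have Hj (j : 'I_n) := smooth_lipschitz (smooth_derive (delta_mx 0 j) sf).
  have [K HK] := choice (fun j => let: ex_intro2 a b c := Hj j in
     ex_intro (fun K => 0 < K /\ exists2 r : R, 0 < r & forall y z,
    ball x r y -> ball x r z -> `|'D_(delta_mx 0 j) f y - 'D_(delta_mx 0 j) f z| <= K * `|y - z|)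
     a (conj b c)).
  (* Stated for all small r > 0, so that the finitely many directions j admit a common radius. *)
  have Hr (j : 'I_n) : \forall r \near (0 : R)^'+, forall y z,
    ball x r y -> ball x r z -> `|'D_(delta_mx 0 j) f y - 'D_(delta_mx 0 j) f z| <= K j * `|y - z|.
    have [_ [r r0 H]] := HK j; near=> s => y z Hy Hz.
    by apply: H; [apply: le_ball Hy | apply: le_ball Hz]; near: s; exact: nbhs_right_le.
  have [r [r0 Hr']] : exists r : R, 0 < r /\ forall (j : 'I_n) y z,
      ball x r y -> ball x r z -> `|'D_(delta_mx 0 j) f y - 'D_(delta_mx 0 j) f z| <= K j * `|y - z|.
    apply: (@filter_ex _ (0 : R)^'+); apply: filterI; first exact: nbhs_right_gt.
    exact: filter_forall Hr.
  exists (1 + \sum_j K j).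
    by rewrite ltr_pwDl // sumr_ge0 // => j _; case: (HK j) => /ltW.
  exists r => // j y z Hy Hz; apply: le_trans (Hr' j y z Hy Hz) _.
  rewrite ler_wpM2r // (bigD1 j) //= addrCA lerDl addr_ge0 // sumr_ge0 // => i _.
  by case: (HK i) => /ltW.
have [K3 K30 [r3 r30 {}H3]] := H3.
move/nbhs_ballP: H1 => [r1 /= r10 H1].
pose r := Num.min r1 (Num.min r2 r3).
have r0 : 0 < r by rewrite !lt_min r10 r20.
have b1 y : ball x r y -> ball x r1 y by apply: le_ball; rewrite ge_min lexx.
have b2 y : ball x r y -> ball x r2 y by apply: le_ball; rewrite !ge_min lexx orbT.
have b3 y : ball x r y -> ball x r3 y by apply: le_ball; rewrite !ge_min lexx !orbT.
pose K := K1 + K2 + K3 * n%:R.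
have K3n : 0 <= K3 * n%:R by rewrite mulr_ge0 // ltW.
have K0 : 0 < K by rewrite ltr_wpDr // addr_gt0.
have D2 y z h : ball x r y -> ball x r z -> `|'D_h f y - 'D_h f z| <= K3 * n%:R * `|y - z| * `|h|.
  move=> Hy Hz; have [dy _] := H1 _ (b1 _ Hy); have [dz _] := H1 _ (b1 _ Hz).
  rewrite !derive_sum_coord // -sumrB (le_trans (ler_norm_sum _ _ _)) //.
  have -> : K3 * n%:R * `|y - z| * `|h| = \sum_(j < n) `|h| * (K3 * `|y - z|).
    by rewrite sumr_const card_ord -mulr_natl; ring.
  apply: ler_sum => j _; rewrite -scalerBr normrZ ler_pM //; first exact: rv_norm_coord.
  by apply: H3; exact: b3.
exists K => //; exists r => // y Hy; have [dy By] := H1 _ (b1 _ Hy); split => //.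
- move=> h; apply: le_trans (By h) _; rewrite ler_wpM2r // /K -addrA lerDl addr_ge0 //.
  exact: ltW.
- move=> z Hz; apply: le_trans (H2 y z (b2 _ Hy) (b2 _ Hz)) _; rewrite ler_wpM2r //.
  by rewrite /K addrAC lerDr addr_ge0 // ltW.
- move=> z h Hz; apply: le_trans (D2 _ _ _ Hy Hz) _.
  by rewrite !ler_wpM2r // /K lerDr addr_ge0 // ltW.
move=> h Hyh; apply: mvi_segment; first by rewrite !mulr_ge0 // ltW.
move=> t t01; have Hyt := ball_segment Hy Hyh t01.
have [dt _] := H1 _ (b1 _ Hyt); split=> //.
apply: le_trans (D2 _ _ _ Hyt Hy) _; rewrite ler_wpM2r // addrAC subrr add0r normrZ.
case/andP: t01 => t0 t1; rewrite (ger0_norm t0).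
apply: ler_pM => //; [exact: mulr_ge0 | by rewrite /K lerDr addr_ge0 // ltW|].
by rewrite ler_piMl.
Unshelve. all: by end_near. Qed.

(** Two applications of the mean value theorem, first along h and then along k. The second
    difference itself is symmetric in h and k, which is the source of the symmetry of second
    derivatives. *)
Lemma second_difference V (f : V -> R) (x h k : V) : smooth f x ->
  \forall s \near (0 : R)^'+, exists2 y, `|y - x| <= s * (`|h| + `|k|) &
    f (x + s *: h + s *: k) - f (x + s *: h) - f (x + s *: k) + f x =
    s * s * 'D_k (fun z => 'D_h f z) y.
Proof.
move=> sf.
have /nbhs_ballP[r /= r0 H] : \forall y \near x,
    differentiable f y /\ differentiable (fun z => 'D_h f z) y.
  by apply: filterI; [exact: smooth_near_diff | exact/smooth_near_diff/smooth_derive].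
have hk : 0 < `|h| + `|k| + 1 by rewrite ltr_wpDl // addr_ge0.
near=> s.
have s0 : 0 < s by near: s; exact: nbhs_right_gt.
have sr : s * (`|h| + `|k|) < r.
  have : s < r / (`|h| + `|k| + 1) by near: s; apply: nbhs_right_lt; rewrite divr_gt0.
  rewrite ltr_pdivlMr // => H'; apply: le_lt_trans H'; rewrite ler_pM2l //.
  by rewrite lerDl.
have inb (a b : R) : 0 <= a <= s -> 0 <= b <= s ->
    `|x + a *: h + b *: k - x| <= s * (`|h| + `|k|).
  move=> /andP[a0 as_] /andP[b0 bs]; rewrite -(addrA x) (addrC x) addrK.
  rewrite (le_trans (ler_normD _ _)) // !normrZ !ger0_norm // mulrDr.
  by rewrite lerD // ler_wpM2r.
have inB (a b : R) : 0 <= a <= s -> 0 <= b <= s -> ball x r (x + a *: h + b *: k).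
  by move=> Ha Hb; rewrite -ball_normE /= distrC; apply: le_lt_trans sr; exact: inb.
have s00 : 0 <= (0 : R) <= s by rewrite lexx ltW.
have sss : 0 <= s <= s by rewrite lexx ltW.
have [c c0s E1] : exists2 c, 0 <= c <= s &
    (f (x + s *: h + s *: k) - f (x + s *: h)) - (f (x + s *: k) - f x) =
    ('D_h f (x + c *: h + s *: k) - 'D_h f (x + c *: h)) * s.
  have := @mvt_scalar R (fun t => f (x + s *: k + t *: h) - f (x + t *: h))
    (fun t => 'D_h f (x + s *: k + t *: h) - 'D_h f (x + t *: h)) 0 s (ltW s0).
  case.
    move=> t t0s; apply: is_deriveB; apply: is_derive_line.
      by rewrite addrAC; case: (H _ (inB _ _ t0s sss)).
    by have [] := H _ (inB _ _ t0s s00); rewrite scale0r addr0.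
  move=> c c0s; rewrite !scale0r !addr0 subr0 => E; exists c => //.
  by move: E; rewrite ![x + s *: k + _]addrAC.
have [d d0s E2] : exists2 d, 0 <= d <= s &
    'D_h f (x + c *: h + s *: k) - 'D_h f (x + c *: h) =
    'D_k (fun z => 'D_h f z) (x + c *: h + d *: k) * s.
  have := @mvt_scalar R (fun t => 'D_h f (x + c *: h + t *: k))
    (fun t => 'D_k (fun z => 'D_h f z) (x + c *: h + t *: k)) 0 s (ltW s0).
  case.
    move=> t t0s; apply: (@is_derive_line _ _ _ (fun z => 'D_h f z)).
    by case: (H _ (inB _ _ c0s t0s)).
  by move=> d d0s; rewrite scale0r addr0 subr0 => E; exists d.
exists (x + c *: h + d *: k); first exact: inb.
rewrite -addrA [- f _ + f x]addrC -[f x - _]opprB E1 E2 mulrC.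
by rewrite [_ * s in LHS]mulrC mulrA.
Unshelve. all: by end_near. Qed.

Lemma continuous_eq_at V (u v : V -> R) (x : V) :
  {for x, continuous u} -> {for x, continuous v} ->
  (forall r : R, 0 < r -> exists y z, [/\ ball x r y, ball x r z & u y = v z]) ->
  u x = v x.
Proof.
move=> cu cv H; apply/eqP; rewrite -subr_eq0 -normr_le0; apply/ler_addgt0Pr => e e0.
rewrite add0r; have e20 : 0 < e / 2 by rewrite divr_gt0.
have /nbhs_ballP[r /= r0 Hr] : \forall y \near x, `|u x - u y| <= e / 2 /\ `|v x - v y| <= e / 2.
  by apply: filterI; [move/cvgrPdist_le: cu; apply | move/cvgrPdist_le: cv; apply].
have [y [z [/Hr[uy _] /Hr[_ vz] E]]] := H _ r0.
have -> : u x - v x = (u x - u y) - (v x - v z) by rewrite E; ring.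
by rewrite [e]splitr (le_trans (ler_normB _ _)) // lerD.
Qed.

(** For the same s the second difference is s * s times either mixed derivative, each taken at some
    point close to x; continuity of both lets s tend to 0. *)
Lemma derive_sym_scalar V (f : V -> R) (x h k : V) : smooth f x ->
  'D_h (fun y => 'D_k f y) x = 'D_k (fun y => 'D_h f y) x.
Proof.
move=> sf; apply: (@continuous_eq_at _ (fun y => 'D_h (fun z => 'D_k f z) y)
  (fun y => 'D_k (fun z => 'D_h f z) y)).
- exact: smooth_continuous (smooth_derive h (smooth_derive k sf)).
- exact: smooth_continuous (smooth_derive k (smooth_derive h sf)).
move=> r r0.
have hk : 0 < `|h| + `|k| + 1 by rewrite ltr_wpDl // addr_ge0.
have [s [[[y yx E1] [z zx E2]] [s0 sr]]] := filter_ex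
  (filterI (filterI (second_difference h k sf) (second_difference k h sf))
   (filterI (nbhs_right_gt 0) (nbhs_right_lt (divr_gt0 r0 hk)))).
have sr' : s * (`|h| + `|k|) < r.
  move: sr; rewrite ltr_pdivlMr // => H'; apply: le_lt_trans H'; rewrite ler_pM2l //.
  by rewrite lerDl.
exists z, y; split.
- by rewrite -ball_normE /= distrC; apply: le_lt_trans zx _; rewrite addrC.
- by rewrite -ball_normE /= distrC; apply: le_lt_trans yx _.
apply: (@mulfI _ (s * s)); first by rewrite mulf_neq0 // gt_eqF.
apply: etrans (esym E2) (etrans _ E1).
by rewrite [x + s *: h + _]addrAC; ring.
Qed.

Lemma derive_sym n V (f : V -> 'rV[R]_n) (x h k : V) : smooth f x ->
  'D_h (fun y => 'D_k f y) x = 'D_k (fun y => 'D_h f y) x.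
Proof.
move=> sf; apply/matrixP => i j.
have sfi : smooth (fun y => f y i j) x by move=> l; exact: Cn_coord.
have E l : \forall y \near x, 'D_l f y i j = 'D_l (fun y => f y i j) y.
  by apply: filterS (smooth_near_diff sf) => y dy; rewrite derive_coord.
apply: (etrans (esym (derive_coord h i j (smooth_diff (smooth_derive k sf))))).
apply: (etrans _ (derive_coord k i j (smooth_diff (smooth_derive h sf)))).
apply: (etrans (near_eq_derive h (E k))); apply: (etrans _ (esym (near_eq_derive k (E h)))).
exact: derive_sym_scalar.
Qed.

Lemma derive_fst V1 V2 (W : normedModType R) (T : V1 * V2 -> W) (x h : V1) (k : V2) :
  differentiable T (x, k) -> 'D_h (fun y => T (y, k)) x = 'D_(h, 0) T (x, k).
Proof.
move=> dT.
have d1 : is_diff x (fun y => (y, k) : V1 * V2) (fun y => (y, 0)).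
  exact: is_diff_pair.
rewrite (@derive_comp _ _ _ _ (fun y => (y, k) : V1 * V2) T x h ex_diff dT).
by rewrite (deriveE _ ex_diff) diff_val.
Qed.

Lemma derive_snd V1 V2 (W : normedModType R) (T : V1 * V2 -> W) (x : V1) (k l : V2) :
  differentiable T (x, k) -> 'D_l (fun y => T (x, y)) k = 'D_(0, l) T (x, k).
Proof.
move=> dT.
have d2 : is_diff k (fun y => (x, y) : V1 * V2) (fun y => (0, y)).
  exact: is_diff_pair.
rewrite (@derive_comp _ _ _ _ (fun y => (x, y) : V1 * V2) T k l ex_diff dT).
by rewrite (deriveE _ ex_diff) diff_val.
Qed.

Lemma derive_pair_split V1 V2 (W : normedModType R) (T : V1 * V2 -> W) (x h : V1) (k l : V2) :
  differentiable T (x, k) ->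
  'D_(h, l) T (x, k) = 'D_h (fun y => T (y, k)) x + 'D_l (fun y => T (x, y)) k.
Proof.
move=> dT; rewrite derive_fst // derive_snd // -(deriveDl _ _ dT).
by congr ('D_ _ _ _); congr (_, _); rewrite /= ?addr0 ?add0r.
Qed.

Lemma derive_dir V (W : normedModType R) (f : V -> W) (x k l : V) :
  differentiable f x -> 'D_l (fun y => 'D_y f x) k = 'D_l f x.
Proof.
move=> df; have Dl := linear_differentiable k (diff_continuous df).
have -> : (fun y => 'D_y f x) = 'd f x by apply/funext => y; rewrite deriveE.
rewrite (deriveE l Dl) (deriveE l df) diff_lin //; exact: diff_continuous.
Qed.

(* The second term is the derivative along the fibre, where the tangent map is linear. *)
Lemma derive_tangent V (W : normedModType R) (f : V -> W) (x k h l : V) : smooth f x ->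
  'D_(h, l) (fun q : V * V => 'D_q.2 f q.1) (x, k) = 'D_h (fun y => 'D_k f y) x + 'D_l f x.
Proof.
move=> sf; rewrite (derive_pair_split _ _ (smooth_diff (smooth_tangent k sf))) /=.
by rewrite derive_dir //; exact: smooth_diff.
Qed.

End LocalEstimates.

(** * Ordinary differential equations *)

Section FlowEstimates.
Context {R : realType}.

Lemma primitive_near (g : R -> R) (A : R) : 0 < A -> continuous g ->
  exists G : R -> R, forall t : R, `|t| < A -> is_derive t 1 G (g t).
Proof.
move=> A0 cg.
exists (fun x : R => \int[lebesgue_measure]_(t in `[- A, x]) g t).
move=> t; rewrite ltr_norml => /andP[t1 t2].
have [|d1 d2] := @continuous_FTC1_closed R g (- A) t A t2 _ t1 (cg t).
  apply: continuous_compact_integrable; first exact: segment_compact.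
  exact: continuous_subspaceT.
exact: (DeriveDef d1 (etrans (esym (derive1E _ _)) d2)).
Qed.

Lemma eq_derive_cst (u v : R -> R) (a : R) (d : R -> R) :
  (forall t : R, `|t| < a -> is_derive t 1 u (d t)) ->
  (forall t : R, `|t| < a -> is_derive t 1 v (d t)) ->
  forall t : R, `|t| < a -> u t - u 0 = v t - v 0.
Proof.
move=> Hu Hv t ta.
have D (s : R) : `|s| <= `|t| -> is_derive s 1 (fun s => u s - v s) 0.
  move=> st; have sa := le_lt_trans st ta.
  by rewrite -(subrr (d s)); apply: is_deriveB; [exact: Hu | exact: Hv].
suff : u t - v t = u 0 - v 0 by lra.
case: (leP 0 t) => t0.
  have [|c _] := @mvt_scalar R (fun s => u s - v s) (fun=> 0) 0 t t0.
    by move=> s /andP[s0 st]; apply: D; rewrite !ger0_norm.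
  by rewrite mul0r => /eqP; rewrite subr_eq0 => /eqP.
have [|c _] := @mvt_scalar R (fun s => u s - v s) (fun=> 0) t 0 (ltW t0).
  by move=> s /andP[st s0]; apply: D; rewrite (ler0_norm s0) (ltr0_norm t0) lerN2.
by rewrite mul0r => /eqP; rewrite subr_eq0 eq_sym => /eqP.
Qed.

(** Primitives on the intervals [|t| < N + 1], normalised to vanish at 0, agree on common parts by
    [eq_derive_cst]. At each t an interval containing t is used. *)
Lemma primitive (g : R -> R) : continuous g ->
  exists G : R -> R, forall t : R, is_derive t 1 G (g t).
Proof.
move=> cg.
have [G HG] := choice (fun N : nat => primitive_near (ltr0Sn R N) cg).
pose N (t : R) := Num.truncn `|t|.
have HN t : `|t| < (N t).+1%:R by exact: truncnS_gt.
exists (fun t => G (N t) t - G (N t) 0) => t.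
have tN : `|t| < (N t).+2%:R by apply: lt_trans (HN t) _; rewrite ltr_nat.
have E : \forall s \near t, G (N t).+1 s - G (N t).+1 0 = G (N s) s - G (N s) 0.
  have : \forall s \near t, `|s| < (N t).+1%:R.
    exact: near_norm_lt.
  apply: filterS => s sN.
  apply: (@eq_derive_cst (G (N t).+1) (G (N s)) (Num.min (N t).+2%:R (N s).+1%:R) g).
  - by move=> r; rewrite lt_min => /andP[r1 _]; exact: HG.
  - by move=> r; rewrite lt_min => /andP[_ r1]; exact: HG.
  by rewrite lt_min HN andbT; apply: lt_trans sN _; rewrite ltr_nat.
apply: near_eq_is_derive E _.
rewrite -[g t]subr0; apply: is_deriveB; exact: HG.
Qed.

Lemma primitive_rv n (g : R -> 'rV[R]_n) : continuous g ->
  exists G : R -> 'rV[R]_n, forall t : R, is_derive t 1 G (g t).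
Proof.
move=> cg.
have cgi (i : 'I_n) : continuous (fun t => g t 0 i).
  move=> t; apply: (@Cn_coord _ 0 _ _ _ g t 0 i); exact: cg.
have [G HG] := choice (fun i : 'I_n => primitive (cgi i)).
exists (fun t => \row_i G i t) => t; apply: is_derive_mx => i j.
rewrite (ord1 i); apply: is_derive_ext (HG j t) => s.
by rewrite mxE.
Qed.

Lemma mvi_curve0 n (u du : R -> 'rV[R]_n) (c M : R) : 0 <= M ->
  (forall t : R, `|t| <= `|c| -> is_derive t 1 u (du t) /\ `|du t| <= M) ->
  `|u c - u 0| <= M * `|c|.
Proof.
move=> M0 H; case: (leP 0 c) => c0.
  rewrite ger0_norm // -{2}[c]subr0; apply: mvi_curve => // t /andP[t0 tc].
  by apply: H; rewrite !ger0_norm.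
rewrite distrC ltr0_norm // -[- c]add0r; apply: (mvi_curve (ltW c0) M0) => t /andP[tc t0].
by apply: H; rewrite (ler0_norm t0) (ltr0_norm c0) lerN2.
Qed.

(* Short-time Gronwall: evaluate at the point where the norm is maximal. *)
Lemma short_gronwall n (v dv : R -> 'rV[R]_n) (a K e : R) : 0 <= K -> 0 <= e ->
  a * K <= 1 / 2 ->
  (forall t : R, `|t| < a -> is_derive t 1 v (dv t) /\ `|dv t| <= K * `|v t| + e) ->
  forall t : R, `|t| < a -> `|v t| <= 2 * (`|v 0| + a * e).
Proof.
move=> K0 e0 aK H t ta; have a0 : 0 < a by exact: le_lt_trans ta.
have tt : - `|t| <= `|t| by rewrite ge0_cp.
have [|c] := @EVT_max R (fun s => `|v s|) (- `|t|) `|t| tt.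
  apply: continuous_in_subspaceT => s; rewrite inE /= in_itv /= -ler_norml => st.
  have [dvs _] := H s (le_lt_trans st ta).
  by apply: continuous_comp; [exact: is_derive_continuous dvs | exact: norm_continuous].
rewrite in_itv /= -ler_norml => ct Hc.
have {}Hc (s : R) : `|s| <= `|t| -> `|v s| <= `|v c|.
  by move=> st; apply: Hc; rewrite in_itv /= -ler_norml.
have M0 : 0 <= K * `|v c| + e by rewrite addr_ge0 // mulr_ge0.
have := @mvi_curve0 n v dv c _ M0 _.
have HM (s : R) : `|s| <= `|c| -> is_derive s 1 v (dv s) /\ `|dv s| <= K * `|v c| + e.
  move=> sc; have st := le_trans sc ct; have [D B] := H s (le_lt_trans st ta).
  split=> //; apply: le_trans B _; rewrite lerD2r ler_wpM2l //; exact: Hc.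
move=> /(_ HM) B.
have ca : `|c| <= a by apply: ltW; apply: le_lt_trans ct ta.
have Bc : `|v c| <= `|v 0| + (K * `|v c| + e) * a.
  rewrite -lerBlDl (le_trans (lerB_dist _ _)) // (le_trans B) // ler_wpM2l //.
have : a * K * `|v c| <= 1 / 2 * `|v c| by rewrite ler_wpM2r.
have := Hc t (lexx _).
by nra.
Qed.

Lemma flow_estimate n (f : 'rV[R]_n -> 'rV[R]_n) (S : set 'rV[R]_n)
    (u y : R -> 'rV[R]_n) (a K : R) : 0 <= K -> a * K <= 1 / 2 ->
  (forall x z, S x -> S z -> `|f x - f z| <= K * `|x - z|) ->
  (forall t : R, `|t| < a -> is_derive t 1 u (f (u t)) /\ S (u t)) ->
  (forall t : R, `|t| < a -> is_derive t 1 y (f (y t)) /\ S (y t)) ->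
  forall t : R, `|t| < a -> `|u t - y t| <= 2 * `|u 0 - y 0|.
Proof.
move=> K0 aK L Hu Hy t ta.
have := @short_gronwall n (fun s => u s - y s) (fun s => f (u s) - f (y s)) a K 0 K0 (lexx 0) aK.
rewrite mulr0 addr0; apply=> // s sa.
have [Du Su] := Hu s sa; have [Dy Sy] := Hy s sa.
by split; [exact: is_deriveB | rewrite addr0; exact: L].
Qed.

Lemma flow_unique n (f : 'rV[R]_n -> 'rV[R]_n) (S : set 'rV[R]_n)
    (u y : R -> 'rV[R]_n) (a K : R) : 0 <= K -> a * K <= 1 / 2 ->
  (forall x z, S x -> S z -> `|f x - f z| <= K * `|x - z|) ->
  (forall t : R, `|t| < a -> is_derive t 1 u (f (u t)) /\ S (u t)) ->
  (forall t : R, `|t| < a -> is_derive t 1 y (f (y t)) /\ S (y t)) ->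
  u 0 = y 0 -> forall t : R, `|t| < a -> u t = y t.
Proof.
move=> K0 aK L Hu Hy E t ta.
have := flow_estimate K0 aK L Hu Hy ta; rewrite E subrr normr0 mulr0 normr_le0.
by rewrite subr_eq0 => /eqP.
Qed.

(** The tail of the series of bounds after k is 2 C / 2^k, so the intervals of that radius around
    [x k] are nested; the supremum of their left ends lies in all of them. *)
Lemma fast_cauchy (x : nat -> R) (C : R) : 0 <= C ->
  (forall k, `|x k.+1 - x k| <= C / 2 ^+ k) ->
  exists l, forall k, `|l - x k| <= 2 * C / 2 ^+ k.
Proof.
move=> C0 H.
pose y k := x k - 2 * C / 2 ^+ k; pose z k := x k + 2 * C / 2 ^+ k.
have p k : 0 < (2 : R) ^+ k by rewrite exprn_gt0.
have E k : 2 * C / 2 ^+ k.+1 = C / 2 ^+ k.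
  by rewrite exprS invfM; field; rewrite gt_eqF.
have yS k : y k <= y k.+1.
  have := H k; rewrite /y E ler_norml => /andP[h1 h2].
  have -> : 2 * C / 2 ^+ k = C / 2 ^+ k + C / 2 ^+ k by ring.
  lra.
have zS k : z k.+1 <= z k.
  have := H k; rewrite /z E ler_norml => /andP[h1 h2].
  have -> : 2 * C / 2 ^+ k = C / 2 ^+ k + C / 2 ^+ k by ring.
  lra.
have ymono i j : (i <= j)%N -> y i <= y j.
  by move=> /subnK <-; elim: (j - i)%N => // m IH; rewrite addSn; apply: le_trans (yS _).
have zmono i j : (i <= j)%N -> z j <= z i.
  by move=> /subnK <-; elim: (j - i)%N => // m IH; rewrite addSn; apply: le_trans (zS _) _.
have yz k : y k <= z k.
  have : 0 <= 2 * C / 2 ^+ k by rewrite divr_ge0 ?mulr_ge0 // ltW.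
  by rewrite /y /z; lra.
have yzij i j : y i <= z j.
  apply: le_trans (ymono _ _ (leq_maxl i j)) _; apply: le_trans (yz _) _.
  exact: zmono (leq_maxr i j).
exists (sup (range y)) => k.
have ub k' : ubound (range y) (z k') by move=> _ [i _ <-].
have h1 : y k <= sup (range y).
  by apply: ub_le_sup; [exists (z 0%N); exact: ub | exists k].
have h2 : sup (range y) <= z k by apply: ge_sup => //; exists (y 0%N), 0%N.
by rewrite ler_norml; move: h1 h2; rewrite /y /z => h1 h2; apply/andP; split; lra.
Qed.

Lemma fast_cauchy_rv n (x : nat -> 'rV[R]_n) (C : R) : 0 <= C ->
  (forall k, `|x k.+1 - x k| <= C / 2 ^+ k) ->
  exists l, forall k, `|l - x k| <= 2 * C / 2 ^+ k.
Proof.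
move=> C0 H.
have Hi (i : 'I_n) k : `|x k.+1 0 i - x k 0 i| <= C / 2 ^+ k.
  by apply: le_trans (H k); have := rv_norm_coord (x k.+1 - x k) 0 i; rewrite !mxE.
have [l Hl] := choice (fun i => fast_cauchy C0 (Hi i)).
exists (\row_i l i) => k; apply/rv_norm_leP.
  by rewrite divr_ge0 ?mulr_ge0 // ltW // exprn_gt0.
by move=> i j; rewrite (ord1 i) !mxE.
Qed.

Lemma small_le0 (x C : R) : 0 <= C -> (forall k, x <= C / 2 ^+ k) -> x <= 0.
Proof.
move=> C0 H; rewrite leNgt; apply/negP => x0.
have [N HN] : exists N : nat, C / x < N%:R.
  by exists (Num.truncn (C / x)).+1; exact: truncnS_gt.
have := H N; have p : 0 < (2 : R) ^+ N by rewrite exprn_gt0.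
rewrite ler_pdivlMr // => H1.
have : (N%:R : R) < 2 ^+ N by rewrite -natrX ltr_nat ltn_expl.
move: HN; rewrite ltr_pdivrMr // => H2 H3.
have : N%:R * x < 2 ^+ N * x by rewrite ltr_pM2r.
by move=> H4; have := lt_trans H2 H4; rewrite mulrC => /lt_le_trans /(_ H1); rewrite ltxx.
Qed.

Definition clamp (l h x : R) : R := Num.max l (Num.min x h).

Lemma clamp_lip l h x y : `|clamp l h x - clamp l h y| <= `|x - y|.
Proof.
have Hmax (a b : R) : `|Num.max l a - Num.max l b| <= `|a - b|.
  have h1 := ler_norm (a - b); have h2 : b - a <= `|a - b| by rewrite distrC ler_norm.
  by rewrite ler_norml; apply/andP; split; case: (leP l a); case: (leP l b); lra.
apply: le_trans (Hmax _ _) _.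
have h1 := ler_norm (x - y); have h2 : y - x <= `|x - y| by rewrite distrC ler_norm.
by rewrite ler_norml; apply/andP; split; case: (leP x h); case: (leP y h); lra.
Qed.

Lemma clamp_mem l h x : l <= h -> l <= clamp l h x <= h.
Proof.
move=> lh; rewrite /clamp le_max lexx /= ge_max lh /= ge_min lexx orbT //.
Qed.

Lemma clamp_id l h x : l <= x <= h -> clamp l h x = x.
Proof. by move=> /andP[lx xh]; rewrite /clamp min_l // max_r. Qed.

Lemma le_all_limit (x y C : R) : 0 <= C -> (forall k, x <= y + C / 2 ^+ k) -> x <= y.
Proof.
by move=> C0 H; rewrite -subr_le0; apply: (small_le0 C0) => k; rewrite lerBlDl.
Qed.

Lemma lipschitz_continuous (V W : normedModType R) (f : V -> W) (B : R) : 0 <= B ->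
  (forall t s, `|f t - f s| <= B * `|t - s|) -> continuous f.
Proof.
move=> B0 H t; apply/cvgrPdist_lt => e e0.
have B1 : 0 < B + 1 by rewrite ltr_wpDl.
apply/nbhs_ballP; exists (e / (B + 1)); first by rewrite /= divr_gt0.
move=> s; rewrite -ball_normE /= ltr_pdivlMr // => H'.
apply: le_lt_trans (H _ _) _; apply: le_lt_trans H'; rewrite mulrC.
by rewrite ler_wpM2l // lerDl.
Qed.

Lemma picard n (F : 'rV[R]_n -> 'rV[R]_n) (K B a : R) (x : 'rV[R]_n) :
  0 <= K -> 0 <= B -> 0 < a -> a * K <= 1 / 2 ->
  (forall y z, `|F y - F z| <= K * `|y - z|) -> (forall y, `|F y| <= B) ->
  exists u : R -> 'rV[R]_n, u 0 = x /\
    forall t : R, `|t| < a -> is_derive t 1 u (F (u t)).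
Proof.
move=> K0 B0 a0 aK FL FB.
have Fc := lipschitz_continuous K0 FL.
pose P (u v : R -> 'rV[R]_n) := v 0 = x /\ forall t : R, is_derive t 1 v (F (u t)).
(* Continuity of u stands under the existential quantifier, so that [choice] yields a step function
   defined on all curves. *)
have exP u : exists v, continuous u -> P u v.
  have [cu|ncu] := pselect (continuous u); last by exists u.
  have cFu : continuous (fun t => F (u t)) by move=> t; apply: continuous_comp; [exact: cu | exact: Fc].
  have [G HG] := primitive_rv cFu.
  exists (fun t => x + G t - G 0) => _; split; first by rewrite addrK.
  move=> t; rewrite -[F (u t)]subr0; apply: is_deriveB.
  by rewrite -[F (u t)]add0r; apply: is_deriveD.
have [step Hstep] := choice exP.
pose u_ k := iter k step (fun=> x).
have cont_of u v : P u v -> continuous v.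
  by move=> [_ H] t; apply: is_derive_continuous (H t).
have cu k : continuous (u_ k).
  elim: k => [|k IH]; first exact: cst_continuous.
  by apply: (cont_of (u_ k)); apply: Hstep.
have Hu k : P (u_ k) (u_ k.+1) by apply: Hstep.
(* One Picard step halves distances on [|t| <= a], because a * K <= 1 / 2. *)
have diffbound u1 u2 v1 v2 D : P u1 v1 -> P u2 v2 -> 0 <= D ->
    (forall t : R, `|t| <= a -> `|u1 t - u2 t| <= D) ->
    forall t : R, `|t| <= a -> `|v1 t - v2 t| <= D / 2.
  move=> [v10 H1] [v20 H2] D0 HD t ta.
  have M0 : 0 <= K * D by rewrite mulr_ge0.
  have := @mvi_curve0 n (fun s => v1 s - v2 s) (fun s => F (u1 s) - F (u2 s)) t _ M0.
  rewrite v10 v20 subrr subr0 => H; apply: le_trans (H _) _.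
    move=> s st; split; first by apply: is_deriveB.
    apply: le_trans (FL _ _) _; rewrite ler_wpM2l //; apply: HD; exact: le_trans ta.
  have : `|t| * (K * D) <= a * (K * D) by rewrite ler_wpM2r.
  have : a * K * D <= 1 / 2 * D by rewrite ler_wpM2r.
  lra.
pose C := a * B.
have C0 : 0 <= C by rewrite mulr_ge0 // ltW.
have p2 k : 0 < (2 : R) ^+ k by rewrite exprn_gt0.
have succ k : forall t : R, `|t| <= a -> `|u_ k.+1 t - u_ k t| <= C / 2 ^+ k.
  elim: k => [|k IH] t ta.
    have [u10 H1] := Hu 0%N.
    have := @mvi_curve0 n (u_ 1%N) (fun s => F x) t B B0; rewrite u10 => H.
    rewrite expr0 divr1 /C mulrC; apply: le_trans (H _) _; last by rewrite ler_wpM2l.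
    by move=> s _; split; [exact: H1 | exact: FB].
  have -> : C / 2 ^+ k.+1 = (C / 2 ^+ k) / 2.
    by rewrite exprSr invfM mulrA.
  apply: (diffbound _ _ _ _ _ (Hu k.+1) (Hu k)) => //.
  by rewrite divr_ge0 // ltW.
(* The iterates converge only on [|t| <= a]. Taking the limit at clamped times makes w Lipschitz on
   the whole line, so that [step] can be applied to it. *)
pose cl := clamp (- a) a.
have cla t : `|cl t| <= a.
  by rewrite ler_norml; apply: clamp_mem; rewrite ge0_cp // ltW.
have exw t : exists l, forall k, `|l - u_ k (cl t)| <= 2 * C / 2 ^+ k.
  by apply: fast_cauchy_rv => // k; exact: succ.
have [w Hw] := choice exw.
have ulip k t s : `|t| <= a -> `|s| <= a -> `|u_ k.+1 t - u_ k.+1 s| <= B * `|t - s|.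
  wlog st : t s / s <= t.
    move=> W ta sa; case: (leP s t) => st; first exact: W.
    by rewrite distrC (distrC t); apply: W => //; exact: ltW.
  move=> ta sa; rewrite (@ger0_norm _ (t - s)) ?subr_ge0 //.
  have [_ H1] := Hu k.
  by apply: (@mvi_curve _ _ _ (fun r => F (u_ k r))) => // r _; split.
have wlip t s : `|w t - w s| <= B * `|t - s|.
  apply: (@le_all_limit _ _ (2 * C)) => //; first by rewrite mulr_ge0.
  move=> k; have -> : w t - w s = (w t - u_ k.+1 (cl t)) + (u_ k.+1 (cl t) - u_ k.+1 (cl s))
     + (u_ k.+1 (cl s) - w s) by apply/rowP => i; rewrite !mxE; ring.
  have h1 := Hw t k.+1; have h2 := Hw s k.+1; rewrite distrC in h2.
  have h3 : `|u_ k.+1 (cl t) - u_ k.+1 (cl s)| <= B * `|t - s|.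
    by apply: le_trans (ulip _ _ _ (cla _) (cla _)) _; rewrite ler_wpM2l // clamp_lip.
  have E : 2 * C / 2 ^+ k.+1 = C / 2 ^+ k.
    by rewrite exprS invfM; field; rewrite gt_eqF.
  have E' : 2 * C / 2 ^+ k = C / 2 ^+ k + C / 2 ^+ k by ring.
  rewrite E in h1 h2; rewrite E'.
  have := ler_normD (w t - u_ k.+1 (cl t) + (u_ k.+1 (cl t) - u_ k.+1 (cl s))) (u_ k.+1 (cl s) - w s).
  have := ler_normD (w t - u_ k.+1 (cl t)) (u_ k.+1 (cl t) - u_ k.+1 (cl s)).
  lra.
have cw := lipschitz_continuous B0 wlip.
have Pw := Hstep w cw; set v := step w in Pw.
(* Since a step halves distances, [step w] is approached by the same iterates as w. The solution is
   [step w], which is differentiable by construction. *)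
have wv t : `|t| <= a -> w t = v t.
  move=> ta; apply/eqP; rewrite -subr_eq0 -normr_le0.
  have clt : cl t = t by apply: clamp_id; rewrite -ler_norml.
  apply: (@small_le0 _ (2 * C)); first by rewrite mulr_ge0.
  move=> k; have -> : w t - v t = (w t - u_ k.+1 t) + (u_ k.+1 t - v t).
    by apply/rowP => i; rewrite !mxE; ring.
  have h1 := Hw t k.+1; rewrite clt in h1.
  have h2 : `|u_ k.+1 t - v t| <= (2 * C / 2 ^+ k) / 2.
    apply: (diffbound _ _ _ _ _ (Hu k) Pw) => //.
      by rewrite divr_ge0 ?mulr_ge0 // ltW.
    move=> s sa; have := Hw s k; rewrite distrC.
    by have -> : cl s = s by apply: clamp_id; rewrite -ler_norml.
  have E : 2 * C / 2 ^+ k.+1 = C / 2 ^+ k.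
    by rewrite exprS invfM; field; rewrite gt_eqF.
  rewrite E in h1.
  have := ler_normD (w t - u_ k.+1 t) (u_ k.+1 t - v t).
  have E' : 2 * C / 2 ^+ k = C / 2 ^+ k + C / 2 ^+ k by ring.
  rewrite E' in h2 *; lra.
exists v; have [v0 Hv] := Pw; split=> // t ta.
by rewrite -wv ?ltW.
Qed.

(* Clamping the coordinates turns a field that is Lipschitz on a ball into a
   globally Lipschitz bounded one. *)
Lemma ode_local n (f : 'rV[R]_n -> 'rV[R]_n) (x0 : 'rV[R]_n) (K r a0 : R) :
  0 < K -> 0 < r -> 0 < a0 ->
  (forall y z : 'rV[R]_n, ball x0 r y -> ball x0 r z -> `|f y - f z| <= K * `|y - z|) ->
  exists a : R, [/\ 0 < a, a <= a0, a * K <= 1 / 2 &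
  exists2 d : R, 0 < d &
  exists phi : R -> 'rV[R]_n -> 'rV[R]_n, forall x, ball x0 d x ->
    phi 0 x = x /\ forall t : R, `|t| < a ->
      is_derive t 1 (phi^~ x) (f (phi t x)) /\ ball x0 r (phi t x)].
Proof.
move=> K0 r0 a00 fL.
(* In the maximum norm the box to which coordinates are clamped is the closed ball of radius r',
   contained in the open ball of radius r. *)
pose r' := r / 2; have r'0 : 0 < r' by rewrite divr_gt0.
have r'r : r' < r by rewrite /r' ltr_pdivrMr // ltr_pMr // ltr1n.
pose c (x : 'rV[R]_n) : 'rV[R]_n := \row_i clamp (x0 0 i - r') (x0 0 i + r') (x 0 i).
have cL x y : `|c x - c y| <= `|x - y|.
  apply/rv_norm_leP => // i j; rewrite (ord1 i) !mxE.
  apply: le_trans (clamp_lip _ _ _ _) _.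
  by have := rv_norm_coord (x - y) 0 j; rewrite !mxE.
have cb x : ball x0 r (c x).
  rewrite -ball_normE /=; apply: le_lt_trans r'r; apply/rv_norm_leP; first exact: ltW.
  move=> i j; rewrite (ord1 i) !mxE ler_norml.
  have /andP[h1 h2] : x0 0 j - r' <= clamp (x0 0 j - r') (x0 0 j + r') (x 0 j) <= x0 0 j + r'.
    by apply: clamp_mem; lra.
  by apply/andP; split; lra.
have cid x : `|x0 - x| <= r' -> c x = x.
  move=> /(rv_norm_leP _ (ltW r'0)) H; apply/rowP => i; rewrite mxE; apply: clamp_id.
  by have := H 0 i; rewrite !mxE ler_norml => /andP[h1 h2]; apply/andP; split; lra.
pose F x := f (c x).
have FL y z : `|F y - F z| <= K * `|y - z|.
  by apply: le_trans (fL _ _ (cb _) (cb _)) _; rewrite ler_pM2l // cL.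
pose B := `|f x0| + K * r.
have B0 : 0 < B by rewrite ltr_wpDl // mulr_gt0.
have FB y : `|F y| <= B.
  rewrite -lerBlDl (le_trans (lerB_dist _ _)) //.
  apply: le_trans (fL _ _ (cb _) (ballxx _ r0)) _; rewrite ler_pM2l // distrC ltW //.
  by have := cb y; rewrite -ball_normE.
(* The bound 1/2/K is the contraction condition. With r'/2/B, a trajectory starting within r'/2 of
   x0 stays within r' of it, where clamping changes nothing and F is f. *)
pose a := Num.min a0 (Num.min (1 / 2 / K) (r' / 2 / B)).
have a_gt0 : 0 < a by rewrite !lt_min a00 !divr_gt0.
have aK : a * K <= 1 / 2 by rewrite -ler_pdivlMr // !ge_min lexx orbT.
have aB : a * B <= r' / 2 by rewrite -ler_pdivlMr // !ge_min lexx !orbT.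
exists a; split=> //; first by rewrite ge_min lexx.
exists (r' / 2); first by rewrite divr_gt0.
have [phi Hphi] := choice (fun x => picard x (ltW K0) (ltW B0) a_gt0 aK FL FB).
exists (fun t x => phi x t) => x; rewrite -ball_normE /= => xd.
have [phi0 Hp] := Hphi x; split=> // t ta.
have near_x0 : `|x0 - phi x t| <= r'.
  have := @mvi_curve0 n (phi x) (fun s => F (phi x s)) t B (ltW B0).
  rewrite phi0 => H.
  have {}H : `|phi x t - x| <= B * `|t|.
    by apply: H => s st; split => //; apply: Hp; exact: le_lt_trans ta.
  have H2 : B * `|t| <= a * B by rewrite mulrC ler_pM2r // ltW.
  have := ler_normD (x0 - x) (x - phi x t); rewrite subrKA (distrC x (phi x t)); lra.
split; last exact: le_lt_trans near_x0 r'r.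
by have := Hp t ta; rewrite /F cid.
Qed.

End FlowEstimates.

(** * Smoothness of flows *)

Section SmoothFlows.
Context {R : realType}.

Lemma dist_continuous (V W : normedModType R) (f : V -> W) (x : V) :
  (forall e : R, 0 < e -> \forall y \near x, `|f x - f y| < e) -> {for x, continuous f}.
Proof. by move=> H; apply/cvgrPdist_lt => e e0; exact: H. Qed.

Definition local_estimates m n (f : 'rV[R]_n -> 'rV[R]_m) (x : 'rV[R]_n) (K r : R) :=
  forall y : 'rV[R]_n, ball x r y ->
   [/\ differentiable f y, forall h, `|'D_h f y| <= K * `|h|,
    forall z, ball x r z -> `|f y - f z| <= K * `|y - z| &
    forall h, ball x r (y + h) -> `|f (y + h) - f y - 'D_h f y| <= K * `|h| * `|h|].

Lemma local_estimates_exist m n (f : 'rV[R]_n -> 'rV[R]_m) (x : 'rV[R]_n) : smooth f x ->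
  exists2 K : R, 0 < K & exists2 r : R, 0 < r & local_estimates f x K r.
Proof.
move=> /smooth_local_estimates [K K0 [r r0 H]]; exists K => //; exists r => // y Hy.
by have [h1 h2 h3 h4 h5] := H y Hy.
Qed.

Lemma local_estimates_le m n (f : 'rV[R]_n -> 'rV[R]_m) (x : 'rV[R]_n) (K r r' : R) :
  r' <= r -> local_estimates f x K r -> local_estimates f x K r'.
Proof.
move=> rr H y Hy; have sub z : ball x r' z -> ball x r z by exact: le_ball.
have [h1 h2 h3 h4] := H y (sub _ Hy); split=> //.
- by move=> z Hz; apply: h3; exact: sub.
- by move=> h Hh; apply: h4; exact: sub.
Qed.

Definition is_flow n (f : 'rV[R]_n -> 'rV[R]_n) (S : set 'rV[R]_n) (a : R)
    (B : set 'rV[R]_n) (phi : R -> 'rV[R]_n -> 'rV[R]_n) :=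
  forall x, B x -> phi 0 x = x /\
    forall t : R, `|t| < a -> is_derive t 1 (phi^~ x) (f (phi t x)) /\ S (phi t x).

Definition short_flow n (f : 'rV[R]_n -> 'rV[R]_n) (x0 : 'rV[R]_n) (K r a d : R)
    (phi : R -> 'rV[R]_n -> 'rV[R]_n) :=
  [/\ 0 < K, 0 < r, 0 < a & 0 < d] /\
  [/\ local_estimates f x0 K r, a * K <= 1 / 2 & is_flow f (ball x0 r) a (ball x0 d) phi].

Lemma short_flow_lip n (f : 'rV[R]_n -> 'rV[R]_n) x0 K r a d phi :
  short_flow f x0 K r a d phi -> forall (t : R) (x y : 'rV[R]_n), `|t| < a ->
  ball x0 d x -> ball x0 d y -> `|phi t x - phi t y| <= 2 * `|x - y|.
Proof.
move=> [[K0 r0 a0 d0] [E aK H]] t x y ta Hx Hy.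
have [x1 x2] := H x Hx; have [y1 y2] := H y Hy.
rewrite -{2}x1 -{2}y1.
apply: (@flow_estimate _ _ f (ball x0 r) (phi^~ x) (phi^~ y) a K (ltW K0) aK) => //.
by move=> u v Hu Hv; have [_ _ h _] := E u Hu; exact: h.
Qed.

Lemma near_ball n (x0 x : 'rV[R]_n) (d : R) : ball x0 d x -> \forall y \near x, ball x0 d y.
Proof. by move=> H; apply: open_nbhs_nbhs; split => //; exact: ball_open. Qed.

Lemma short_flow_continuous n (f : 'rV[R]_n -> 'rV[R]_n) x0 K r a d phi :
  short_flow f x0 K r a d phi -> forall (t : R) (x : 'rV[R]_n), `|t| < a ->
  ball x0 d x -> {for x, continuous (phi t)}.
Proof.
move=> H t x ta Hx; apply: dist_continuous => e e0.
have h1 : \forall y \near x, ball x (e / 2) y by apply: nbhsx_ballx; rewrite divr_gt0.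
apply: filterS2 (near_ball Hx) h1 => y Hy /ball_norm_lt xy.
apply: le_lt_trans (short_flow_lip H ta Hx Hy) _; lra.
Qed.

(** The difference of nearby trajectories minus s times the solution w of the linearised equation
    vanishes at time 0 and satisfies that equation up to an error quadratic in s, so Gronwall bounds
    it by a multiple of s squared. *)
Lemma short_flow_variational n (f : 'rV[R]_n -> 'rV[R]_n) x0 K r a d phi
    (x h : 'rV[R]_n) (w : R -> 'rV[R]_n) :
  short_flow f x0 K r a d phi -> ball x0 d x ->
  (forall t : R, `|t| < a -> is_derive t 1 w ('D_(w t) f (phi t x))) -> w 0 = h ->
  forall t : R, `|t| < a -> is_derive x h (phi t) (w t).
Proof.
move=> SF Hx Hw w0 t ta; have [[K0 r0 a0 d0] [E aK H]] := SF.
(* The factor 4 is the square of the Lipschitz constant 2 of the flow; the outer 2 and a come from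
   [short_gronwall]. *)
apply: (@quad_is_derive _ _ _ _ _ _ _ (2 * (a * (4 * K * `|h| * `|h|)))).
  by rewrite !mulr_ge0 // ltW.
have Nx : \forall s \near (0 : R), ball x0 d (x + s *: h).
  have c : {for (0 : R), continuous (fun s : R => x + s *: h)}.
    apply: differentiable_continuous.
    have dg : is_diff (0 : R) (fun s : R => x + s *: h) (fun s : R => s *: h).
      by apply: is_diff_eq; apply/funext => s; rewrite !fctE add0r.
    exact: ex_diff.
  by apply: c; rewrite /= scale0r addr0; exact: near_ball.
apply: filterS Nx => s Hs.
have [x1 x2] := H x Hx; have [y1 y2] := H _ Hs.
have e0 : 0 <= 4 * K * `|s *: h| * `|s *: h| by rewrite !mulr_ge0 // ltW.
have := @short_gronwall R n (fun s' => phi s' (x + s *: h) - phi s' x - s *: w s')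
  (fun s' => f (phi s' (x + s *: h)) - f (phi s' x) - s *: 'D_(w s') f (phi s' x))
  a K _ (ltW K0) e0 aK.
have E0 : x + s *: h - x - s *: h = 0 by rewrite addrAC addrK subrr.
rewrite x1 y1 w0 E0 normr0 add0r => G.
apply: le_trans (G _ t ta) _; last first.
  rewrite normrZ.
  have -> : 2 * (a * (4 * K * (`|s| * `|h|) * (`|s| * `|h|))) =
    2 * (a * (4 * K * `|h| * `|h|)) * `|s| * `|s| by ring.
  exact: lexx.
move=> s' sa.
have [dx Sx] := x2 s' sa; have [dy Sy] := y2 s' sa; split.
  have D1 := @is_deriveB _ _ _ _ _ _ _ _ _ dy dx.
  have D2 := @is_deriveZ _ _ _ _ s _ _ _ (Hw s' sa).
  exact: (@is_deriveB _ _ _ _ _ _ _ _ _ D1 D2).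
have [df B _ Q] := E _ Sx.
set p := phi s' x in dx Sx df B Q *; set q := phi s' _ in dy Sy *.
have -> : f q - f p - s *: 'D_(w s') f p =
    (f q - f p - 'D_(q - p) f p) + 'D_(q - p - s *: w s') f p.
  by rewrite (deriveBl (q - p) (s *: w s') df) (deriveZl _ _ df) addrA subrK.
rewrite addrC; apply: le_trans (ler_normD _ _) _; apply: lerD; first exact: B.
have := Q (q - p); rewrite subrKC => /(_ Sy) Q1; apply: le_trans Q1 _.
have L := short_flow_lip SF sa Hs Hx.
have Ex : x + s *: h - x = s *: h by rewrite addrAC subrr add0r.
rewrite Ex -/p -/q in L.
have -> : 4 * K * `|s *: h| * `|s *: h| = K * (2 * `|s *: h|) * (2 * `|s *: h|) by ring.
have := normr_ge0 (q - p) => q0.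
by apply: ler_pM => //; rewrite ?mulr_ge0 ?ler_pM2l // ltW.
Qed.

Lemma norm_row_mx m n (a : 'rV[R]_m) (b : 'rV[R]_n) : `|row_mx a b| = Num.max `|a| `|b|.
Proof.
apply/eqP; rewrite eq_le; apply/andP; split.
  apply/rv_norm_leP; first by rewrite le_max normr_ge0.
  move=> i j; rewrite le_max; case: (split_ordP j) => j' ->.
    by rewrite row_mxEl rv_norm_coord.
  by rewrite row_mxEr rv_norm_coord orbT.
rewrite ge_max; apply/andP; split; apply/rv_norm_leP => // i j.
  by have := rv_norm_coord (row_mx a b) i (lshift n j); rewrite row_mxEl.
by have := rv_norm_coord (row_mx a b) i (rshift m j); rewrite row_mxEr.
Qed.

Lemma ball_row_mx m n (a a' : 'rV[R]_m) (b b' : 'rV[R]_n) (d : R) :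
  ball (row_mx a b) d (row_mx a' b') <-> ball a d a' /\ ball b d b'.
Proof.
have -> : ball (row_mx a b) d (row_mx a' b') <-> `|row_mx a b - row_mx a' b'| < d.
  by split; [exact: ball_norm_lt | exact: norm_ball].
rewrite opp_row_mx add_row_mx norm_row_mx gt_max; split.
  by move=> /andP[h1 h2]; split; exact: norm_ball.
by move=> [/ball_norm_lt h1 /ball_norm_lt h2]; apply/andP.
Qed.

Lemma is_derive_lsubmx m n (u : R -> 'rV[R]_(m + n)) (t : R) du :
  is_derive t 1 u du -> is_derive t 1 (fun s => lsubmx (u s)) (lsubmx du).
Proof.
move=> H; apply: is_derive_mx => i j; rewrite mxE.
by apply: is_derive_ext (is_derive_coord _ _ H) => s; rewrite mxE.
Qed.

Lemma is_derive_rsubmx m n (u : R -> 'rV[R]_(m + n)) (t : R) du :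
  is_derive t 1 u du -> is_derive t 1 (fun s => rsubmx (u s)) (rsubmx du).
Proof.
move=> H; apply: is_derive_mx => i j; rewrite mxE.
by apply: is_derive_ext (is_derive_coord _ _ H) => s; rewrite mxE.
Qed.

Lemma is_derive_row_mx m n (u : R -> 'rV[R]_m) (v : R -> 'rV[R]_n) (t : R) du dv :
  is_derive t 1 u du -> is_derive t 1 v dv ->
  is_derive t 1 (fun s => row_mx (u s) (v s)) (row_mx du dv).
Proof.
move=> Hu Hv; apply: is_derive_mx => i j; case: (split_ordP j) => j' ->.
  rewrite row_mxEl; apply: is_derive_ext (is_derive_coord i j' Hu) => s.
  by rewrite row_mxEl.
rewrite row_mxEr; apply: is_derive_ext (is_derive_coord i j' Hv) => s.
by rewrite row_mxEr.
Qed.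

(** The lift of f to the tangent bundle: its trajectories pair a trajectory of f with a solution of
    the linearised equation along it. Row vectors of length n + n, instead of pairs, keep it in the
    class of fields handled by the induction on k. *)
Definition tangent_field n (f : 'rV[R]_n -> 'rV[R]_n) (y : 'rV[R]_(n + n)) : 'rV[R]_(n + n) :=
  row_mx (f (lsubmx y)) ('D_(rsubmx y) f (lsubmx y)).

Lemma smooth_tangent_field n (f : 'rV[R]_n -> 'rV[R]_n) (x v : 'rV[R]_n) :
  smooth f x -> smooth (tangent_field f) (row_mx x v).
Proof.
move=> sf k; have Ll := Cn_lsubmx (Cn_id k (row_mx x v)).
have Lr := Cn_rsubmx (Cn_id k (row_mx x v)).
apply: Cn_row_mx.
  by apply: (Cn_comp Ll); rewrite row_mxKl; exact: sf.
apply: (@Cn_comp _ _ _ _ _ (fun y : 'rV[R]_(n + n) => (lsubmx y, rsubmx y))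
   (fun q : 'rV[R]_n * 'rV[R]_n => 'D_q.2 f q.1)); first exact: Cn_pair.
by rewrite row_mxKl row_mxKr; exact: (smooth_tangent v sf).
Qed.

(* The derivative of the flow is the second component of the flow of the tangent
   field, which is of class C^k by induction. *)
Lemma local_flow_Cn k n (f : 'rV[R]_n -> 'rV[R]_n) (x0 : 'rV[R]_n) (r0 a0 : R) :
  smooth f x0 -> 0 < r0 -> 0 < a0 ->
  exists K r a d phi, [/\ short_flow f x0 K r a d phi, r <= r0, a <= a0 &
    forall (t : R) (x : 'rV[R]_n), `|t| < a -> ball x0 d x -> Cn k (phi t) x].
Proof.
elim: k n f x0 r0 a0 => [|k IH] n f x0 r0 a0 sf r00 a00.
  have [K K0 [r r_gt0 E]] := local_estimates_exist sf.
  have r'0 : 0 < Num.min r r0 by rewrite lt_min r_gt0.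
  have E' : local_estimates f x0 K (Num.min r r0).
    by apply: local_estimates_le E; rewrite ge_min lexx.
  have [|a [a_gt0 aa0 aK [d d0 [phi Hphi]]]] := @ode_local R n f x0 K _ a0 K0 r'0 a00.
    by move=> y z Hy Hz; have [_ _ h _] := E' y Hy; exact: h.
  have SF : short_flow f x0 K (Num.min r r0) a d phi by [].
  exists K, (Num.min r r0), a, d, phi; split=> //.
    by rewrite ge_min lexx orbT.
  by move=> t x ta Hx; exact: short_flow_continuous SF _ _ ta Hx.
have [K K0 [r r_gt0 E]] := local_estimates_exist sf.
have r'0 : 0 < Num.min r r0 by rewrite lt_min r_gt0.
(* The second bound ensures uniqueness of the trajectories of f itself; the constant [K1] obtained
   next belongs to the tangent field, in dimension n + n. *)
have a'0 : 0 < Num.min a0 (1 / 2 / K) by rewrite lt_min a00 !divr_gt0.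
have [K1 [r1 [a [d [Phi [SF r1r aa0 CPhi]]]]]] :=
  IH _ _ _ _ _ (smooth_tangent_field 0 sf) r'0 a'0.
have [[K10 r10 a_gt0 d0] [E1 aK1 HPhi]] := SF.
have E' : local_estimates f x0 K r1.
  by apply: local_estimates_le E; apply: le_trans r1r _; rewrite ge_min lexx.
have aK : a * K <= 1 / 2.
  by rewrite -ler_pdivlMr //; apply: le_trans aa0 _; rewrite ge_min lexx orbT.
pose phi t x := lsubmx (Phi t (row_mx x 0)).
have inB x h : ball x0 d x -> `|h| < d -> ball (row_mx x0 (0 : 'rV[R]_n)) d (row_mx x h).
  by move=> Hx hd; apply/ball_row_mx; split=> //; apply: norm_ball; rewrite sub0r normrN.
have lball y : ball (row_mx x0 (0 : 'rV[R]_n)) r1 y -> ball x0 r1 (lsubmx y).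
  by rewrite -{1}[y]hsubmxK => /ball_row_mx[].
have lflow x h : ball x0 d x -> `|h| < d -> lsubmx (Phi 0 (row_mx x h)) = x /\
    forall t : R, `|t| < a -> is_derive t 1 (fun t => lsubmx (Phi t (row_mx x h)))
      (f (lsubmx (Phi t (row_mx x h)))) /\ ball x0 r1 (lsubmx (Phi t (row_mx x h))).
  move=> Hx hd; have [p0 p1] := HPhi _ (inB _ _ Hx hd); rewrite p0 row_mxKl; split=> // t ta.
  have [D S] := p1 t ta; split; last exact: lball.
  by have := is_derive_lsubmx D; rewrite /tangent_field row_mxKl.
have Hflow : is_flow f (ball x0 r1) a (ball x0 d) phi.
  by move=> x Hx; apply: lflow => //; rewrite normr0.
have SFphi : short_flow f x0 K r1 a d phi by [].
(* The first component solves the equation of f whatever the tangent vector h is, so uniqueness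
   identifies it with [phi]. *)
have indep x h (t : R) : ball x0 d x -> `|h| < d -> `|t| < a ->
    lsubmx (Phi t (row_mx x h)) = phi t x.
  move=> Hx hd ta; have [p0 p1] := lflow x h Hx hd; have [q0 q1] := Hflow x Hx.
  apply: (@flow_unique _ _ f (ball x0 r1) (fun t => lsubmx (Phi t (row_mx x h)))
    (fun t => phi t x) a K (ltW K0) aK) => //.
    by move=> u v Hu Hv; have [_ _ h' _] := E' u Hu; exact: h'.
  by rewrite p0 q0.
exists K, r1, a, d, phi; split=> //.
- by apply: le_trans r1r _; rewrite ge_min lexx orbT.
- by apply: le_trans aa0 _; rewrite ge_min lexx.
move=> t x ta Hx.
(* The flow of the tangent field is available only for tangent vectors shorter than d, so basis
   vectors are scaled by c and the result is divided by c. *)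
pose c := d / 2; have c0 : 0 < c by rewrite divr_gt0.
have cne : c != 0 by rewrite gt_eqF.
have hd (i : 'I_n) : `|c *: (delta_mx 0 i : 'rV[R]_n)| < d.
  rewrite normrZ (gtr0_norm c0); apply: (@le_lt_trans _ _ c).
    rewrite ler_piMr //; first exact: ltW.
    apply/rv_norm_leP => // i' j; rewrite mxE; case: (_ && _); rewrite ?normr1 ?normr0 //.
  by rewrite /c; lra.
have key y (i : 'I_n) : ball x0 d y -> is_derive y (delta_mx 0 i : 'rV[R]_n) (phi t)
     (c^-1 *: rsubmx (Phi t (row_mx y (c *: delta_mx 0 i)))).
  move=> Hy.
  apply: (short_flow_variational (w := fun s => c^-1 *: rsubmx (Phi s (row_mx y (c *: delta_mx 0 i))))
    SFphi Hy) ta; last first.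
    have [-> _] := HPhi _ (inB _ _ Hy (hd i)).
    by rewrite row_mxKr scalerA mulVf // scale1r.
  move=> s sa; have [_ p1] := HPhi _ (inB _ _ Hy (hd i)); have [D S] := p1 s sa.
  have [df _ _ _] := E' _ (lball _ S).
  have := is_derive_rsubmx D; rewrite /tangent_field row_mxKr (indep _ _ _ Hy (hd i) sa).
  rewrite (indep _ _ _ Hy (hd i) sa) in df.
  by rewrite deriveZl // => D'; exact: is_deriveZ.
apply: Cn_partial; apply: filterS (near_ball Hx) => y Hy i; split.
  by have := key y i Hy; case.
apply: (@Cn_near_eq _ _ _ _ (fun y => c^-1 *: rsubmx (Phi t (row_mx y (c *: delta_mx 0 i))))).
  by apply: filterS (near_ball Hy) => z Hz; have [_ ->] := key z i Hz.
apply: Cn_Z; apply: Cn_rsubmx.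
apply: (@Cn_comp _ _ _ _ _ (fun y => row_mx y (c *: delta_mx 0 i)) (Phi t)).
  by apply: Cn_row_mx; [exact: Cn_id | exact: Cn_cst].
by apply: CPhi => //; exact: inB.
Qed.

(* The set of times at which the flow is C^k near x is open and closed: two
   nearby times differ by the local flow along the trajectory. *)
Lemma short_flow_smooth n (f : 'rV[R]_n -> 'rV[R]_n) x0 K r a d phi :
  short_flow f x0 K r a d phi -> (forall y : 'rV[R]_n, ball x0 r y -> smooth f y) ->
  forall (t : R) (x : 'rV[R]_n), `|t| < a -> ball x0 d x -> smooth (phi t) x.
Proof.
move=> SF sf t x ta Hx k; have [[K0 r0 a0 d0] [E aK H]] := SF.
have [x1 x2] := H x Hx.
(* Taking q = s yields both that the set of good times is open and that its complement is. The
   continuation is necessary because the interval given by [local_flow_Cn] depends on k, whereas a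
   does not. *)
have loc (s : R) : `|s| < a -> \forall p \near s, forall q, `|q - s| <= `|p - s| ->
    (Cn k (phi p) x -> Cn k (phi q) x) /\ (Cn k (phi q) x -> Cn k (phi p) x).
  move=> sa; have [ds Ss] := x2 s sa.
  have [r1 r10 Hr1] : exists2 r1 : R, 0 < r1 & ball (phi s x) r1 `<=` ball x0 r.
    by have /nbhs_ballP[r1] := near_ball Ss; exists r1.
  have [K1 [r2 [a1 [d1 [psi [SF1 r21 _ Cpsi]]]]]] := local_flow_Cn k (sf _ Ss) r10 ltr01.
  have [[K10 r20 a10 d10] [_ _ H1]] := SF1.
  have cphi : {for s, continuous (phi^~ x)} by exact: is_derive_continuous ds.
  have N1 : \forall p \near s, ball (phi s x) d1 (phi p x).
    by apply: (cphi (ball (phi s x) d1)); exact: nbhsx_ballx.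
  have [e e0 He] : nbhs_ball s [set p | ball (phi s x) d1 (phi p x)] by exact/nbhs_ballP.
  have {}e0 : 0 < e by [].
  (* Times within b of s differ by less than 2b <= a1, the lifetime of [psi]; b <= e keeps the
     trajectory in the domain of [psi]; 3b <= a - |s| keeps p + u below a for [|u| < 2b]. *)
  pose b := Num.min (a1 / 2) (Num.min e ((a - `|s|) / 3)).
  have b0 : 0 < b.
    by rewrite !lt_min e0 /=; apply/andP; split; apply: divr_gt0; rewrite ?subr_gt0.
  have ba1 : b <= a1 / 2 by rewrite ge_min lexx.
  have be : b <= e by rewrite !ge_min lexx orbT.
  have bas : b <= (a - `|s|) / 3 by rewrite !ge_min lexx !orbT.
  have trans p q : `|p - s| < b -> `|q - s| < b -> Cn k (phi p) x -> Cn k (phi q) x.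
    move=> pb qb Cp.
    have pa : `|p| < a.
      have := ler_normD (p - s) s; rewrite subrK; move: (normr_ge0 s) => ?; lra.
    have qa : `|q| < a.
      have := ler_normD (q - s) s; rewrite subrK; move: (normr_ge0 s) => ?; lra.
    have px : ball (phi s x) d1 (phi p x).
      by apply: He; apply: norm_ball; rewrite distrC; apply: lt_le_trans pb be.
    have Np : \forall y \near x, ball (phi s x) d1 (phi p y).
      apply: (short_flow_continuous SF pa Hx); exact: near_ball.
    have qp : `|q - p| < 2 * b.
      have := ler_normD (q - s) (s - p); rewrite subrKA (distrC s); lra.
    have eqn : \forall y \near x, psi (q - p) (phi p y) = phi q y.
      apply: filterS2 Np (near_ball Hx) => y Hpy Hy.
      have [y1 y2] := H y Hy; have [z1 z2] := H1 _ Hpy.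
      have -> : phi q y = phi (p + (q - p)) y by rewrite subrKC.
      apply: (@flow_unique _ _ f (ball x0 r) (fun t => psi t (phi p y))
         (fun t => phi (p + t) y) (2 * b) K (ltW K0)) => //.
      - have : 2 * b * K <= a * K; last lra.
        rewrite ler_pM2r //; move: (normr_ge0 s) => ?; lra.
      - by move=> u v Hu Hv; have [_ _ h' _] := E u Hu; exact: h'.
      - move=> u ub; have [|D S] := z2 u; first lra.
        by split=> //; apply: Hr1; apply: le_ball S.
      - move=> u ub.
        have pua : `|p + u| < a.
          have := ler_normD (p + u - s) s; rewrite subrK.
          have := ler_normD (p - s) u; rewrite addrAC; move: (normr_ge0 s) => ?; lra.
        have [D S] := y2 _ pua; split=> //.
        have Du : is_derive u 1 (fun v : R => p + v) (1 : R).
          by rewrite -[X in is_derive _ _ _ X]add0r; apply: is_deriveD.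
        have := @is_derive1_comp R _ (fun v : R => p + v) (phi^~ y) u 1 _ Du D.
        by rewrite scale1r.
      - by rewrite z1 addr0.
    apply: Cn_near_eq eqn _; apply: Cn_comp Cp _; apply: Cpsi => //; lra.
  apply/nbhs_ballP; exists b => // p /ball_norm_lt; rewrite distrC => pb q qp.
  have qb := le_lt_trans qp pb.
  by split; exact: trans.
pose I := [set s : R | `|s| < a].
pose A := [set s : R | `|s| < a /\ Cn k (phi s) x].
have oI s : I s -> \forall p \near s, I p by exact: near_norm_lt.
suff : A = I by move=> AI; have : I t by []; rewrite -AI => -[].
have cI : connected I.
  apply/connected_intervalP => u v Iu Iv w /andP[uw wv].
  move: Iu Iv; rewrite /I /= !ltr_norml => /andP[u1 u2] /andP[v1 v2]; apply/andP; split; lra.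
apply: cI.
- exists 0; split; first by rewrite normr0.
  apply: (@Cn_near_eq _ _ _ _ id); last exact: Cn_id.
  by apply: filterS (near_ball Hx) => y Hy; have [->] := H y Hy.
- exists A; last by rewrite predeqE => s; split=> [[h1 h2]|[h1 h2]].
  rewrite openE => s [sa Cs]; apply: filterS2 (oI s sa) (loc s sa) => p Ip Hp.
  have q0 : `|s - s| <= `|p - s| by rewrite subrr normr0.
  by split=> //; have [_ h] := Hp s q0; exact: h.
- exists (~` (I `&` ~` A)).
    apply: open_closedC; rewrite openE => s [sa nA].
    apply: filterS2 (oI s sa) (loc s sa) => p Ip Hp; split=> //.
    move=> [_ Cp]; apply: nA; split=> //.
    have q0 : `|s - s| <= `|p - s| by rewrite subrr normr0.
    by have [h _] := Hp s q0; exact: h.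
  rewrite predeqE => s; split=> [As|[Is nn]].
    by split; [case: As | move=> [_]].
  by apply: contrapT => nA; apply: nn.
Qed.

End SmoothFlows.

(** * Inverse function theorem *)

Section InverseFunction.
Context {R : realType}.

Lemma Cn_det k (V : normedModType R) n (A : V -> 'M[R]_n) (x : V) :
  (forall i j, Cn k (fun y => A y i j) x) -> Cn k (fun y => \det (A y)) x.
Proof.
move=> H; apply: Cn_sum => s _; apply: Cn_M; first exact: Cn_cst.
by apply: Cn_prod => i _; exact: H.
Qed.

(** By Cramer's rule the entries of the inverse are cofactors divided by a determinant that does not
    vanish. *)
Lemma Cn_invmx k (V : normedModType R) n (A : V -> 'M[R]_n) (x : V) :
  (\forall y \near x, A y \in unitmx) ->
  (forall i j, Cn k (fun y => A y i j) x) -> forall i j, Cn k (fun y => invmx (A y) i j) x.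
Proof.
move=> Au HA i j.
apply: (@Cn_near_eq _ _ _ _ (fun y => (\det (A y))^-1 * cofactor (A y) j i)).
  by apply: filterS Au => y Ay; rewrite /invmx Ay !mxE.
apply: Cn_M.
  apply: (@Cn_comp _ _ _ _ _ (fun y => \det (A y) : R) (fun z : R => z^-1 : R)); first exact: Cn_det.
  by apply: Cn_inv; have := nbhs_singleton Au; rewrite unitmxE unitfE.
apply: Cn_M; first exact: Cn_cst.
apply: Cn_det => a b; apply: Cn_ext (HA (lift j a) (lift i b)) => y.
by rewrite !mxE.
Qed.

Definition jacobian_mx m n (f : 'rV[R]_n -> 'rV[R]_m) (x : 'rV[R]_n) : 'M[R]_(n, m) :=
  \matrix_(i, j) 'D_(delta_mx 0 i) f x 0 j.

Lemma derive_jacobian m n (f : 'rV[R]_n -> 'rV[R]_m) (x h : 'rV[R]_n) :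
  differentiable f x -> 'D_h f x = h *m jacobian_mx f x.
Proof.
move=> df; rewrite (derive_sum_coord h df); apply/rowP => j; rewrite !mxE summxE.
by apply: eq_bigr => i _; rewrite !mxE.
Qed.

Lemma mulmxr_bounded m n (A : 'M[R]_(n, m)) :
  exists2 C : R, 0 < C & forall h : 'rV[R]_n, `|h *m A| <= C * `|h|.
Proof.
apply: (@linear_lipschitz _ _ _ (mulmxr A : {linear 'rV[R]_n -> 'rV[R]_m})).
by move=> x; exact: (Cn_linmx 0 (mulmxr A : {linear 'rV[R]_n -> 'rV[R]_m}) x).
Qed.

Lemma inj_unitmx n (A : 'M[R]_n) :
  (forall h : 'rV[R]_n, h *m A = 0 -> h = 0) -> A \in unitmx.
Proof.
move=> H; rewrite -row_free_unit; apply/row_freeP.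
have : kermx A = 0.
  apply/row_matrixP => i; rewrite row0; apply: H.
  by rewrite -row_mul mulmx_ker row0.
move=> /eqP; rewrite kermx_eq0 => /row_freeP [B E]; by exists B.
Qed.

Lemma Cn_mulmxr k (V : normedModType R) m n (A : 'M[R]_(n, m)) (f : V -> 'rV[R]_n) (x : V) :
  Cn k f x -> Cn k (fun y => f y *m A) x.
Proof.
by move=> Hf; apply: (Cn_comp Hf (Cn_linmx k (mulmxr A : {linear 'rV[R]_n -> 'rV[R]_m}) _)).
Qed.

Lemma derive_mulmxr (V : normedModType R) m n (A : 'M[R]_(n, m)) (f : V -> 'rV[R]_n) (x h : V) :
  differentiable f x -> 'D_h (fun y => f y *m A) x = 'D_h f x *m A.
Proof.
move=> df.
have cA : continuous (mulmxr A : {linear 'rV[R]_n -> 'rV[R]_m}).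
  by move=> y; exact: (Cn_linmx 0 (mulmxr A : {linear 'rV[R]_n -> 'rV[R]_m}) y).
have dA := linear_differentiable (f x) cA.
rewrite (@derive_comp _ _ _ _ f (mulmxr A : {linear 'rV[R]_n -> 'rV[R]_m}) x h df dA).
by rewrite deriveE // diff_lin.
Qed.

(* A map r with small derivative is a contraction, so x - r x is invertible. *)
Lemma perturbed_identity_onto n (r : 'rV[R]_n -> 'rV[R]_n) (x0 : 'rV[R]_n) (rho : R) : 0 < rho ->
  (forall y z : 'rV[R]_n, ball x0 rho y -> ball x0 rho z -> `|r y - r z| <= 1 / 2 * `|y - z|) ->
  forall y : 'rV[R]_n, `|y - (x0 - r x0)| < rho / 4 ->
  exists2 x, ball x0 rho x & x - r x = y.
Proof.
move=> rho0 L y Hy.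
(* Fixed points of T solve x - r x = y. Since rho/4 + (1/2)(rho/2) = rho/2, T maps the closed ball
   of radius rho/2 to itself, and the iterates remain where r is a contraction. *)
pose T x := y + r x.
have cb (x : 'rV[R]_n) : `|x - x0| <= rho / 2 -> ball x0 rho x.
  by move=> H; apply: norm_ball; rewrite distrC; apply: le_lt_trans H _; lra.
have Tst x : `|x - x0| <= rho / 2 -> `|T x - x0| <= rho / 2.
  move=> H; have := L x x0 (cb _ H) (ballxx _ rho0).
  have -> : T x - x0 = (y - (x0 - r x0)) + (r x - r x0).
    by apply/rowP => i; rewrite !mxE; ring.
  have := ler_normD (y - (x0 - r x0)) (r x - r x0); lra.
pose u k := iter k T x0.
have ub k : `|u k - x0| <= rho / 2.
  elim: k => [|k IH]; first by rewrite subrr normr0 divr_ge0 // ltW.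
  exact: Tst.
have us k : `|u k.+1 - u k| <= (rho / 2) / 2 ^+ k.
  elim: k => [|k IH]; first by rewrite expr0 divr1; exact: (ub 1%N).
  have -> : u k.+2 - u k.+1 = r (u k.+1) - r (u k).
    by rewrite /u /= /T; apply/rowP => i; rewrite !mxE; ring.
  apply: le_trans (L _ _ (cb _ (ub _)) (cb _ (ub _))) _.
  have -> : rho / 2 / 2 ^+ k.+1 = 1 / 2 * (rho / 2 / 2 ^+ k).
    by rewrite exprS invfM; field; rewrite gt_eqF // exprn_gt0.
  by rewrite ler_pM2l.
have [l Hl] : exists l, forall k, `|l - u k| <= 2 * (rho / 2) / 2 ^+ k.
  by apply: fast_cauchy_rv us; rewrite divr_ge0 // ltW.
have C0 : 0 <= 2 * (rho / 2) by rewrite mulr_ge0 // divr_ge0 // ltW.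
have lb : `|l - x0| <= rho / 2.
  apply: (le_all_limit C0) => k; have := Hl k; have := ub k.
  by have := ler_normD (l - u k) (u k - x0); rewrite subrKA; lra.
exists l; first exact: cb.
suff : T l - l = 0 by rewrite /T => /eqP; rewrite subr_eq0 => /eqP {1}<-; rewrite addrK.
apply/eqP; rewrite -normr_le0; apply: (@small_le0 R _ (2 * (2 * (rho / 2)))).
  by rewrite mulr_ge0.
move=> k; have h1 := L _ _ (cb _ lb) (cb _ (ub k)); have h2 := Hl k; have h3 := Hl k.+1.
have E : 2 * (rho / 2) / 2 ^+ k.+1 = 1 / 2 * (2 * (rho / 2) / 2 ^+ k).
  by rewrite exprS invfM; field; rewrite gt_eqF // exprn_gt0.
have E2 : 2 * (2 * (rho / 2)) / 2 ^+ k = 2 * (2 * (rho / 2) / 2 ^+ k) by ring.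
rewrite E in h3; rewrite E2.
have -> : T l - l = (r l - r (u k)) - (l - u k.+1).
  by rewrite /u /= -/(u k) /T; apply/rowP => i; rewrite !mxE; ring.
have := ler_normB (r l - r (u k)) (l - u k.+1); have := normr_ge0 (l - u k); lra.
Qed.

Lemma near_addr (V : normedModType R) (y : V) (P : V -> Prop) :
  (\forall z \near y, P z) -> \forall k \near (0 : V), P (y + k).
Proof.
move=> H; have cs : {for (0 : V), continuous (fun k => y + k)}.
  by apply: (@Cn_continuous _ 0); apply: Cn_D; [exact: Cn_cst | exact: Cn_id].
by apply: (cs P); rewrite /= addr0.
Qed.

(** Put h = g (y + k) - g y. The remainder of f at h is quadratic in h, hence in k by the Lipschitz
    bound on g; multiplying by the inverse Jacobian turns it into the remainder of g. *)
Lemma inverse_differentiable n (f g : 'rV[R]_n -> 'rV[R]_n) (y : 'rV[R]_n) (C : R) :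
  smooth f (g y) -> 0 < C ->
  (\forall z \near y, f (g z) = z /\ `|g z - g y| <= C * `|z - y|) ->
  jacobian_mx f (g y) \in unitmx ->
  differentiable g y /\ forall k, 'D_k g y = k *m invmx (jacobian_mx f (g y)).
Proof.
move=> sf C0 H Ju; set B := invmx _; set x := g y in sf *.
have [K K0 [r r0 E]] := local_estimates_exist sf.
have [CB CB0 HB] := mulmxr_bounded B.
pose L := mulmxr B : {linear 'rV[R]_n -> 'rV[R]_n}.
have Lc : continuous L by move=> z; exact: (Cn_linmx 0 L z).
have [|dg Dg] := near_le_differentiable (f := g) (x := y) Lc.
  move=> e e0.
  have N1 : \forall k \near (0 : 'rV[R]_n), f (g (y + k)) = y + k /\ `|g (y + k) - g y| <= C * `|k|.
    apply: filterS (near_addr H) => k [h1 h2].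
    by split=> //; move: h2; rewrite [y + k]addrC addrK.
  (* The first bound puts x + h in the ball of the estimates; the second makes the factor CB * K * C
     * C * [|k|] of the remainder at most e. *)
  pose q := Num.min (r / (C + 1)) (e / (CB * K * C * C + 1)).
  have q2 : 0 < CB * K * C * C + 1 by rewrite ltr_wpDl // !mulr_ge0 // ltW.
  have q0 : 0 < q by rewrite lt_min !divr_gt0 // ltr_wpDl // ltW.
  have N2 : \forall k \near (0 : 'rV[R]_n), `|k| < q by apply: near_norm_lt; rewrite normr0.
  apply: filterS2 N1 N2 => k [fgk gk]; rewrite lt_min => /andP[kr ke].
  set h := g (y + k) - g y in gk *.
  have gE : g (y + k) = x + h by rewrite /h /x subrKC.
  have [df B1 _ Q] := E x (ballxx _ r0).
  have fx : f x = y by have [] := nbhs_singleton H.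
  have hr : ball x r (x + h).
    apply: norm_ball; rewrite opprD addNKr normrN; apply: le_lt_trans gk _.
    move: kr; rewrite ltr_pdivlMr; last by rewrite ltr_wpDl // ltW.
    by apply: le_lt_trans; rewrite mulrC ler_wpM2l // lerDl.
  have := Q h hr; rewrite -gE fgk fx (addrC y) addrK derive_jacobian // => Qh.
  have -> : h - L k = (h *m jacobian_mx f x - k) *m B.
    by rewrite mulmxBl mulmxK.
  apply: le_trans (HB _) _; rewrite distrC.
  have : `|h| * `|h| <= (C * `|k|) * (C * `|k|) by apply: ler_pM.
  move: ke; rewrite ltr_pdivlMr // => ke hh.
  have h1 : CB * (K * (`|h| * `|h|)) <= CB * (K * (C * `|k| * (C * `|k|))).
    by rewrite !ler_pM2l.
  have h2 : CB * `|k - h *m jacobian_mx f x| <= CB * (K * (`|h| * `|h|)).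
    by rewrite ler_pM2l // mulrA.
  apply: le_trans h2 _; apply: le_trans h1 _.
  have -> : CB * (K * (C * `|k| * (C * `|k|))) = (`|k| * (CB * K * C * C)) * `|k| by ring.
  rewrite ler_wpM2r //; apply: le_trans (ltW ke); rewrite ler_wpM2l // lerDl //.
by split=> // k; rewrite deriveE // Dg.
Qed.

(** Multiplying f by the inverse of its Jacobian at x0 gives a map F whose deviation r from the
    identity has zero derivative at x0, so r is a contraction near x0. *)
Theorem inverse_function n (f : 'rV[R]_n -> 'rV[R]_n) (U : set 'rV[R]_n) (x0 : 'rV[R]_n) :
  open U -> U x0 -> (forall x, U x -> smooth f x) ->
  (forall h, 'D_h f x0 = 0 -> h = 0) ->
  exists D g, [/\ open D /\ D x0, D `<=` U, open (f @` D),
    forall x, D x -> g (f x) = x & forall y, (f @` D) y -> smooth g y].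
Proof.
move=> oU Ux0 sf inj.
have df0 := smooth_diff (sf _ Ux0).
pose A := jacobian_mx f x0.
have Au : A \in unitmx.
  by apply: inj_unitmx => h hA; apply: inj; rewrite derive_jacobian.
pose B := invmx A; pose F x := f x *m B; pose r x := x - F x.
have sF x : U x -> smooth F x by move=> Ux k; apply: Cn_mulmxr; exact: sf.
have sr x : U x -> smooth r x.
  by move=> Ux k; apply: Cn_B; [exact: Cn_id | exact: sF].
have DF x h : U x -> 'D_h F x = 'D_h f x *m B.
  by move=> Ux; rewrite derive_mulmxr //; exact/smooth_diff/sf.
have Dr x h : U x -> 'D_h r x = h - 'D_h f x *m B.
  move=> Ux; rewrite -DF // -[r]/(id - F) deriveB; first by rewrite derive_id.
    exact: derivable_id.
  by apply: diff_derivable; exact/smooth_diff/sF.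
have Dr0 h : 'D_h r x0 = 0.
  by rewrite Dr // derive_jacobian // mulmxK // subrr.
have [K K0 [r1 r10 E]] := smooth_local_estimates (sr _ Ux0).
have [r2 /= r20 HU] : nbhs_ball x0 U by apply/nbhs_ballP; apply: open_nbhs_nbhs.
pose rho := Num.min r1 (Num.min r2 (1 / 2 / K)).
have rho0 : 0 < rho by rewrite !lt_min r10 r20 !divr_gt0.
have b1 (y : 'rV[R]_n) : ball x0 rho y -> ball x0 r1 y by apply: le_ball; rewrite ge_min lexx.
have bU (y : 'rV[R]_n) : ball x0 rho y -> U y.
  by move=> Hy; apply: HU; apply: le_ball Hy; rewrite !ge_min lexx orbT.
have rhoK : K * rho <= 1 / 2.
  by rewrite mulrC -ler_pdivlMr // !ge_min lexx !orbT.
have Drb (y h : 'rV[R]_n) : ball x0 rho y -> `|'D_h r y| <= 1 / 2 * `|h|.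
  move=> Hy; have [_ _ _ HL _] := E y (b1 _ Hy).
  have := HL x0 h (ballxx _ r10); rewrite Dr0 subr0 => H; apply: le_trans H _.
  rewrite ler_wpM2r //; apply: le_trans rhoK; rewrite ler_pM2l // distrC ltW //.
  exact: ball_norm_lt.
have rL (y z : 'rV[R]_n) : ball x0 rho y -> ball x0 rho z -> `|r y - r z| <= 1 / 2 * `|y - z|.
  move=> Hy Hz; have := @mvi_segment R _ _ r z (y - z) 0 (1 / 2 * `|y - z|).
  rewrite subrKC subr0; apply; first by rewrite mulr_ge0.
  move=> t t01; have Ht : ball x0 rho (z + t *: (y - z)).
    by apply: ball_segment => //; rewrite subrKC.
  by rewrite subr0; split; [exact/smooth_diff/sr/bU | exact: Drb].
have Finj (y z : 'rV[R]_n) : ball x0 rho y -> ball x0 rho z -> `|y - z| <= 2 * `|F y - F z|.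
  move=> Hy Hz; have := rL y z Hy Hz.
  have Eyz : y - z = (F y - F z) + (r y - r z) by rewrite /r; apply/rowP => i; rewrite !mxE; ring.
  have := ler_normD (F y - F z) (r y - r z); rewrite -Eyz; lra.
(* Cutting the ball by a condition on [F x] makes the image of D exactly the set of y with y *m B
   within rho/4 of F x0, which is open. *)
pose D := [set x | ball x0 rho x /\ `|F x - F x0| < rho / 4].
have FonD y : `|y *m B - F x0| < rho / 4 -> exists2 x, D x & f x = y.
  move=> Hy; have [|x Hx Ex] := perturbed_identity_onto rho0 rL (y := y *m B).
    by rewrite /r subKr.
  rewrite /r subKr in Ex; exists x; first by split; rewrite // Ex.
  have Bu : B \in unitmx by rewrite unitmx_inv.
  by rewrite -[LHS](mulmxK Bu) -[RHS](mulmxK Bu) -Ex.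
have fD : f @` D = [set y | `|y *m B - F x0| < rho / 4].
  rewrite predeqE => y; split; first by move=> [x [_ Hx] <-].
  by move=> /FonD [x Dx <-]; exists x.
have cF x : U x -> {for x, continuous F} by move=> Ux; exact: smooth_continuous (sF _ Ux).
have oD : open D.
  rewrite openE => x [Hx FHx].
  have N : \forall z \near x, `|F z - F x0| < rho / 4.
    have c : {for x, continuous (fun z => F z - F x0)}.
      by apply: (@Cn_continuous _ 0); apply: Cn_B; [exact: (sF _ (bU _ Hx) 0%N) | exact: Cn_cst].
    exact: (c _ (near_norm_lt FHx)).
  by apply: filterS2 N (near_ball Hx).
have ofD : open (f @` D).
  rewrite fD openE => y /= Hy.
  have c : {for y, continuous (fun z : 'rV[R]_n => z *m B - F x0)}.
    by apply: (@Cn_continuous _ 0); apply: Cn_B; [apply: Cn_mulmxr; exact: Cn_id | exact: Cn_cst].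
  exact: (c _ (near_norm_lt Hy)).
pose g y := xget x0 [set x | D x /\ f x = y].
have gP y : (f @` D) y -> D (g y) /\ f (g y) = y.
  by move=> [x Dx fx]; apply: (@xgetPex _ x0 [set x | D x /\ f x = y]); exists x.
have fg x : D x -> g (f x) = x.
  move=> Dx; have [Dg Eg] := gP (f x) (imageP f Dx).
  have := Finj _ _ (proj1 Dg) (proj1 Dx); rewrite /F Eg subrr normr0 mulr0 normr_le0.
  by rewrite subr_eq0 => /eqP.
have [CB CB0 HB] := mulmxr_bounded B.
have glip y z : (f @` D) y -> (f @` D) z -> `|g y - g z| <= 2 * CB * `|y - z|.
  move=> Hy Hz; have [Dy Ey] := gP y Hy; have [Dz Ez] := gP z Hz.
  apply: le_trans (Finj _ _ (proj1 Dy) (proj1 Dz)) _; rewrite /F Ey Ez -mulmxBl -mulrA.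
  by rewrite ler_pM2l.
have near_fD y : (f @` D) y -> \forall z \near y, (f @` D) z.
  by move=> Hy; apply: open_nbhs_nbhs.
have Junit x : ball x0 rho x -> jacobian_mx f x \in unitmx.
  move=> Hx; apply: inj_unitmx => h hJ.
  have := Drb x h Hx; rewrite Dr; last exact: bU.
  rewrite derive_jacobian; last exact/smooth_diff/sf/bU.
  rewrite hJ mul0mx subr0 => H.
  by apply/eqP; rewrite -normr_le0; move: H; lra.
have Dg y : (f @` D) y -> differentiable g y /\
    forall k, 'D_k g y = k *m invmx (jacobian_mx f (g y)).
  move=> Hy; have [Dgy Ey] := gP y Hy.
  apply: (@inverse_differentiable _ f g y (2 * CB)).
  - exact/sf/bU/(proj1 Dgy).
  - by rewrite mulr_gt0.
  - apply: filterS (near_fD y Hy) => z Hz; have [_ Ez] := gP z Hz; split=> //.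
    exact: glip.
  - exact/Junit/(proj1 Dgy).
exists D, g; split=> //.
- by split=> //; split; [exact: ballxx | rewrite subrr normr0 divr_gt0].
- by move=> x [Hx _]; exact: bU.
(* The derivative of g is the inverse Jacobian of f at [g y], of class C^k as soon as g is; this
   raises the order of g by one. *)
move=> y Hy k; elim: k y Hy => [|k IH] y Hy.
  apply: differentiable_continuous; exact: (proj1 (Dg y Hy)).
split; first by apply: filterS (near_fD y Hy) => z /Dg[].
move=> h.
apply: (@Cn_near_eq1 _ _ _ _ _ (fun q : 'rV[R]_n * 'rV[R]_n => q.2 *m invmx (jacobian_mx f (g q.1)))).
  by apply: filterS (near_fD y Hy) => z /Dg[_ Ez] l; rewrite /= Ez.
have Cg : Cn k (fun q : 'rV[R]_n * 'rV[R]_n => g q.1) (y, h).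
  by apply: (@Cn_comp _ _ _ _ _ fst g); [exact: Cn_fst | exact: IH].
have [[Bg _] _] := gP y Hy.
apply: Cn_mx => i j.
apply: (@Cn_ext _ _ _ _ (fun q : 'rV[R]_n * 'rV[R]_n =>
   \sum_l q.2 i l * invmx (jacobian_mx f (g q.1)) l j)).
  by move=> q; rewrite mxE.
apply: Cn_sum => l _; apply: Cn_M; first by apply: Cn_coord; exact: Cn_snd.
apply: Cn_invmx.
  have : \forall z \near y, jacobian_mx f (g z) \in unitmx.
    by apply: filterS (near_fD y Hy) => z Hz; have [[Bz _] _] := gP z Hz; exact: Junit.
  move=> N; exact: (@cvg_fst _ _ (nbhs y) (nbhs h) _ _ N).
move=> a b.
apply: (@Cn_ext _ _ _ _ (fun q : 'rV[R]_n * 'rV[R]_n => 'D_(delta_mx 0 a) f (g q.1) 0 b)).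
  by move=> q; rewrite mxE.
apply: Cn_coord; apply: (@Cn_comp _ _ _ _ _ (fun q : 'rV[R]_n * 'rV[R]_n => g q.1)
  (fun z => 'D_(delta_mx 0 a) f z)) => //.
by apply: (smooth_derive (delta_mx 0 a) (sf _ (bU _ Bg))).
Qed.

End InverseFunction.

(** * Rectification of commuting vector fields *)

Section Rectification.
Context {R : realType}.
Implicit Types V : normedModType R.

Lemma derive_lsubmx V m n (f : V -> 'rV[R]_(m + n)) (x h : V) :
  differentiable f x -> 'D_h (fun y => lsubmx (f y)) x = lsubmx ('D_h f x).
Proof.
move=> df.
have cL : continuous (lsubmx : {linear 'rV[R]_(m + n) -> 'rV[R]_m}).
  by move=> y; exact: (Cn_linmx 0 (lsubmx : {linear 'rV[R]_(m + n) -> 'rV[R]_m}) y).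
have dL := linear_differentiable (f x) cL.
rewrite (@derive_comp _ _ _ _ f (lsubmx : {linear 'rV[R]_(m + n) -> 'rV[R]_m}) x h df dL).
by rewrite deriveE // diff_lin.
Qed.

Lemma derive_rsubmx V m n (f : V -> 'rV[R]_(m + n)) (x h : V) :
  differentiable f x -> 'D_h (fun y => rsubmx (f y)) x = rsubmx ('D_h f x).
Proof.
move=> df.
have cL : continuous (rsubmx : {linear 'rV[R]_(m + n) -> 'rV[R]_n}).
  by move=> y; exact: (Cn_linmx 0 (rsubmx : {linear 'rV[R]_(m + n) -> 'rV[R]_n}) y).
have dL := linear_differentiable (f x) cL.
rewrite (@derive_comp _ _ _ _ f (rsubmx : {linear 'rV[R]_(m + n) -> 'rV[R]_n}) x h df dL).
by rewrite deriveE // diff_lin.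
Qed.

Lemma derive_row_mx V m n (f : V -> 'rV[R]_m) (g : V -> 'rV[R]_n) (x h : V) :
  differentiable f x -> differentiable g x ->
  differentiable (fun y => row_mx (f y) (g y)) x ->
  'D_h (fun y => row_mx (f y) (g y)) x = row_mx ('D_h f x) ('D_h g x).
Proof.
move=> df dg dfg; rewrite -[LHS]hsubmxK -(derive_lsubmx h dfg) -(derive_rsubmx h dfg).
by congr (row_mx ('D_h _ x) ('D_h _ x)); apply/funext => y; rewrite (row_mxKl, row_mxKr).
Qed.

Lemma derive_bigsum V (W : normedModType R) n (F : 'I_n -> V -> W) (x h : V) :
  (forall i, differentiable (F i) x) ->
  'D_h (fun y => \sum_i F i y) x = \sum_i 'D_h (F i) x.
Proof.
move=> dF; have -> : (fun y => \sum_i F i y) = \sum_i F i.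
  by apply/funext => y; rewrite fct_sumE.
by apply: derive_sum => i; exact: diff_derivable.
Qed.

Lemma derive_scale V n (c : V -> R) (f : V -> 'rV[R]_n) (x h : V) :
  differentiable c x -> differentiable f x ->
  differentiable (fun y => c y *: f y) x ->
  'D_h (fun y => c y *: f y) x = 'D_h c x *: f x + c x *: 'D_h f x.
Proof.
move=> dc df dcf; apply/rowP => j; rewrite -(derive_coord h 0 j dcf) !mxE.
have dfj : differentiable (fun y => f y 0 j) x.
  exact: (@differentiable_comp _ _ _ _ f _ _ df (differentiable_coord _ 0 j)).
have -> : (fun y => (c y *: f y) 0 j) = c * (fun y => f y 0 j).
  by apply/funext => y; rewrite !mxE.
rewrite deriveM; [|exact: diff_derivable..].
by rewrite (derive_coord h 0 j df) addrC; congr (_ + _); exact: mulrC.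
Qed.

Lemma Cn_scale k V n (c : V -> R) (f : V -> 'rV[R]_n) (x : V) :
  Cn k c x -> Cn k f x -> Cn k (fun y => c y *: f y) x.
Proof.
move=> Hc Hf; apply: Cn_mx => i j.
apply: (@Cn_ext _ _ _ _ (fun y => c y * f y i j)); first by move=> y; rewrite mxE.
by apply: Cn_M => //; exact: Cn_coord.
Qed.

(* The coordinates are the inverse of Psi y = the flow at a fixed time tau of the
   field \sum_i (y_i / tau) Y_i; the parameters y are frozen state variables.
   Commutation makes s Y_i solve the variational equation, so d Psi / d y_i = Y_i. *)
Theorem commuting_fields_rectify p (P : pred 'I_p) (Y : 'I_p -> 'rV[R]_p -> 'rV[R]_p)
    (b : 'I_p -> 'rV[R]_p) (M : set 'rV[R]_p) (z0 : 'rV[R]_p) :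
  open M -> M z0 -> (forall i z, M z -> smooth (Y i) z) ->
  (forall i j z, M z -> 'D_(Y i z) (Y j) z = 'D_(Y j z) (Y i) z) ->
  (forall i, P i -> b i = Y i z0) ->
  (forall i, ~~ P i -> forall z, Y i z = 0) ->
  (forall c : 'rV[R]_p, \sum_i c 0 i *: b i = 0 -> c = 0) ->
  exists u : local_coordinates R p, [/\ lc_dom u z0, lc_dom u `<=` M &
    forall i z, P i -> lc_dom u z -> coordinate_field u i z = Y i z].
Proof.
move=> oM Mz0 sY comm bP bnP bfree.
pose G (s : 'rV[R]_(p + p)) := \sum_j lsubmx s 0 j *: Y j (rsubmx s).
pose f (s : 'rV[R]_(p + p)) : 'rV[R]_(p + p) := row_mx 0 (G s).
have sterm j s : M (rsubmx s) -> smooth (fun s : 'rV[R]_(p + p) => lsubmx s 0 j *: Y j (rsubmx s)) s.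
  move=> Ms k; apply: Cn_scale; first by apply: Cn_coord; apply: Cn_lsubmx; exact: Cn_id.
  by apply: (Cn_comp (Cn_rsubmx (Cn_id k s))); exact: sY.
have sG s : M (rsubmx s) -> smooth G s by move=> Ms k; apply: Cn_sum => j _; exact: sterm.
have sf s : M (rsubmx s) -> smooth f s.
  by move=> Ms k; apply: Cn_row_mx; [exact: Cn_cst | exact: sG].
have Df (s h : 'rV[R]_(p + p)) : M (rsubmx s) -> 'D_h f s =
    row_mx 0 (\sum_j (lsubmx h 0 j *: Y j (rsubmx s) + lsubmx s 0 j *: 'D_(rsubmx h) (Y j) (rsubmx s))).
  move=> Ms; rewrite /f.
  have dc0 : differentiable (fun _ : 'rV[R]_(p + p) => 0 : 'rV[R]_p) s by exact: differentiable_cst.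
  rewrite (derive_row_mx h dc0 (smooth_diff (sG s Ms)) (smooth_diff (sf s Ms))).
  rewrite derive_cst; congr row_mx; rewrite /G derive_bigsum; last first.
    by move=> j; exact: smooth_diff (sterm j s Ms).
  have dl : differentiable (fun s : 'rV[R]_(p + p) => lsubmx s) s.
    by apply: smooth_diff => k; apply: Cn_lsubmx; exact: Cn_id.
  have dr : differentiable (fun s : 'rV[R]_(p + p) => rsubmx s) s.
    by apply: smooth_diff => k; apply: Cn_rsubmx; exact: Cn_id.
  apply: eq_bigr => j _.
  have dlj : differentiable (fun s : 'rV[R]_(p + p) => lsubmx s 0 j) s.
    by apply: smooth_diff => k; apply: Cn_coord; apply: Cn_lsubmx; exact: Cn_id.
  have dY := smooth_diff (sY j _ Ms).
  have dYr : differentiable (fun s : 'rV[R]_(p + p) => Y j (rsubmx s)) s.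
    exact: (@differentiable_comp _ _ _ _ _ (Y j) _ dr dY).
  rewrite (derive_scale h dlj dYr (smooth_diff (sterm j s Ms))).
  rewrite (derive_coord h 0 j dl) (@derive_comp _ _ _ _ _ (Y j) s h dr dY).
  have did : differentiable (fun s : 'rV[R]_(p + p) => s) s by exact: smooth_diff (fun k => Cn_id k s).
  by rewrite (derive_lsubmx h did) (derive_rsubmx h did) derive_id.
pose s0 : 'rV[R]_(p + p) := row_mx 0 z0.
have [r0 r00 Hr0] : exists2 r0 : R, 0 < r0 & ball z0 r0 `<=` M.
  have /nbhs_ballP[r0] : nbhs z0 M by exact: open_nbhs_nbhs.
  by exists r0.
have ballM (s : 'rV[R]_(p + p)) : ball s0 r0 s -> M (rsubmx s).
  by rewrite -{1}[s]hsubmxK => /ball_row_mx[_ /Hr0].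
have Ms0 : M (rsubmx s0) by rewrite row_mxKr.
have [K [r [a [d [phi [SF rr0 _ _]]]]]] := local_flow_Cn 0 (sf _ Ms0) r00 ltr01.
have rM (s : 'rV[R]_(p + p)) : ball s0 r s -> M (rsubmx s) by move=> Hs; apply: ballM; exact: le_ball Hs.
have sphi := short_flow_smooth SF (fun s Hs => sf s (rM s Hs)).
have [[K0 r_gt0 a0 d0] [Est aK Hphi]] := SF.
(* Time 1 may lie outside the interval of existence; dividing the parameters by tau makes time tau
   play its role. *)
pose tau := a / 2; have tau0 : 0 < tau by rewrite divr_gt0.
have tau_neq0 : tau != 0 by rewrite gt_eqF.
have taua : `|tau| < a by rewrite gtr0_norm // /tau; lra.
(* Coordinates outside P displace the starting point along the vectors b j, which complete the
   values of the given fields at z0 to a basis. *)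
pose E (y : 'rV[R]_p) := \sum_(j | ~~ P j) y 0 j *: b j.
have Elin : linear E.
  move=> c y z; rewrite /E scaler_sumr -big_split; apply: eq_bigr => j _.
  by rewrite !mxE scalerDl scalerA.
pose EM := GRing.isLinear.Build _ _ _ _ _ Elin.
pose EL : {linear 'rV[R]_p -> 'rV[R]_p} := HB.pack E EM.
pose start (y : 'rV[R]_p) : 'rV[R]_(p + p) := row_mx (tau^-1 *: y) (z0 + E y).
have sst y : smooth start y.
  move=> k; apply: Cn_row_mx; first by apply: Cn_Z; exact: Cn_id.
  by apply: Cn_D; [exact: Cn_cst | exact: (Cn_linmx k EL y)].
have start0 : start 0 = s0.
  have E0 : E 0 = 0 by exact: (linear0 EL).
  by rewrite /start scaler0 E0 addr0.
have Dstart (y h : 'rV[R]_p) : 'D_h start y = row_mx (tau^-1 *: h) (E h).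
  have cE : continuous EL by move=> z; exact: (Cn_linmx 0 EL z).
  have d1 : differentiable (fun y : 'rV[R]_p => tau^-1 *: y) y.
    by apply: smooth_diff => k; apply: Cn_Z; exact: Cn_id.
  have dE : differentiable E y by exact: (linear_differentiable y cE).
  have d2 : differentiable (fun y : 'rV[R]_p => z0 + E y) y.
    by apply: smooth_diff => k; apply: Cn_D; [exact: Cn_cst | exact: (Cn_linmx k EL y)].
  rewrite (derive_row_mx h d1 d2 (smooth_diff (sst y))); congr row_mx.
    rewrite -[fun y => _]/(tau^-1 \*: id) deriveZ; last exact: derivable_id.
    by rewrite derive_id.
  rewrite -[fun y => _]/(cst z0 + E) deriveD; [|exact: derivable_cst|exact: diff_derivable].
  by rewrite derive_cst add0r deriveE // (diff_lin y cE).
have Edelta i : E (delta_mx 0 i) = if P i then 0 else b i.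
  rewrite /E; case: ifPn => Pi.
    apply: big1 => j Pj; rewrite mxE eqxx /=.
    have /negbTE -> : j != i by apply: contraNneq Pj => ->.
    by rewrite scale0r.
  rewrite (bigD1 i) //= mxE !eqxx scale1r big1 ?addr0 // => j /andP[_ ji].
  by rewrite mxE (negbTE ji) andbF scale0r.
pose W := [set y | ball s0 d (start y)].
pose Psi y := rsubmx (phi tau (start y)).
have oW : open W.
  rewrite openE => y Wy.
  by have := smooth_continuous (sst y); apply; exact: near_ball.
have sPsi y : W y -> smooth Psi y.
  by move=> Wy k; apply: Cn_rsubmx; apply: (Cn_comp (sst y k)); exact: sphi.
have DPsi y h : W y -> 'D_h Psi y = rsubmx ('D_('D_h start y) (phi tau) (start y)).
  move=> Wy; have d1 := smooth_diff (sst y); have d2 := smooth_diff (sphi _ _ taua Wy).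
  have d3 := @differentiable_comp _ _ _ _ start (phi tau) y d1 d2.
  by rewrite (derive_rsubmx h d3) (@derive_comp _ _ _ _ start (phi tau) y h d1 d2).
have frozen x (t : R) : ball s0 d x -> `|t| < a -> lsubmx (phi t x) = lsubmx x.
  move=> Hx ta; have [p0 p1] := Hphi x Hx.
  have := @mvi_curve0 R p (fun s => lsubmx (phi s x)) (fun=> 0) t 0 (lexx 0).
  rewrite mul0r p0 => H; apply/eqP; rewrite -subr_eq0 -normr_le0.
  apply: H => s st; rewrite normr0; split; last exact: lexx.
  have [D _] := p1 s (le_lt_trans st ta).
  by have := is_derive_lsubmx D; rewrite row_mxKl.
have W0 : W 0 by rewrite /W /= start0; exact: ballxx.
have key y i : W y -> P i -> 'D_(delta_mx 0 i) Psi y = Y i (Psi y).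
  move=> Wy Pi; rewrite DPsi // Dstart Edelta Pi.
  have [p0 p1] := Hphi _ Wy; set x := start y in p0 p1 *.
  pose w (s : R) := row_mx (tau^-1 *: delta_mx 0 i : 'rV[R]_p)
    ((tau^-1 * s) *: Y i (rsubmx (phi s x))).
  have w0 : w 0 = row_mx (tau^-1 *: delta_mx 0 i) 0 by rewrite /w mulr0 scale0r.
  have Hw (s : R) : `|s| < a -> is_derive s 1 w ('D_(w s) f (phi s x)).
    move=> sa; have [D S] := p1 s sa; have MS := rM _ S.
    rewrite Df // /w row_mxKl row_mxKr.
    apply: (@is_derive_row_mx R p p (fun=> tau^-1 *: delta_mx 0 i)
      (fun s => (tau^-1 * s) *: Y i (rsubmx (phi s x))) s 0).
    set z := rsubmx (phi s x) in MS *.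
    have Dz : is_derive s 1 (fun s => rsubmx (phi s x)) (G (phi s x)).
      by have := is_derive_rsubmx D; rewrite row_mxKr.
    have dY := smooth_diff (sY i _ MS).
    have /derivable1_diffP dz : derivable (fun s => rsubmx (phi s x)) s 1 by case: Dz.
    have dYz := @differentiable_comp _ _ _ _ (fun s => rsubmx (phi s x)) (Y i) s dz dY.
    have dc : differentiable (fun s : R => tau^-1 * s) s.
      by apply: smooth_diff => k; apply: Cn_M; [exact: Cn_cst | exact: Cn_id].
    have dcY : differentiable (fun s : R => (tau^-1 * s) *: Y i (rsubmx (phi s x))) s.
      apply/derivable1_diffP/derivable_mxP => i' j'.
      have -> : (fun s : R => ((tau^-1 * s) *: Y i (rsubmx (phi s x))) i' j') =
         (fun s : R => tau^-1 * s) * (fun s => Y i (rsubmx (phi s x)) i' j').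
        by apply/funext => s'; rewrite mxE.
      apply: derivableM; first exact: diff_derivable.
      by have /derivable_mxP := @diff_derivable _ _ _ _ _ (1 : R) dYz; apply.
    apply: DeriveDef; first exact: diff_derivable.
    rewrite (derive_scale (1 : R) dc dYz dcY).
    rewrite (@derive_comp _ _ _ _ (fun s => rsubmx (phi s x)) (Y i) s (1 : R) dz dY).
    have -> : 'D_1 (fun s : R => rsubmx (phi s x)) s = G (phi s x) by case: Dz.
    have -> : 'D_1 (fun s : R => tau^-1 * s) s = tau^-1.
      rewrite -[fun s : R => _]/(tau^-1 \*: id) deriveZ; last exact: derivable_id.
      by rewrite derive_id; exact: mulr1.
    rewrite -/z big_split /=; congr (_ + _).
      rewrite (bigD1 i) //= !mxE !eqxx mulr1 big1 ?addr0 // => j ji.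
      by rewrite !mxE (negbTE ji) andbF mulr0 scale0r.
    rewrite /G.
    (* The derivative of [Y i] along the trajectory is expanded over j so that [comm] can exchange
       [Y i] with each [Y j] separately. *)
    have -> : 'D_(\sum_j lsubmx (phi s x) 0 j *: Y j z) (Y i) z =
        \sum_j lsubmx (phi s x) 0 j *: 'D_(Y j z) (Y i) z.
      by rewrite deriveE // linear_sum; apply: eq_bigr => j _; rewrite linearZ deriveE.
    rewrite scaler_sumr; apply: eq_bigr => j _.
    rewrite deriveZl; last exact: smooth_diff (sY j _ MS).
    by rewrite comm // !scalerA mulrC.
  have [_ ->] := short_flow_variational SF Wy Hw w0 taua.
  by rewrite row_mxKr mulVf // scale1r.
have fs0 : f s0 = 0.
  rewrite /f /G row_mxKl big1 ?row_mx0 // => j _.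
  by rewrite mxE scale0r.
have fixed (t : R) : `|t| < a -> phi t s0 = s0.
  have [p0 p1] := Hphi s0 (ballxx _ d0).
  apply: (@flow_unique R _ f (ball s0 r) (phi^~ s0) (fun=> s0) a K (ltW K0) aK) => //.
    by move=> u v Hu Hv; have [_ _ h' _] := Est u Hu; exact: h'.
  by move=> t' _; rewrite fs0; split; [exact: is_derive_cst | exact: ballxx].
have Psi0 : Psi 0 = z0 by rewrite /Psi start0 fixed // row_mxKr.
have key0 i : 'D_(delta_mx 0 i) Psi 0 = b i.
  case Pi: (P i); first by rewrite key // Psi0 bP.
  rewrite DPsi // Dstart Edelta Pi start0.
  (* Along the constant trajectory s0 all parameters are 0, and [Y i] is the zero field for i
     outside P; hence the variational equation is solved by a constant. *)
  pose w (s : R) := row_mx (tau^-1 *: delta_mx 0 i : 'rV[R]_p) (b i).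
  have Hw (s : R) : `|s| < a -> is_derive s 1 w ('D_(w s) f (phi s s0)).
    move=> sa; rewrite fixed // Df // /w !row_mxKl !row_mxKr big1; last first.
      move=> j _; rewrite !mxE scale0r addr0 eqxx /=.
      have [->|ji] := eqVneq j i; first by rewrite bnP ?Pi // scaler0.
      by rewrite mulr0 scale0r.
    by rewrite row_mx0; exact: is_derive_cst.
  have [_ ->] := short_flow_variational SF (ballxx s0 d0) Hw erefl taua.
  by rewrite row_mxKr.
have inj h : 'D_h Psi 0 = 0 -> h = 0.
  rewrite (derive_sum_coord _ (smooth_diff (sPsi 0 W0))) => H; apply: bfree.
  by rewrite -[RHS]H; apply: eq_bigr => j _; rewrite key0.
have [D [g [[oD D0] DW oPD gK sg]]] := inverse_function oW W0 sPsi inj.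
have Psig z : (Psi @` D) z -> Psi (g z) = z /\ D (g z).
  by move=> [y Dy <-]; rewrite gK.
have gD : g @` (Psi @` D) = D.
  rewrite predeqE => y; split; first by move=> [z /Psig[_ Dz] <-].
  by move=> Dy; exists (Psi y); [exact: imageP | exact: gK].
have ogD : open (g @` (Psi @` D)) by rewrite gD.
have Psi_smooth : smooth_on (g @` (Psi @` D)) Psi.
  by apply: smooth_smooth_on => y; rewrite gD => /DW; exact: sPsi.
(* The coordinate map is g and its inverse is [Psi], so [coordinate_field] is by definition a
   partial derivative of [Psi]. *)
pose u := @LocalCoordinates R p (Psi @` D) g Psi oPD ogD (fun z Hz => proj1 (Psig z Hz))
  (smooth_smooth_on sg) Psi_smooth.
exists u; split.
- by exists 0.
- move=> _ [y Dy <-]; apply: rM; have [_ p1] := Hphi _ (DW _ Dy).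
  by have [] := p1 tau taua.
- move=> i z Pi Hz; have [E1 Dg] := Psig z Hz.
  by rewrite /coordinate_field /= key ?E1 //; exact: DW.
Qed.

End Rectification.

(** * Infinitesimal actions of local groups *)

Section LocalGroupCalculus.
Context {R : realType}.
Implicit Types U V W : normedModType R.

Lemma near_prod_nest U V (x : U) (y : V) (P : U -> V -> Prop) :
  (\forall q \near (x, y), P q.1 q.2) -> \forall b \near y, \forall a \near x, P a b.
Proof.
move=> [[A B] /= [HA HB] AB]; apply: filterS HB => b Bb; apply: filterS HA => a Aa.
exact: (AB (a, b)).
Qed.

Lemma near_prod_nest2 U V (x : U) (y : V) (P : U -> V -> Prop) :
  (\forall q \near (x, y), P q.1 q.2) -> \forall a \near x, \forall b \near y, P a b.
Proof.
move=> [[A B] /= [HA HB] AB]; apply: filterS HA => a Aa; apply: filterS HB => b Bb.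
exact: (AB (a, b)).
Qed.

Lemma near_fst_arg U V (x : U) (y : V) (P : U * V -> Prop) :
  (\forall q \near (x, y), P q) -> \forall a \near x, P (a, y).
Proof.
move=> [[A B] /= [HA HB] AB]; apply: filterS HA => a Aa.
by apply: (AB (a, y)); split=> //=; exact: nbhs_singleton HB.
Qed.

Lemma near_snd_arg U V (x : U) (y : V) (P : U * V -> Prop) :
  (\forall q \near (x, y), P q) -> \forall b \near y, P (x, b).
Proof.
move=> [[A B] /= [HA HB] AB]; apply: filterS HB => b Bb.
by apply: (AB (x, b)); split=> //=; exact: nbhs_singleton HA.
Qed.

Lemma derive_pair U V W (f : U -> V) (g : U -> W) (x h : U) :
  differentiable f x -> differentiable g x ->
  'D_h (fun y => (f y, g y)) x = ('D_h f x, 'D_h g x).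
Proof.
move=> df dg; rewrite (deriveE _ (differentiable_pair df dg)) diff_pair //.
by rewrite !deriveE.
Qed.

Lemma derive_near_id U (f : U -> U) (x v : U) :
  (\forall y \near x, f y = y) -> 'D_v f x = v.
Proof. by move=> H; rewrite (near_eq_derive v H) derive_id. Qed.

Lemma smooth_fst_arg U V W (T : U * V -> W) (x : U) (k : V) :
  smooth T (x, k) -> smooth (fun y => T (y, k)) x.
Proof.
move=> sT l; apply: (@Cn_comp _ _ _ _ _ (fun y => (y, k)) T); last exact: sT.
by apply: Cn_pair; [exact: Cn_id | exact: Cn_cst].
Qed.

Lemma smooth_snd_arg U V W (T : U * V -> W) (x : U) (k : V) :
  smooth T (x, k) -> smooth (fun y => T (x, y)) k.
Proof.
move=> sT l; apply: (@Cn_comp _ _ _ _ _ (fun y => (x, y)) T); last exact: sT.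
by apply: Cn_pair; [exact: Cn_cst | exact: Cn_id].
Qed.

Lemma derive_tangent_comp U V W (T : V -> W) (gamma mu : U -> V) (x h : U) :
  smooth T (gamma x) -> differentiable gamma x -> differentiable mu x ->
  'D_h (fun y => 'D_(mu y) T (gamma y)) x =
  'D_('D_h gamma x) (fun q => 'D_(mu x) T q) (gamma x) + 'D_('D_h mu x) T (gamma x).
Proof.
move=> sT dg dm.
have dT := smooth_diff (smooth_tangent (mu x) sT).
have dp := differentiable_pair dg dm.
have := @derive_comp _ _ _ _ (fun y => (gamma y, mu y)) (fun q : V * V => 'D_q.2 T q.1) x h dp dT.
by rewrite /= => ->; rewrite derive_pair // derive_tangent.
Qed.

(** The bilinear part of the Taylor expansion of a group law at its unit. Antisymmetrized in v and w
    it is the Lie bracket, see [lie_bracketE]. *)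
Definition mixed_derivative U (m : U * U -> U) (e v w : U) : U :=
  'D_(0, w) (fun q => 'D_(v, 0) m q) (e, e).

(* Differentiate alpha (m (x, y), z) = alpha (x, alpha (y, z)) first in x, then in y. *)
Lemma infinitesimal_action U V (m : U * U -> U) (alpha : U * V -> V) (e : U) (z : V) (v w : U) :
  smooth m (e, e) -> smooth alpha (e, z) ->
  (\forall x \near e, m (x, e) = x) -> (\forall y \near e, m (e, y) = y) ->
  (\forall z' \near z, alpha (e, z') = z') ->
  (\forall q \near (e, e), alpha (m q, z) = alpha (q.1, alpha (q.2, z))) ->
  'D_('D_(w, 0) alpha (e, z)) (fun z' => 'D_(v, 0) alpha (e, z')) z =
  'D_(w, 0) (fun q => 'D_(v, 0) alpha q) (e, z) +
  'D_(mixed_derivative m e v w, 0) alpha (e, z).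
Proof.
move=> sm sa me em az act.
(* For a group law, [mu] is the right-invariant field with value v at the unit. *)
pose mu y := 'D_(v, 0) m (e, y).
have eme : m (e, e) = e by exact: nbhs_singleton me.
have aez : alpha (e, z) = z by exact: nbhs_singleton az.
have smv := smooth_derive (v, 0) sm.
have sav := smooth_derive (v, 0) sa.
have sy := smooth_fst_arg sa.
have smu : smooth mu e by exact: (smooth_snd_arg smv).
have step : \forall y \near e, 'D_(mu y, 0) alpha (y, z) = 'D_(v, 0) alpha (e, alpha (y, z)).
  have N1 : \forall y \near e, differentiable m (e, y).
    exact: near_snd_arg (smooth_near_diff sm).
  have N2 : \forall y \near e, differentiable alpha (y, z).
    exact: near_fst_arg (smooth_near_diff sa).
  have N3 : \forall y \near e, differentiable alpha (e, alpha (y, z)).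
    have c := smooth_continuous sy; rewrite /prop_for /continuous_at aez in c.
    have : \forall z' \near z, differentiable alpha (e, z').
    exact: near_snd_arg (smooth_near_diff sa).
    by move=> /c.
  have N4 : \forall y \near e, \forall x \near e, alpha (m (x, y), z) = alpha (x, alpha (y, z)).
    apply: (@near_prod_nest _ _ e e (fun x y => alpha (m (x, y), z) = alpha (x, alpha (y, z)))).
    by apply: filterS act => -[].
  apply: filter_app N1; apply: filter_app N2; apply: filter_app N3; apply: filter_app N4.
  apply: filterS em => y emy E d3 d2 d1.
  have dmx : differentiable (fun x => m (x, y)) e.
    exact: (@differentiable_comp _ _ _ _ (fun x => (x, y)) m e
      (differentiable_pair (smooth_diff (fun k => Cn_id k e)) (differentiable_cst _ _)) d1).
  have dcz : differentiable (fun _ : U => z) e by exact: differentiable_cst.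
  have dp := differentiable_pair dmx dcz.
  have d2' : differentiable alpha (m (e, y), z) by rewrite emy.
  have := near_eq_derive v E.
  rewrite (@derive_comp _ _ _ _ (fun x => (m (x, y), z)) alpha e v dp d2').
  rewrite (@derive_fst _ _ _ _ (fun q => alpha q) e v (alpha (y, z)) d3) => <-.
  by rewrite (derive_pair v dmx dcz) derive_cst (derive_fst v d1) emy.
have := near_eq_derive w step.
have dmu := smooth_diff smu.
have dc0 : differentiable (fun _ : U => 0 : V) e by exact: differentiable_cst.
have dcz : differentiable (fun _ : U => z) e by exact: differentiable_cst.
have did : differentiable (fun y : U => y) e by exact: smooth_diff (fun k => Cn_id k e).
rewrite (@derive_tangent_comp _ _ _ alpha (fun y => (y, z)) (fun y => (mu y, 0)) e w sa
  (differentiable_pair did dcz) (differentiable_pair dmu dc0)).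
rewrite (derive_pair w did dcz) (derive_pair w dmu dc0) !derive_cst derive_id.
have -> : mu e = v.
  by rewrite /mu -(derive_fst v (smooth_diff sm)) (derive_near_id v me).
have Emu : 'D_w mu e = mixed_derivative m e v w by exact: (derive_snd w (smooth_diff smv)).
rewrite Emu => ->.
have sX : smooth (fun z' => 'D_(v, 0) alpha (e, z')) (alpha (e, z)).
  by rewrite aez; exact: (smooth_snd_arg sav).
rewrite (@derive_comp _ _ _ _ (fun y => alpha (y, z)) (fun z' => 'D_(v, 0) alpha (e, z')) e w
  (smooth_diff sy) (smooth_diff sX)).
by rewrite aez (derive_fst w (smooth_diff sa)).
Qed.

Lemma derive_fst_lin U V W (T : U * V -> W) (q : U * V) (a : R) (h k : U) :
  differentiable T q -> 'D_(a *: h + k, 0) T q = a *: 'D_(h, 0) T q + 'D_(k, 0) T q.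
Proof.
move=> dT; rewrite -(deriveZl _ _ dT) -(deriveDl _ _ dT); congr ('D_ _ _ _).
by congr (_, _); rewrite /= scaler0 addr0.
Qed.

Lemma derive_fst_sub U V W (T : U * V -> W) (q : U * V) (h k : U) :
  differentiable T q -> 'D_(h - k, 0) T q = 'D_(h, 0) T q - 'D_(k, 0) T q.
Proof.
move=> dT; rewrite -(deriveBl _ _ dT); congr ('D_ _ _ _).
by congr (_, _); rewrite /= subr0.
Qed.

(** In [infinitesimal_action] the second derivative of alpha is symmetric in v and w and drops out
    of the bracket. The sign arises because the derivative of the w-field along the v-field involves
    the mixed derivative with v and w exchanged. *)
Lemma infinitesimal_action_bracket U p (m : U * U -> U) (alpha : U * 'rV[R]_p -> 'rV[R]_p)
    (e : U) (z : 'rV[R]_p) (v w : U) :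
  smooth m (e, e) -> smooth alpha (e, z) ->
  (\forall x \near e, m (x, e) = x) -> (\forall y \near e, m (e, y) = y) ->
  (\forall z' \near z, alpha (e, z') = z') ->
  (\forall q \near (e, e), alpha (m q, z) = alpha (q.1, alpha (q.2, z))) ->
  field_bracket (fun z' => 'D_(v, 0) alpha (e, z')) (fun z' => 'D_(w, 0) alpha (e, z')) z =
  - 'D_(mixed_derivative m e v w - mixed_derivative m e w v, 0) alpha (e, z).
Proof.
move=> sm sa me em az act; rewrite /field_bracket.
rewrite (infinitesimal_action w v sm sa me em az act).
rewrite (infinitesimal_action v w sm sa me em az act).
rewrite (derive_sym (v, 0) (w, 0) sa) (derive_fst_sub _ _ (smooth_diff sa)).
by rewrite opprD addrACA subrr add0r opprB.
Qed.

Lemma addr_eq_sub (Z : zmodType) (a b c : Z) : a + b = c -> b = c - a.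
Proof. by move=> <-; rewrite addrAC subrr add0r. Qed.

(* Differentiate m (C (x, y), x) = m (x, y) first in y, then in x. *)
Lemma conjugation_bracket r (m C : 'rV[R]_r * 'rV[R]_r -> 'rV[R]_r) (e v w : 'rV[R]_r) :
  smooth m (e, e) -> smooth C (e, e) ->
  (\forall x \near e, m (x, e) = x) -> (\forall y \near e, m (e, y) = y) ->
  (\forall x \near e, C (x, e) = e) -> (\forall y \near e, C (e, y) = y) ->
  (\forall q \near (e, e), m (C q, q.1) = m q) ->
  'D_(v, 0) (fun q => 'D_(0, w) C q) (e, e) =
  mixed_derivative m e v w - mixed_derivative m e w v.
Proof.
move=> sm sC me em Ce eC H.
(* When C is conjugation, [u x] is Ad(x) w, and its derivative at e is the bracket. *)
pose u x := 'D_(0, w) C (x, e).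
have scw := smooth_derive (0, w) sC.
have su : smooth u e by exact: (smooth_fst_arg scw).
have step : \forall x \near e, 'D_(u x, 0) m (e, x) = 'D_(0, w) m (x, e).
  have N1 : \forall x \near e, differentiable m (e, x).
    exact: near_snd_arg (smooth_near_diff sm).
  have N2 : \forall x \near e, differentiable m (x, e).
    exact: near_fst_arg (smooth_near_diff sm).
  have N3 : \forall x \near e, differentiable C (x, e).
    exact: near_fst_arg (smooth_near_diff sC).
  have N4 : \forall x \near e, \forall y \near e, m (C (x, y), x) = m (x, y).
    apply: (@near_prod_nest2 _ _ e e (fun x y => m (C (x, y), x) = m (x, y))).
    by apply: filterS H => -[].
  apply: filter_app N1; apply: filter_app N2; apply: filter_app N3; apply: filter_app N4.
  apply: filterS Ce => x Cxe E d3 d2 d1.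
  have dCy : differentiable (fun y => C (x, y)) e.
    exact: (@differentiable_comp _ _ _ _ (fun y => (x, y)) C e
      (differentiable_pair (differentiable_cst _ _) (smooth_diff (fun k => Cn_id k e))) d3).
  have dcx : differentiable (fun _ : 'rV[R]_r => x) e by exact: differentiable_cst.
  have dp := differentiable_pair dCy dcx.
  have d1' : differentiable m (C (x, e), x) by rewrite Cxe.
  have := near_eq_derive w E.
  rewrite (@derive_comp _ _ _ _ (fun y => (C (x, y), x)) m e w dp d1').
  rewrite (@derive_snd _ _ _ _ m x e w d2) => <-.
  by rewrite (derive_pair w dCy dcx) derive_cst (derive_snd w d3) Cxe.
have := near_eq_derive v step.
have du := smooth_diff su.
have dc0 : differentiable (fun _ : 'rV[R]_r => 0 : 'rV[R]_r) e by exact: differentiable_cst.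
have dce : differentiable (fun _ : 'rV[R]_r => e) e by exact: differentiable_cst.
have did : differentiable (fun y : 'rV[R]_r => y) e by exact: smooth_diff (fun k => Cn_id k e).
rewrite (@derive_tangent_comp _ _ _ m (fun x => (e, x)) (fun x => (u x, 0)) e v sm
  (differentiable_pair dce did) (differentiable_pair du dc0)).
rewrite (derive_pair v dce did) (derive_pair v du dc0) !derive_cst derive_id.
have -> : u e = w by rewrite /u -(derive_snd w (smooth_diff sC)) (derive_near_id w eC).
rewrite (derive_fst v (smooth_diff (smooth_derive (0, w) sm))).
rewrite -(derive_fst _ (smooth_diff sm)) (derive_near_id _ me).
have Eu : 'D_v u e = 'D_(v, 0) (fun q => 'D_(0, w) C q) (e, e).
  exact: (derive_fst v (smooth_diff scw)).
have Em : 'D_(v, 0) (fun q => 'D_(0, w) m q) (e, e) = mixed_derivative m e v w.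
  exact: (derive_sym (v, 0) (0, w) sm).
move=> /addr_eq_sub E; apply: etrans (esym Eu) _; apply: etrans E _.
exact: (f_equal2 (fun a b => a - b) Em erefl).
Qed.

Lemma derive_field p (X Y : 'rV[R]_p -> 'rV[R]_p) (z h : 'rV[R]_p) :
  smooth X z -> smooth Y z ->
  'D_h (fun y => 'D_(X y) Y y) z = 'D_h (fun y => 'D_(X z) Y y) z + 'D_('D_h X z) Y z.
Proof.
move=> sX sY.
rewrite (@derive_tangent_comp _ _ _ Y (fun y => y) X z h sY
  (smooth_diff (fun k => Cn_id k z)) (smooth_diff sX)).
by rewrite derive_id.
Qed.

Lemma smooth_nabla p (X Y : 'rV[R]_p -> 'rV[R]_p) (z : 'rV[R]_p) :
  smooth X z -> smooth Y z -> smooth (fun y => 'D_(X y) Y y) z.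
Proof.
move=> sX sY k.
apply: (@Cn_comp _ _ _ _ _ (fun y => (y, X y)) (fun q : 'rV[R]_p * 'rV[R]_p => 'D_q.2 Y q.1)).
  by apply: Cn_pair; [exact: Cn_id | exact: sX].
exact: (smooth_tangent (X z) sY).
Qed.

Lemma derive_field_bracket p (X Y : 'rV[R]_p -> 'rV[R]_p) (z h : 'rV[R]_p) :
  smooth X z -> smooth Y z ->
  'D_h (field_bracket X Y) z =
  'D_h (fun y => 'D_(X z) Y y) z + 'D_('D_h X z) Y z -
  ('D_h (fun y => 'D_(Y z) X y) z + 'D_('D_h Y z) X z).
Proof.
move=> sX sY.
have d1 := smooth_diff (smooth_nabla sX sY); have d2 := smooth_diff (smooth_nabla sY sX).
apply: etrans (deriveB (diff_derivable d1) (diff_derivable d2)) _.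
exact: (f_equal2 (fun a b => a - b) (derive_field h sX sY) (derive_field h sY sX)).
Qed.

Definition nabla2 p (X Y Z : 'rV[R]_p -> 'rV[R]_p) (z : 'rV[R]_p) : 'rV[R]_p :=
  'D_('D_(X z) Y z) Z z.

Definition hessian p (X Y Z : 'rV[R]_p -> 'rV[R]_p) (z : 'rV[R]_p) : 'rV[R]_p :=
  'D_(X z) (fun y => 'D_(Y z) Z y) z.

Lemma hessian_sym p (X Y Z : 'rV[R]_p -> 'rV[R]_p) (z : 'rV[R]_p) : smooth Z z ->
  hessian X Y Z z = hessian Y X Z z.
Proof. exact: derive_sym. Qed.

Lemma field_bracket2 p (X Y Z : 'rV[R]_p -> 'rV[R]_p) (z : 'rV[R]_p) :
  smooth X z -> smooth Y z -> smooth Z z ->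
  field_bracket X (field_bracket Y Z) z =
  hessian X Y Z z + nabla2 X Y Z z - (hessian X Z Y z + nabla2 X Z Y z) -
  (nabla2 Y Z X z - nabla2 Z Y X z).
Proof.
move=> sX sY sZ.
exact: (f_equal2 (fun a b => a - b) (derive_field_bracket (X z) sY sZ)
  (deriveBl _ _ (smooth_diff sX))).
Qed.

#[local] Opaque nabla2 hessian.

Lemma jacobi_cancel p (a1 a2 b1 b2 c1 c2 d1 d2 d3 d4 d5 d6 : 'rV[R]_p) :
  a1 = a2 -> b1 = b2 -> c1 = c2 ->
  a1 + d1 - (b1 + d2) - (d3 - d4) + (c2 + d3 - (a2 + d5) - (d6 - d2)) +
  (b2 + d6 - (c1 + d4) - (d1 - d5)) = 0.
Proof. by move=> -> -> ->; apply/rowP => i; rewrite !mxE; ring. Qed.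

(** Each double bracket expands into Hessian terms and terms with two first derivatives. In the
    cyclic sum the latter cancel in pairs, and so do the former once the second derivatives are
    known to be symmetric. The identity serves to obtain the Jacobi identity of the Lie algebra. *)
Lemma field_bracket_jacobi p (X Y Z : 'rV[R]_p -> 'rV[R]_p) (z : 'rV[R]_p) :
  smooth X z -> smooth Y z -> smooth Z z ->
  field_bracket X (field_bracket Y Z) z + field_bracket Y (field_bracket Z X) z +
  field_bracket Z (field_bracket X Y) z = 0.
Proof.
move=> sX sY sZ.
rewrite (field_bracket2 sX sY sZ) (field_bracket2 sY sZ sX) (field_bracket2 sZ sX sY).
exact: (jacobi_cancel _ _ _ _ _ _ (hessian_sym X Y sZ) (hessian_sym X Z sY) (hessian_sym Z Y sX)).
Qed.

End LocalGroupCalculus.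

(** * The group law in a chart *)

Section LieChart.
Context {R : realType} {r : nat} {G : lieGroupType R r}.

#[local] Notation c := (chart_map (chart1 G)).
#[local] Notation ci := (chart_inv (chart1 G)).
#[local] Notation D := (chart_dom (chart1 G)).
#[local] Notation e := (chart1 G 1%g).

Lemma smooth_on_nbhs m n (U : set 'rV[R]_n) (f : 'rV[R]_n -> 'rV[R]_m) (x : 'rV[R]_n) :
  smooth_on U f -> nbhs x U -> smooth f x.
Proof.
move=> sf Ux; apply: (@smooth_on_smooth _ _ _ (interior U)) => //.
  exact: open_interior.
by move=> s y /interior_subset; exact: sf.
Qed.

Lemma chart1_dom1 : D 1%g.
Proof. exact: chart_at_mem. Qed.

Lemma chart1_inv1 : ci e = 1%g.
Proof. by rewrite chart_mapK //; exact: chart1_dom1. Qed.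

Lemma chart1_invK (x : 'rV[R]_r) : (c @` D) x -> D (ci x) /\ c (ci x) = x.
Proof. by move=> [g Dg <-]; rewrite chart_mapK. Qed.

Lemma near_chart_dom : \forall g \near (1%g : G), D g.
Proof. by apply: open_nbhs_nbhs; split; [exact: chart_dom_open | exact: chart1_dom1]. Qed.

Lemma near_chart_cod : \forall x \near e, (c @` D) x.
Proof.
apply: open_nbhs_nbhs; split; first exact: chart_cod_open.
by exists 1%g => //; exact: chart1_dom1.
Qed.

Lemma chart_inv_cvg : ci x @[x --> e] --> (1%g : G).
Proof.
rewrite -{2}chart1_inv1; apply: chart_inv_continuous.
exact: nbhs_singleton near_chart_cod.
Qed.

Lemma chart_cvg : c g @[g --> (1%g : G)] --> e.
Proof. exact: chart_map_continuous chart1_dom1. Qed.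

Lemma near_chart_invK : \forall x \near e, D (ci x) /\ c (ci x) = x.
Proof. by apply: filterS near_chart_cod => x /chart1_invK. Qed.

(** The product read in the preferred chart at the unit. Outside the chart its values are arbitrary,
    so the group axioms are available only near e, as statements on germs. *)
Definition lie_op (q : 'rV[R]_r * 'rV[R]_r) : 'rV[R]_r := c (ci q.1 * ci q.2)%g.

Definition lie_neg (x : 'rV[R]_r) : 'rV[R]_r := c ((ci x)^-1)%g.

Definition lie_conj (q : 'rV[R]_r * 'rV[R]_r) : 'rV[R]_r :=
  c (ci q.1 * ci q.2 * (ci q.1)^-1)%g.

Lemma mulg_cvg (T : Type) (F : set_system T) (FF : Filter F) (f g : T -> G) (a b : G) :
  f @ F --> a -> g @ F --> b -> (f x * g x)%g @[x --> F] --> (a * b)%g.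
Proof.
move=> fa gb; apply: (@cvg_comp _ _ _ (fun x => (f x, g x)) (fun gh : G * G => (gh.1 * gh.2)%g)
  F (nbhs (a, b))); first exact: cvg_pair.
exact: (@lie_mul_continuous R r G (a, b)).
Qed.

Lemma invg_cvg (T : Type) (F : set_system T) (f : T -> G) (a : G) :
  f @ F --> a -> (f x)^-1%g @[x --> F] --> a^-1%g.
Proof.
by move=> fa; apply: cvg_comp fa _; exact: (@lie_inv_continuous R r G a).
Qed.

Lemma chart_inv_fst_cvg : ci q.1 @[q --> (e, e)] --> (1%g : G).
Proof. exact: cvg_comp (@cvg_fst _ _ (nbhs e) (nbhs e) _) chart_inv_cvg. Qed.

Lemma chart_inv_snd_cvg : ci q.2 @[q --> (e, e)] --> (1%g : G).
Proof. exact: cvg_comp (@cvg_snd _ _ (nbhs e) (nbhs e) _) chart_inv_cvg. Qed.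

Lemma mul_cvg1 : (ci q.1 * ci q.2)%g @[q --> (e, e)] --> (1%g : G).
Proof. by rewrite -[1%g in X in _ --> X]mulg1; exact: mulg_cvg chart_inv_fst_cvg chart_inv_snd_cvg. Qed.

Lemma near_lie_opK : \forall q \near (e, e), ci (lie_op q) = (ci q.1 * ci q.2)%g.
Proof.
have : \forall q \near (e, e), D (ci q.1 * ci q.2)%g by exact: mul_cvg1 near_chart_dom.
by apply: filterS => q Dq; rewrite /lie_op chart_mapK.
Qed.

Lemma lie_op_cvg : lie_op q @[q --> (e, e)] --> e.
Proof. exact: cvg_comp mul_cvg1 chart_cvg. Qed.

Lemma lie_op_e : lie_op (e, e) = e.
Proof. by rewrite /lie_op /= chart1_inv1 mulg1. Qed.

Lemma near_lie_ope : \forall x \near e, lie_op (x, e) = x.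
Proof. by apply: filterS near_chart_invK => x [_]; rewrite /lie_op /= chart1_inv1 mulg1. Qed.

Lemma near_lie_eop : \forall x \near e, lie_op (e, x) = x.
Proof. by apply: filterS near_chart_invK => x [_]; rewrite /lie_op /= chart1_inv1 mul1g. Qed.

Lemma near_sub_row m n (x : 'rV[R]_m) (y : 'rV[R]_n) (P : 'rV[R]_m * 'rV[R]_n -> Prop) :
  (\forall q \near (x, y), P q) -> \forall w \near row_mx x y, P (lsubmx w, rsubmx w).
Proof.
move=> H.
have cl : {for row_mx x y, continuous (lsubmx : 'rV[R]_(m + n) -> _)}.
  exact: Cn_continuous (Cn_lsubmx (Cn_id 0 _)).
have cr : {for row_mx x y, continuous (rsubmx : 'rV[R]_(m + n) -> _)}.
  exact: Cn_continuous (Cn_rsubmx (Cn_id 0 _)).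
rewrite /prop_for /continuous_at row_mxKl in cl.
rewrite /prop_for /continuous_at row_mxKr in cr.
exact: (cvg_pair cl cr H).
Qed.

Lemma smooth_of_row m n k (f : 'rV[R]_m * 'rV[R]_n -> 'rV[R]_k) (x : 'rV[R]_m) (y : 'rV[R]_n) :
  smooth (fun w => f (lsubmx w, rsubmx w)) (row_mx x y) -> smooth f (x, y).
Proof.
move=> sf j.
have : Cn j (fun q : 'rV[R]_m * 'rV[R]_n =>
    f (lsubmx (row_mx q.1 q.2), rsubmx (row_mx q.1 q.2))) (x, y).
  apply: (@Cn_comp _ _ _ _ _ (fun q : 'rV[R]_m * 'rV[R]_n => row_mx q.1 q.2)
    (fun w => f (lsubmx w, rsubmx w))); last exact: sf.
  by apply: Cn_row_mx; [exact: Cn_fst | exact: Cn_snd].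
by apply: Cn_ext => -[a b] /=; rewrite row_mxKl row_mxKr.
Qed.

Lemma smooth_lie_op_e (z : 'rV[R]_r) : (c @` D) z -> smooth lie_op (e, z).
Proof.
move=> Oz; have [Dz zK] := chart1_invK Oz.
apply: smooth_of_row; apply: smooth_on_nbhs (@lie_mul_smooth R r G 1%g 1%g 1%g) _.
apply: (@near_sub_row _ _ e z (fun q => [/\ (c @` D) q.1, (c @` D) q.2 & D (ci q.1 * ci q.2)%g])).
have h1 : \forall q \near (e, z), (c @` D) q.1.
  exact: (@cvg_fst _ _ (nbhs e) (nbhs z) _ _ near_chart_cod).
have nz : \forall x \near z, (c @` D) x.
  by apply: open_nbhs_nbhs; split=> //; exact: chart_cod_open.
have h2 : \forall q \near (e, z), (c @` D) q.2.
  exact: (@cvg_snd _ _ (nbhs e) (nbhs z) _ _ nz).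
have c1 : ci q.1 @[q --> (e, z)] --> (1%g : G).
  exact: cvg_comp (@cvg_fst _ _ (nbhs e) (nbhs z) _) chart_inv_cvg.
have c2 : ci q.2 @[q --> (e, z)] --> ci z.
  exact: cvg_comp (@cvg_snd _ _ (nbhs e) (nbhs z) _) (chart_inv_continuous Oz).
have c3 : (ci q.1 * ci q.2)%g @[q --> (e, z)] --> ci z.
  by rewrite -[ci z in X in _ --> X]mul1g; exact: mulg_cvg c1 c2.
have nD : \forall g \near ci z, D g.
  by apply: open_nbhs_nbhs; split=> //; exact: chart_dom_open.
have h3 : \forall q \near (e, z), D (ci q.1 * ci q.2)%g by exact: c3 nD.
by apply: filter_app h1; apply: filter_app h2; apply: filterS h3.
Qed.

Lemma smooth_lie_op : smooth lie_op (e, e).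
Proof. exact: smooth_lie_op_e (nbhs_singleton near_chart_cod). Qed.

Lemma smooth_lie_neg : smooth lie_neg e.
Proof.
apply: smooth_on_nbhs (@lie_inv_smooth R r G 1%g 1%g) _.
have h : (ci x)^-1%g @[x --> e] --> (1%g : G).
  by rewrite -[1%g in X in _ --> X]invg1; exact: invg_cvg chart_inv_cvg.
by apply: filterS2 near_chart_cod (h _ near_chart_dom).
Qed.

Lemma lie_neg_e : lie_neg e = e.
Proof. by rewrite /lie_neg chart1_inv1 invg1. Qed.

Lemma near_lie_negK : \forall x \near e, ci (lie_neg x) = (ci x)^-1%g.
Proof.
have h : (ci x)^-1%g @[x --> e] --> (1%g : G).
  by rewrite -[1%g in X in _ --> X]invg1; exact: invg_cvg chart_inv_cvg.
have h' : \forall x \near e, D ((ci x)^-1)%g by exact: h near_chart_dom.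
by apply: filterS h' => x Dx; exact: chart_mapK.
Qed.

Lemma near_lie_conj : \forall q \near (e, e), lie_op (lie_op q, lie_neg q.1) = lie_conj q.
Proof.
have h : \forall q \near (e, e), ci (lie_neg q.1) = (ci q.1)^-1%g.
  exact: (@cvg_fst _ _ (nbhs e) (nbhs e) _ _ near_lie_negK).
by apply: filterS2 near_lie_opK h => q h1 h2; rewrite {1}/lie_op /= h1 h2.
Qed.

Lemma smooth_lie_conj : smooth lie_conj (e, e).
Proof.
apply: smooth_near_eq near_lie_conj _.
apply: (@smooth_comp _ _ _ _ (fun q => (lie_op q, lie_neg q.1)) lie_op); last first.
  by rewrite lie_op_e lie_neg_e; exact: smooth_lie_op.
apply: smooth_pair; first exact: smooth_lie_op.
apply: (@smooth_comp _ _ _ _ fst lie_neg); last exact: smooth_lie_neg.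
by move=> k; exact: Cn_fst.
Qed.

Lemma near_lie_conjK : \forall q \near (e, e),
  ci (lie_conj q) = (ci q.1 * ci q.2 * (ci q.1)^-1)%g.
Proof.
have h : (ci q.1 * ci q.2 * (ci q.1)^-1)%g @[q --> (e, e)] --> (1%g : G).
  rewrite -[1%g in X in _ --> X](mulgV 1%g).
  by apply: mulg_cvg mul_cvg1 _; exact: invg_cvg chart_inv_fst_cvg.
have h' : \forall q \near (e, e), D (ci q.1 * ci q.2 * (ci q.1)^-1)%g.
  exact: h near_chart_dom.
by apply: filterS h' => q Dq; exact: chart_mapK.
Qed.

Lemma lie_conj_bracket (v w : 'rV[R]_r) :
  'D_(v, 0) (fun q => 'D_(0, w) lie_conj q) (e, e) =
  mixed_derivative lie_op e v w - mixed_derivative lie_op e w v.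
Proof.
apply: (conjugation_bracket v w smooth_lie_op smooth_lie_conj near_lie_ope near_lie_eop).
- by apply: filterS near_chart_invK => x _; rewrite /lie_conj /= chart1_inv1 mulg1 mulgV.
- apply: filterS near_chart_invK => x [_].
  by rewrite /lie_conj /= chart1_inv1 mul1g invg1 mulg1.
- apply: filterS near_lie_conjK => q h.
  by rewrite /lie_op /= h -mulgA mulVg mulg1.
Qed.

Lemma near_lie_opA : \forall q \near ((e, e), e),
  lie_op (lie_op q.1, q.2) = lie_op (q.1.1, lie_op (q.1.2, q.2)).
Proof.
have h1 : \forall q \near ((e, e), e), ci (lie_op q.1) = (ci q.1.1 * ci q.1.2)%g.
  exact: (@cvg_fst _ _ (nbhs (e, e)) (nbhs e) _ _ near_lie_opK).
have c2 : {for ((e, e), e), continuous (fun q : 'rV[R]_r * 'rV[R]_r * 'rV[R]_r => (q.1.2, q.2))}.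
  apply: (@Cn_continuous _ 0); apply: Cn_pair; last exact: Cn_snd.
  by apply: (@Cn_comp _ _ _ _ _ fst snd); [exact: Cn_fst | exact: Cn_snd].
have h2 : \forall q \near ((e, e), e), ci (lie_op (q.1.2, q.2)) = (ci q.1.2 * ci q.2)%g.
  exact: c2 near_lie_opK.
by apply: filterS2 h1 h2 => q h1 h2; rewrite /lie_op /= h1 h2 mulgA.
Qed.

Definition left_invariant_field (v : 'rV[R]_r) (x : 'rV[R]_r) : 'rV[R]_r :=
  'D_(0, v) lie_op (x, e).

Lemma smooth_left_invariant_field (v : 'rV[R]_r) : smooth (left_invariant_field v) e.
Proof. exact: (smooth_fst_arg (smooth_derive (0, v) smooth_lie_op)). Qed.

Lemma left_invariant_field_e (v : 'rV[R]_r) : left_invariant_field v e = v.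
Proof.
rewrite /left_invariant_field -(derive_snd v (smooth_diff smooth_lie_op)).
exact: derive_near_id near_lie_eop.
Qed.

(* Differentiate m (m (x, y), k) = m (x, m (y, k)) in k. *)
Lemma near_left_invariant_field (v : 'rV[R]_r) : \forall q \near (e, e),
  left_invariant_field v (lie_op q) = 'D_(0, left_invariant_field v q.2) lie_op q.
Proof.
have N0 : \forall x \near e, differentiable lie_op (x, e).
  exact: near_fst_arg (smooth_near_diff smooth_lie_op).
have N1 : \forall q \near (e, e), differentiable lie_op (q.2, e).
  exact: (@cvg_snd _ _ (nbhs e) (nbhs e) _ _ N0).
have N2 : \forall q \near (e, e), differentiable lie_op (lie_op q, e) by exact: lie_op_cvg N0.
have N3 := @near_prod_nest2 _ _ _ (e, e) e (fun q k =>
  lie_op (lie_op q, k) = lie_op (q.1, lie_op (q.2, k))) near_lie_opA.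
have N4 : \forall q \near (e, e), lie_op (q.2, e) = q.2.
  exact: (@cvg_snd _ _ (nbhs e) (nbhs e) _ _ near_lie_ope).
have N5 := smooth_near_diff smooth_lie_op.
apply: filter_app N1; apply: filter_app N2; apply: filter_app N3; apply: filter_app N4.
apply: filterS N5 => -[x y] /= d3 ye E d2 d1.
have dcx (a : 'rV[R]_r) : differentiable (fun _ : 'rV[R]_r => a) e by exact: differentiable_cst.
have did : differentiable (fun k : 'rV[R]_r => k) e by exact: smooth_diff (fun k => Cn_id k e).
have dyk : differentiable (fun k => lie_op (y, k)) e.
  exact: (@differentiable_comp _ _ _ _ (fun k => (y, k)) lie_op e (differentiable_pair (dcx y) did) d1).
have dp := differentiable_pair (dcx x) dyk.
have d3' : differentiable lie_op (x, lie_op (y, e)) by rewrite ye.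
have := near_eq_derive v E.
rewrite (@derive_snd _ _ _ _ lie_op (lie_op (x, y)) e v d2).
rewrite (@derive_comp _ _ _ _ (fun k => (x, lie_op (y, k))) lie_op e v dp d3').
by rewrite (derive_pair v (dcx x) dyk) derive_cst (derive_snd v d1) ye.
Qed.

Lemma is_derive_comp_curve (V W : normedModType R) (u : R -> V) (g : V -> W) (t : R) (du : V) :
  is_derive t 1 u du -> differentiable g (u t) ->
  is_derive t 1 (fun s : R => g (u s)) ('D_du g (u t)).
Proof.
move=> Hu dg; have /derivable1_diffP Du := @ex_derive _ _ _ _ _ _ _ Hu.
have dc : differentiable (fun s => g (u s)) t by exact: (differentiable_comp Du dg).
apply: DeriveDef; first exact: diff_derivable.
by rewrite (derive_comp _ Du dg) (@derive_val _ _ _ _ _ _ _ Hu).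
Qed.

Lemma is_derive_pair (V W : normedModType R) (u : R -> V) (w : R -> W) (t : R) (du : V) (dw : W) :
  is_derive t 1 u du -> is_derive t 1 w dw -> is_derive t 1 (fun s : R => (u s, w s)) (du, dw).
Proof.
move=> Hu Hw; have /derivable1_diffP Du := @ex_derive _ _ _ _ _ _ _ Hu.
have /derivable1_diffP Dw := @ex_derive _ _ _ _ _ _ _ Hw.
apply: DeriveDef; first exact: (diff_derivable (differentiable_pair Du Dw)).
by rewrite (derive_pair _ Du Dw) (@derive_val _ _ _ _ _ _ _ Hu) (@derive_val _ _ _ _ _ _ _ Hw).
Qed.
Lemma is_derive_shift (V : normedModType R) (g : R -> V) (s t : R) (dg : V) :
  is_derive (s + t) 1 g dg -> is_derive t 1 (fun x : R => g (s + x)) dg.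
Proof.
move=> H; have H2 : is_derive (t : R) (1 : R) (fun x : R => s + x) (1 : R).
  by rewrite -[X in is_derive _ _ _ X]add0r; exact: is_deriveD (is_derive_cst _ _ _) (is_derive_id _ _).
by have := is_derive1_comp H2 H; rewrite scale1r.
Qed.

(* Differentiate gamma (s + t) = gamma s * gamma t in t at t = 0. *)
Lemma one_param_subgroup_ode (v : 'rV[R]_r) (gamma : R -> G) :
  one_param_subgroup v gamma ->
  \forall s \near (0 : R), is_derive (s : R) (1 : R) (fun t : R => c (gamma t)) (left_invariant_field v (c (gamma s))).
Proof.
move=> [cg hg dg].
have g0 : gamma 0 = 1%g.
  by have := hg 0 0; rewrite addr0 -{1}[gamma 0]mulg1 => /mulgI.
have gD : gamma t @[t --> (0 : R)] --> (1%g : G) by rewrite -g0; exact: cg.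
have N0 : \forall x \near e, differentiable lie_op (x, e).
  exact: near_fst_arg (smooth_near_diff smooth_lie_op).
have N1 : \forall s \near (0 : R), differentiable lie_op (c (gamma s), e).
  have cgD : c (gamma t) @[t --> (0 : R)] --> e by exact: cvg_comp gD chart_cvg.
  exact: cgD N0.
have N2 : \forall s \near (0 : R), D (gamma s) by exact: gD near_chart_dom.
have N2' := N2; apply: filterS2 N1 N2 => s ds Ds.
have dp : is_derive (0 : R) (1 : R) (fun t : R => (c (gamma s), c (gamma t))) (0, v).
  exact: is_derive_pair (is_derive_cst _ _ _) dg.
have ds' : differentiable lie_op (c (gamma s), c (gamma 0)) by rewrite g0.
have H := is_derive_comp_curve dp ds'.
have H1 : is_derive (0 : R) (1 : R) (fun t : R => c (gamma (s + t))) (left_invariant_field v (c (gamma s))).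
  rewrite /left_invariant_field -g0.
  apply: near_eq_is_derive H.
  apply: filterS N2' => t Dt.
  by rewrite /lie_op /= !chart_mapK // hg.
apply: is_derive_ext (fun t => _) (@is_derive_shift _ (fun t : R => c (gamma (s + t))) (- s) s _ _).
  by move=> t; rewrite addrA subrr add0r.
by rewrite addNr.
Qed.

End LieChart.

(** * One-parameter subgroups *)

Section OneParameterSubgroups.
Context {R : realType}.

(** * Homomorphisms from the real line to a group *)

Section Homomorphisms.
Context {G : groupType}.

Lemma local_hom0 (eta : R -> G) (b : R) : 0 < b ->
  (forall s t : R, `|s| < b -> `|t| < b -> eta (s + t) = (eta s * eta t)%g) -> eta 0 = 1%g.
Proof.
move=> b0 H; have h0 : `|0 : R| < b by rewrite normr0.
by have := H 0 0 h0 h0; rewrite addr0 -{1}[eta 0]mulg1 => /mulgI.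
Qed.

Lemma local_hom_expgn (eta : R -> G) (b : R) (n : nat) (s : R) : 0 < b ->
  (forall s t : R, `|s| < b -> `|t| < b -> eta (s + t) = (eta s * eta t)%g) ->
  n%:R * `|s| < b -> eta (n%:R * s) = (eta s ^+ n)%g.
Proof.
move=> b0 H; elim: n => [|n IH] nb; first by rewrite mul0r expg0 (local_hom0 b0 H).
have n0 : 0 <= (n%:R : R) by exact: ler0n.
have s0 := normr_ge0 s.
have nn : n%:R * `|s| < b by move: nb; rewrite -natr1; nra.
have ss : `|s| < b by move: nb; rewrite -natr1; nra.
rewrite -natr1 mulrDl mul1r H ?IH ?expgSr //.
by rewrite normrM normr_nat.
Qed.

(* gamma t = eta (t / N) ^+ N for every large N. *)
Lemma local_hom_extend (eta : R -> G) (b : R) : 0 < b ->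
  (forall s t : R, `|s| < b -> `|t| < b -> eta (s + t) = (eta s * eta t)%g) ->
  exists2 gamma : R -> G, (forall s t, gamma (s + t) = (gamma s * gamma t)%g) &
    forall s : R, `|s| < b -> gamma s = eta s.
Proof.
move=> b0 H.
(* Refining the subdivision of t does not change the value, so any two subdivisions are compared
   through a common refinement. *)
have scale (n m : nat) (t : R) : `|t| < n.+1%:R * b ->
    eta (t / n.+1%:R) = (eta (t / (m.+1 * n.+1)%:R)%R ^+ m.+1)%g.
  move=> tb; have n0 : 0 < n.+1%:R :> R by rewrite ltr0n.
  have m0 : 0 < m.+1%:R :> R by rewrite ltr0n.
  have E : m.+1%:R * (t / (m.+1 * n.+1)%:R) = t / n.+1%:R.
    by rewrite natrM; field; rewrite !gt_eqF.
  rewrite -(local_hom_expgn b0 H) ?E //.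
  rewrite -[m.+1%:R]ger0_norm ?ltW // -normrM E normrM normfV (gtr0_norm n0).
  by rewrite ltr_pdivrMr // mulrC.
pose N (t : R) := Num.truncn (`|t| / b).
have HN (t : R) : `|t| < (N t).+1%:R * b by rewrite -ltr_pdivrMr // truncnS_gt.
pose gamma (t : R) := (eta (t / (N t).+1%:R)%R ^+ (N t).+1)%g.
have gammaE (n : nat) (t : R) : `|t| < n.+1%:R * b -> gamma t = (eta (t / n.+1%:R)%R ^+ n.+1)%g.
  move=> tb; rewrite /gamma (scale _ n _ (HN t)) (scale n (N t) _ tb).
  by rewrite -!expgnA (mulnC n.+1 (N t).+1).
exists gamma => [s t|s sb]; last by rewrite (gammaE 0%N) ?mul1r // divr1 expg1.
(* Then n + 2 is the sum of the subdivision numbers of s and t, enough for s, t and s + t at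
   once. *)
pose n := (N s + N t)%N.
have bound (x : R) : `|x| <= `|s| + `|t| -> `|x| < n.+2%:R * b.
  move=> xst; apply: le_lt_trans xst _; apply: lt_le_trans (ltrD (HN s) (HN t)) _.
  by rewrite -mulrDl ler_pM2r // -natrD ler_nat /n addSn addnS leqnn.
have s0 := normr_ge0 s; have t0 := normr_ge0 t.
have bs : `|s| < n.+2%:R * b by apply: bound; rewrite lerDl.
have bt : `|t| < n.+2%:R * b by apply: bound; rewrite lerDr.
have bst : `|s + t| < n.+2%:R * b by apply: bound; exact: ler_normD.
have small (x : R) : `|x| < n.+2%:R * b -> `|x / n.+2%:R| < b.
  by rewrite normrM normfV normr_nat ltr_pdivrMr ?ltr0n // mulrC.
rewrite (gammaE _ _ bs) (gammaE _ _ bt) (gammaE _ _ bst) mulrDl -expgMn.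
  by rewrite H //; exact: small.
(* The power of a product splits because the two factors commute, as addition of small times
   does. *)
by rewrite /commute -!H ?(addrC (s / _)) //; exact: small.
Qed.

Lemma hom_eq_near (gamma eta : R -> G) :
  (forall s t, gamma (s + t) = (gamma s * gamma t)%g) ->
  (forall s t, eta (s + t) = (eta s * eta t)%g) ->
  (\forall t \near (0 : R), gamma t = eta t) -> gamma =1 eta.
Proof.
move=> Hg He /nbhs_ballP [b /= b0 gb] t.
pose n := Num.truncn (`|t| / b); have Hn : `|t| < n.+1%:R * b by rewrite -ltr_pdivrMr // truncnS_gt.
have -> : t = n.+1%:R * (t / n.+1%:R) by field; rewrite gt_eqF // -natr1 ltr_wpDl.
have pos : 0 < n.+1%:R * `|t / n.+1%:R| + 1 by rewrite ltr_wpDl // mulr_ge0.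
rewrite (@local_hom_expgn gamma (n.+1%:R * `|t / n.+1%:R| + 1)) ?ltrDl //.
rewrite (@local_hom_expgn eta (n.+1%:R * `|t / n.+1%:R| + 1)) ?ltrDl //.
rewrite gb //; apply: norm_ball; rewrite sub0r normrN normrM normfV normr_nat.
by rewrite ltr_pdivrMr ?ltr0n // mulrC.
Qed.

End Homomorphisms.

Context {r : nat} {G : lieGroupType R r}.

#[local] Notation c := (chart_map (chart1 G)).
#[local] Notation ci := (chart_inv (chart1 G)).
#[local] Notation D := (chart_dom (chart1 G)).
#[local] Notation e := (chart1 G 1%g).

Lemma one_param_subgroup0 (v : 'rV[R]_r) (gamma : R -> G) :
  one_param_subgroup v gamma -> gamma 0 = 1%g.
Proof. by move=> [_ hg _]; exact: (@local_hom0 _ gamma 1). Qed.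

Lemma near_one_param_subgroup (v : 'rV[R]_r) (gamma : R -> G) (P : G -> Prop) :
  one_param_subgroup v gamma -> (\forall g \near (1%g : G), P g) ->
  \forall t \near (0 : R), P (gamma t).
Proof. by move=> H; rewrite -(one_param_subgroup0 H); case: H => cg _ _; exact: cg. Qed.

(** Both curves solve, in the chart, the equation of the same left-invariant field with the same
    initial point; they agree near 0, and homomorphisms that agree near 0 are equal. *)
Lemma one_param_subgroup_unique (v : 'rV[R]_r) (gamma eta : R -> G) :
  one_param_subgroup v gamma -> one_param_subgroup v eta -> gamma = eta.
Proof.
move=> Hg He; apply/funext; case: (Hg) (He) => _ hg _ [_ he _]; apply: hom_eq_near => //.
have [K K0 [rr r0 E]] := local_estimates_exist (smooth_left_invariant_field v (G := G)).
have chart_ball : \forall g \near (1%g : G), ball e rr (c g).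
  have h : \forall x \near e, ball e rr x by exact: nbhsx_ballx.
  exact: chart_cvg h.
have D1 : \forall g \near (1%g : G), D g by exact: near_chart_dom.
have near_ode (alpha : R -> G) : one_param_subgroup v alpha ->
    \forall t \near (0 : R), (is_derive (t : R) (1 : R) (fun t : R => c (alpha t))
      (left_invariant_field v (c (alpha t)) (G := G)) /\ ball e rr (c (alpha t))) /\ ci (c (alpha t)) = alpha t.
  move=> Ha; have h1 := one_param_subgroup_ode Ha.
  have h2 := near_one_param_subgroup Ha chart_ball.
  have h3 := near_one_param_subgroup Ha D1.
  apply: filter_app h1; apply: filterS2 h2 h3 => t h2 h3 h1.
  by split; [split | exact: chart_mapK].
have [a1 /= a10 H1] := (iffLR (nbhs_ballP _ _) (near_ode _ Hg)).
have [a2 /= a20 H2] := (iffLR (nbhs_ballP _ _) (near_ode _ He)).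
pose a := Num.min (Num.min a1 a2) (1 / 2 / K).
have a0 : 0 < a by rewrite !lt_min a10 a20 !divr_gt0.
have aK : a * K <= 1 / 2 by rewrite -ler_pdivlMr // /a ge_min lexx orbT.
have aball (t : R) : `|t| < a -> ball (0 : R) a1 t /\ ball (0 : R) a2 t.
  by rewrite !lt_min => /andP[/andP[h1 h2] _]; split; apply: norm_ball; rewrite sub0r normrN.
have U := @flow_unique R r (left_invariant_field v (G := G)) (ball e rr)
  (fun t => c (gamma t)) (fun t => c (eta t)) a K (ltW K0) aK.
apply/nbhs_ballP; exists a => //= t /ball_norm_lt; rewrite sub0r normrN => ta.
have [b1 b2] := aball t ta.
rewrite -(H1 t b1).2 -(H2 t b2).2; congr (ci _); apply: U ta.
- by move=> x z Hx Hz; have [_ _ h _] := E x Hx; exact: h.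
- by move=> s sa; have [h _] := aball s sa; exact: (H1 s h).1.
- by move=> s sa; have [_ h] := aball s sa; exact: (H2 s h).1.
- by rewrite (one_param_subgroup0 Hg) (one_param_subgroup0 He).
Qed.

(** Let xi be the integral curve of the left-invariant field through e. By left invariance both xi
    (s + t) and the product of xi s and xi t solve the same equation in t, so xi is a local
    homomorphism, which extends to the whole line. *)
Lemma one_param_subgroup_exists (v : 'rV[R]_r) : exists gamma : R -> G, one_param_subgroup v gamma.
Proof.
pose f := left_invariant_field v (G := G).
have [K [rr [a [d [phi [[[K0 r0 a0 d0] [E aK F]] _ _ _]]]]]] :=
  @local_flow_Cn R 0 r f e 1 1 (smooth_left_invariant_field v) ltr01 ltr01.
pose xi (t : R) := phi t e.
have [xi0 Hxi] : xi 0 = e /\ forall t : R, `|t| < a ->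
    is_derive (t : R) (1 : R) xi (f (xi t)) /\ ball e rr (xi t).
  exact: (F e (ballxx _ d0)).
have cxi : xi t @[t --> (0 : R)] --> e.
  rewrite -xi0; apply: is_derive_continuous (Hxi 0 _).1.
  by rewrite normr0.
have : \forall q \near (e, e), [/\ ball e rr (lie_op (G := G) q),
    f (lie_op (G := G) q) = 'D_(0, f q.2) (lie_op (G := G)) q,
    differentiable (lie_op (G := G)) q, ci (lie_op (G := G) q) = (ci q.1 * ci q.2)%g &
    lie_op (G := G) (q.1, e) = q.1].
  have h1 : \forall q \near (e, e), ball e rr (lie_op (G := G) q).
    by apply: lie_op_cvg; exact: nbhsx_ballx.
  have h2 := near_left_invariant_field v (G := G).
  have h3 := smooth_near_diff (smooth_lie_op (G := G)).
  have h4 := near_lie_opK (G := G).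
  have h5 : \forall q \near (e, e), lie_op (G := G) (q.1, e) = q.1.
    exact: (@cvg_fst _ _ (nbhs e) (nbhs e) _ _ near_lie_ope).
  apply: filter_app h1; apply: filter_app h2; apply: filter_app h3; apply: filterS2 h4 h5.
  by move=> q h4 h5 h3 h2 h1; split.
move=> [[A B] /= [HA HB] AB].
have : \forall t \near (0 : R), A (xi t) /\ B (xi t) 
  by have h : \forall x \near e, A x /\ B x by [exact: filterI]; exact: cxi h.
move=> /nbhs_ballP [b1 /= b10 Hb1].
(* With b <= a / 2 the sum of two times below b stays in the interval of existence. *)
pose b := Num.min b1 (a / 2).
have b0 : 0 < b by rewrite lt_min b10 divr_gt0.
have ba : b <= a / 2 by rewrite /b ge_min lexx orbT.
have loc (s t : R) : `|s| < b -> `|t| < b -> (A `*` B) (xi s, xi t).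
  rewrite !lt_min => /andP[sb _] /andP[tb _]; split=> /=.
    by apply: (Hb1 s _).1; apply: norm_ball; rewrite sub0r normrN.
  by apply: (Hb1 t _).2; apply: norm_ball; rewrite sub0r normrN.
have xiD (s t : R) : `|s| < b -> `|t| < b -> xi (s + t) = lie_op (G := G) (xi s, xi t).
  move=> sb tb.
  apply: (@flow_unique R r f (ball e rr) (fun t => xi (s + t))
     (fun t => lie_op (G := G) (xi s, xi t)) b K (ltW K0) _ _ _ _ _ t tb).
  - have : b * K <= a / 2 * K by rewrite ler_pM2r.
    have h : 0 < a * K by exact: mulr_gt0.
    by move: aK h; lra.
  - by move=> x z Hx Hz; have [_ _ h _] := E x Hx; exact: h.
  - move=> x xb; have sxa : `|s + x| < a.
      by apply: le_lt_trans (ler_normD _ _) _; move: sb xb ba; lra.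
    have [h1 h2] := Hxi (s + x) sxa.
    by split=> //; exact: is_derive_shift.
  - move=> x xb; have [/= h1 h2 h3 _ _] := AB _ (loc s x sb xb); split; last exact: h1.
    have xa : `|x| < a by move: xb ba a0; lra.
    rewrite h2; exact: is_derive_comp_curve (is_derive_pair (is_derive_cst (xi s) _ _) (Hxi x xa).1) h3.
  - have zb : `|0 : R| < b by rewrite normr0.
    have [/= _ _ _ _ h] := AB _ (loc s 0 sb zb).
    by rewrite addr0 xi0 h.
have [|gamma hg gE] := @local_hom_extend G (fun t => ci (xi t)) b b0.
  move=> s t sb tb; rewrite xiD //.
  by have [/= _ _ _ h _] := AB _ (loc s t sb tb).
have near_b : \forall t \near (0 : R), `|t| < b by apply: near_norm_lt; rewrite normr0.
have cg0 : gamma t @[t --> (0 : R)] --> (1%g : G).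
  have h : ci (xi t) @[t --> (0 : R)] --> (1%g : G) by exact: cvg_comp cxi chart_inv_cvg.
  apply: cvg_trans h; apply: near_eq_cvg; apply: filterS near_b => t tb; exact: esym (gE t tb).
exists gamma; split=> //.
(* Left translation by [gamma t] carries continuity at 0 to continuity at t. *)
- move=> t; have -> : gamma = (fun s => gamma t * gamma (s - t))%g.
    by apply/funext => s; rewrite -hg addrCA subrr addr0.
  have h : (s - t) @[s --> t] --> (0 : R).
    by rewrite -[0](subrr t); apply: cvgB; [exact: cvg_id | exact: cvg_cst].
  rewrite /continuous_at subrr (_ : gamma 0 = 1%g); last by exact: (@local_hom0 _ gamma 1).
  by apply: mulg_cvg; [exact: cvg_cst | exact: cvg_comp h cg0].
- have h : is_derive (0 : R) (1 : R) xi v.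
    have za : `|0 : R| < a by rewrite normr0.
    by have := (Hxi 0 za).1; rewrite xi0 /f left_invariant_field_e.
  have h' : \forall x \near e, c (ci x) = x by apply: filterS near_chart_invK => x [].
  have h'' : \forall t \near (0 : R), c (ci (xi t)) = xi t by exact: cxi h'.
  by apply: near_eq_is_derive h; apply: filterS2 near_b h'' => t tb Et; rewrite gE // Et.
Qed.

(** Running gamma at speed t gives a one-parameter subgroup of velocity t v; by uniqueness it is the
    one that [xget] selects, and its value at time 1 is [gamma t]. *)
Lemma lie_exp_scale (v : 'rV[R]_r) : exists2 gamma : R -> G,
  one_param_subgroup v gamma & forall t : R, lie_exp G (t *: v) = gamma t.
Proof.
have [gamma Hg] := one_param_subgroup_exists v; exists gamma => // t.
have Ht : one_param_subgroup (t *: v) (fun s => gamma (t * s)).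
  have [cg hg dg] := Hg; split.
  - move=> s; apply: (@continuous_comp _ _ _ (fun s => t * s) gamma); last exact: cg.
    exact: mulrl_continuous.
  - by move=> s s'; rewrite mulrDr hg.
  - have d1 : is_derive (0 : R) (1 : R) (fun s : R => t * s) t.
      by have := is_deriveZ t (is_derive_id (0 : R) 1); rewrite /= [t *: 1]mulr1.
    have dg' : is_derive (t * 0) (1 : R) (fun s : R => c (gamma s)) v by rewrite mulr0.
    exact: is_derive1_comp d1 dg'.
rewrite /lie_exp (xget_unique _ Ht) ?mulr1 // => y Hy.
exact: one_param_subgroup_unique Hy Ht.
Qed.

End OneParameterSubgroups.

(** * The Lie bracket *)

Section LieAlgebraOfFields.
Context {R : realType} {r : nat} {G : lieGroupType R r}.

#[local] Notation c := (chart_map (chart1 G)).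
#[local] Notation ci := (chart_inv (chart1 G)).
#[local] Notation D := (chart_dom (chart1 G)).
#[local] Notation e := (chart1 G 1%g).
#[local] Notation m := (@lie_op R r G).

(** [lie_Ad] is the derivative of conjugation in its second argument at the unit, so the bracket is
    a mixed second derivative of [lie_conj], which [lie_conj_bracket] evaluates. *)
Lemma lie_bracketE (v w : 'rV[R]_r) :
  lie_bracket G v w = mixed_derivative m e v w - mixed_derivative m e w v.
Proof.
rewrite -lie_conj_bracket /lie_bracket.
have [gamma Hg Eg] := lie_exp_scale v (G := G).
rewrite (_ : (fun t => _) = fun t : R => lie_Ad (gamma t) w); last first.
  by apply/funext => t; rewrite Eg.
have [cg hg dg] := Hg; have g0 := one_param_subgroup0 Hg.
have N0 : \forall x \near e, differentiable (@lie_conj R r G) (x, e).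
  exact: near_fst_arg (smooth_near_diff (smooth_lie_conj (G := G))).
have N1 : \forall g \near (1%g : G), differentiable (@lie_conj R r G) (c g, e).
  exact: chart_cvg N0.
have N2 := near_one_param_subgroup Hg N1.
have N3 := near_one_param_subgroup Hg (near_chart_dom (G := G)).
have sw := smooth_derive (0, w) (smooth_lie_conj (G := G)).
have dsw : differentiable (fun q => 'D_(0, w) (@lie_conj R r G) q) (c (gamma 0), e).
  by rewrite g0; exact: smooth_diff sw.
have H := is_derive_comp_curve (is_derive_pair dg (is_derive_cst e _ _)) dsw.
rewrite g0 in H.
have H' : is_derive (0 : R) (1 : R) (fun t : R => lie_Ad (gamma t) w)
    ('D_(v, 0) (fun q => 'D_(0, w) (@lie_conj R r G) q) (e, e)).
  apply: near_eq_is_derive H; apply: filterS2 N2 N3 => t dt Dt.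
  by rewrite -(derive_snd w dt) /lie_Ad /lie_conj /= chart_mapK.
rewrite derive1E; exact: (@derive_val _ _ _ _ _ _ _ H').
Qed.

Lemma derive_snd_lin (U V W : normedModType R) (T : U * V -> W) (q : U * V) (a : R) (h k : V) :
  differentiable T q -> 'D_(0, a *: h + k) T q = a *: 'D_(0, h) T q + 'D_(0, k) T q.
Proof.
move=> dT; rewrite -(deriveZl _ _ dT) -(deriveDl _ _ dT); congr ('D_ _ _ _).
by congr (_, _); rewrite /= scaler0 addr0.
Qed.

Lemma mixed_derivative_linr (v : 'rV[R]_r) (a : R) (w w' : 'rV[R]_r) :
  mixed_derivative m e v (a *: w + w') = a *: mixed_derivative m e v w + mixed_derivative m e v w'.
Proof. exact: derive_snd_lin (smooth_diff (smooth_derive (v, 0) smooth_lie_op)). Qed.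

Lemma mixed_derivative_linl (v v' w : 'rV[R]_r) (a : R) :
  mixed_derivative m e (a *: v + v') w = a *: mixed_derivative m e v w + mixed_derivative m e v' w.
Proof.
have E x : mixed_derivative m e x w = 'D_(x, 0) (fun q => 'D_(0, w) m q) (e, e).
  exact: derive_sym smooth_lie_op.
rewrite !E; exact: derive_fst_lin (smooth_diff (smooth_derive (0, w) smooth_lie_op)).
Qed.

Lemma scaler_subr_add (Z : lmodType R) (a : R) (x x' y y' : Z) :
  a *: x + x' - (a *: y + y') = a *: (x - y) + (x' - y').
Proof. by rewrite scalerBr opprD addrACA. Qed.

Lemma opp_scalerN_add (Z : lmodType R) (a : R) (x y : Z) : - (a *: - x - y) = a *: x + y.
Proof. by rewrite scalerN opprD !opprK. Qed.

Lemma lie_bracket_antisym (v w : 'rV[R]_r) : lie_bracket G v w = - lie_bracket G w v.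
Proof. by rewrite !lie_bracketE opprB. Qed.

Lemma lie_bracket_linr (v : 'rV[R]_r) (a : R) (w w' : 'rV[R]_r) :
  lie_bracket G v (a *: w + w') = a *: lie_bracket G v w + lie_bracket G v w'.
Proof.
rewrite !lie_bracketE mixed_derivative_linr mixed_derivative_linl.
exact: scaler_subr_add.
Qed.

Lemma lie_bracket_linl (v v' w : 'rV[R]_r) (a : R) :
  lie_bracket G (a *: v + v') w = a *: lie_bracket G v w + lie_bracket G v' w.
Proof.
rewrite lie_bracket_antisym lie_bracket_linr (lie_bracket_antisym w v) (lie_bracket_antisym w v').
exact: opp_scalerN_add.
Qed.

Lemma field_bracket_near_eq n (X X' Y Y' : 'rV[R]_n -> 'rV[R]_n) (z : 'rV[R]_n) :
  (\forall y \near z, X y = X' y) -> (\forall y \near z, Y y = Y' y) ->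
  field_bracket X Y z = field_bracket X' Y' z.
Proof.
move=> EX EY; rewrite /field_bracket (nbhs_singleton EX) (nbhs_singleton EY).
by rewrite (near_eq_derive _ EX) (near_eq_derive _ EY).
Qed.

Lemma field_bracketNr n (X Y : 'rV[R]_n -> 'rV[R]_n) (z : 'rV[R]_n) :
  differentiable X z -> differentiable Y z ->
  field_bracket X (fun y => - Y y) z = - field_bracket X Y z.
Proof.
move=> dX dY; rewrite /field_bracket (deriveN (diff_derivable dY)).
rewrite (_ : 'D_(- Y z) X z = - 'D_(Y z) X z); last by rewrite !deriveE // linearN.
by rewrite opprB opprK addrC.
Qed.

Lemma field_bracket_antisym n (X Y : 'rV[R]_n -> 'rV[R]_n) (z : 'rV[R]_n) :
  field_bracket X Y z = - field_bracket Y X z.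
Proof. by rewrite /field_bracket opprB. Qed.

(** * Translation fields and the Jacobi identity of the Lie algebra *)

Section TranslationFields.

Let cO := c @` D.

Lemma near_lie_opA_e (z : 'rV[R]_r) : cO z ->
  \forall q \near (e, e), m (m q, z) = m (q.1, m (q.2, z)).
Proof.
move=> Oz; have [Dz zK] := chart1_invK Oz.
have c2 : ci q.2 @[q --> (e, e)] --> (1%g : G).
  exact: cvg_comp (@cvg_snd _ _ (nbhs e) (nbhs e) _) chart_inv_cvg.
have c3 : (ci q.2 * ci z)%g @[q --> (e, e)] --> ci z.
  by rewrite -[ci z in X in _ --> X]mul1g; apply: mulg_cvg c2 _; exact: cvg_cst.
have nD : \forall g \near ci z, D g.
  by apply: open_nbhs_nbhs; split=> //; exact: chart_dom_open.
have h : \forall q \near (e, e), D (ci q.2 * ci z)%g by exact: c3 nD.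
apply: filterS2 h (near_lie_opK (G := G)) => q h Eq.
have -> : m (m q, z) = c (ci q.1 * ci q.2 * ci z)%g by rewrite -Eq.
have -> : m (q.1, m (q.2, z)) = c (ci q.1 * ci (c (ci q.2 * ci z)))%g by [].
by rewrite chart_mapK // mulgA.
Qed.

(** The right-invariant fields in the chart: they are the generators of left multiplication, which
    is a left action of the group on itself. *)
Let T (v z : 'rV[R]_r) : 'rV[R]_r := 'D_(v, 0) m (e, z).

Lemma translation_field_bracket (v w z : 'rV[R]_r) : cO z ->
  field_bracket (T v) (T w) z = - T (lie_bracket G v w) z.
Proof.
move=> Oz; rewrite lie_bracketE; apply: infinitesimal_action_bracket.
- exact: smooth_lie_op.
- exact: smooth_lie_op_e.
- exact: near_lie_ope.
- exact: near_lie_eop.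
- have nz : \forall x \near z, (c @` D) x.
    by apply: open_nbhs_nbhs; split=> //; exact: chart_cod_open.
  apply: filterS nz => x /chart1_invK [_ xK].
  by rewrite /lie_op /= chart1_inv1 mul1g.
- exact: near_lie_opA_e.
Qed.

(** The fields [T v] reverse brackets, so a double bracket of fields is T of the double bracket, the
    two signs cancelling; as T v has value v at e, the Jacobi identity of vector fields at e is the
    one claimed. *)
Lemma lie_bracket_jacobi (u v w : 'rV[R]_r) :
  lie_bracket G u (lie_bracket G v w) + lie_bracket G v (lie_bracket G w u) +
  lie_bracket G w (lie_bracket G u v) = 0.
Proof.
have Oe : cO e by exact: nbhs_singleton near_chart_cod.
have sT x : smooth (T x) e.
  exact: (smooth_snd_arg (smooth_derive (x, 0) (smooth_lie_op (G := G)))).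
have E x y z : field_bracket (T x) (field_bracket (T y) (T z)) e = lie_bracket G x (lie_bracket G y z).
  rewrite (@field_bracket_near_eq _ _ (T x) _ (fun a => - T (lie_bracket G y z) a)); last 2 first.
  - by near=> a.
  - by apply: filterS (near_chart_cod (G := G)) => a /translation_field_bracket.
  rewrite (field_bracketNr (smooth_diff (sT _)) (smooth_diff (sT _))).
  rewrite translation_field_bracket // opprK /T.
  rewrite -(derive_fst _ (smooth_diff smooth_lie_op)).
  exact: derive_near_id near_lie_ope.
rewrite -!E; exact: field_bracket_jacobi.
Unshelve. all: by end_near. Qed.

End TranslationFields.

End LieAlgebraOfFields.

(** * Fundamental vector fields of an action *)

Section ActionFields.
Context {R : realType} {r p : nat} {G : lieGroupType R r} {M : set 'rV[R]_p}.
Context (M_open : open M).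
Context (A : local_action G M).

#[local] Notation c := (chart_map (chart1 G)).
#[local] Notation ci := (chart_inv (chart1 G)).
#[local] Notation D := (chart_dom (chart1 G)).
#[local] Notation e := (chart1 G 1%g).
#[local] Notation m := (@lie_op R r G).

Definition chart_action (q : 'rV[R]_r * 'rV[R]_p) : 'rV[R]_p := act A (ci q.1) q.2.

Lemma near_open (z : 'rV[R]_p) : M z -> \forall y \near z, M y.
Proof. by move=> Mz; apply: open_nbhs_nbhs; split. Qed.

Lemma chart_action_e (z : 'rV[R]_p) : M z -> chart_action (e, z) = z.
Proof. by move=> Mz; rewrite /chart_action /= chart1_inv1 act1. Qed.

Lemma near_act_dom (z : 'rV[R]_p) : M z -> \forall gz \near ((1%g : G), z), act_dom A gz.
Proof.
by move=> Mz; apply: open_nbhs_nbhs; split; [exact: act_dom_open | exact: act_dom1].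
Qed.

Lemma smooth_chart_action (z : 'rV[R]_p) : M z -> smooth chart_action (e, z).
Proof.
move=> Mz; apply: smooth_of_row; apply: smooth_on_nbhs (@act_smooth R r p G M A 1%g) _.
apply: (@near_sub_row _ _ _ e z (fun q => (c @` D) q.1 /\ act_dom A (ci q.1, q.2))).
have h1 : \forall q \near (e, z), (c @` D) q.1.
  exact: (@cvg_fst _ _ (nbhs e) (nbhs z) _ _ near_chart_cod).
have c1 : ci q.1 @[q --> (e, z)] --> (1%g : G).
  exact: cvg_comp (@cvg_fst _ _ (nbhs e) (nbhs z) _) chart_inv_cvg.
have c2 : q.2 @[q --> (e, z)] --> z by exact: (@cvg_snd _ _ (nbhs e) (nbhs z) _).
have h2 : \forall q \near (e, z), act_dom A (ci q.1, q.2).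
  exact: (cvg_pair c1 c2 (near_act_dom Mz)).
by apply: filterS2 h1 h2.
Qed.

(** The exponential curve enters only through its velocity v at 0, so the chain rule replaces it by
    a derivative of the action read in the chart. *)
Lemma inf_generatorE (v : 'rV[R]_r) (z : 'rV[R]_p) : M z ->
  inf_generator A v z = 'D_(v, 0) chart_action (e, z).
Proof.
move=> Mz; rewrite /inf_generator.
have [gamma Hg Eg] := lie_exp_scale v (G := G).
rewrite (_ : (fun t => _) = fun t : R => act A (gamma t) z); last first.
  by apply/funext => t; rewrite Eg.
have [cg hg dg] := Hg; have g0 := one_param_subgroup0 Hg.
have N3 := near_one_param_subgroup Hg (near_chart_dom (G := G)).
have dA : differentiable chart_action (c (gamma 0), z).
  by rewrite g0; exact: smooth_diff (smooth_chart_action Mz).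
have H := is_derive_comp_curve (is_derive_pair dg (is_derive_cst z _ _)) dA.
rewrite g0 in H.
have H' : is_derive (0 : R) (1 : R) (fun t : R => act A (gamma t) z)
    ('D_(v, 0) chart_action (e, z)).
  apply: near_eq_is_derive H; apply: filterS N3 => t Dt.
  by rewrite /chart_action /= chart_mapK.
rewrite derive1E; exact: (@derive_val _ _ _ _ _ _ _ H').
Qed.

(* The group law for which the action becomes a left action. *)
Definition action_op (q : 'rV[R]_r * 'rV[R]_r) : 'rV[R]_r :=
  match act_side A with LeftAction => m q | RightAction => m (q.2, q.1) end.

Lemma near_swap (a b : 'rV[R]_r) (P : 'rV[R]_r * 'rV[R]_r -> Prop) :
  (\forall q \near (a, b), P q) -> \forall q \near (b, a), P (q.2, q.1).
Proof.
move=> [[X Y] /= [HX HY] XY]; exists (Y, X) => //= -[x y] /= [Yx Xy].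
exact: XY.
Qed.

Lemma Cn_swap k (q : 'rV[R]_r * 'rV[R]_r) : Cn k (fun q : 'rV[R]_r * 'rV[R]_r => (q.2, q.1)) q.
Proof. by apply: Cn_pair; [exact: Cn_snd | exact: Cn_fst]. Qed.

Lemma smooth_action_op : smooth action_op (e, e).
Proof.
rewrite /action_op; case: (act_side A); first exact: smooth_lie_op.
move=> k; apply: (@Cn_comp _ _ _ _ _ (fun q : 'rV[R]_r * 'rV[R]_r => (q.2, q.1)) m).
  exact: Cn_swap.
exact: smooth_lie_op.
Qed.

Lemma near_action_opK : \forall q \near (e, e), ci (action_op q) =
  match act_side A with LeftAction => (ci q.1 * ci q.2)%g | RightAction => (ci q.2 * ci q.1)%g end.
Proof.
rewrite /action_op; case: (act_side A); first exact: near_lie_opK.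
exact: near_swap (near_lie_opK (G := G)).
Qed.

Lemma near_action_ope : \forall x \near e, action_op (x, e) = x.
Proof.
rewrite /action_op; case: (act_side A); [exact: near_lie_ope | exact: near_lie_eop].
Qed.

Lemma near_action_eop : \forall x \near e, action_op (e, x) = x.
Proof.
rewrite /action_op; case: (act_side A); [exact: near_lie_eop | exact: near_lie_ope].
Qed.

(** The domain is open and contains (1, z), so near (e, e) the three domain conditions of [actM]
    hold by continuity. *)
Lemma near_chart_actionM (z : 'rV[R]_p) : M z ->
  \forall q \near (e, e), chart_action (action_op q, z) = chart_action (q.1, chart_action (q.2, z)).
Proof.
move=> Mz; have h0 := near_action_opK.
have c1 : ci q.1 @[q --> (e, e)] --> (1%g : G) by exact: chart_inv_fst_cvg.
have c2 : ci q.2 @[q --> (e, e)] --> (1%g : G) by exact: chart_inv_snd_cvg.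
have ca : chart_action (q.2, z) @[q --> (e, e)] --> z.
  have cy : chart_action (y, z) @[y --> e] --> z.
    rewrite -{2}(chart_action_e Mz).
    exact: smooth_continuous (smooth_fst_arg (smooth_chart_action Mz)).
  exact: cvg_comp (@cvg_snd _ _ (nbhs e) (nbhs e) _) cy.
have cz : z @[q --> (e, e)] --> z by exact: cvg_cst.
have h1 : \forall q \near (e, e), act_dom A (ci q.2, z).
  exact: (cvg_pair c2 cz (near_act_dom Mz)).
have h2 : \forall q \near (e, e), act_dom A (ci q.1, chart_action (q.2, z)).
  exact: (cvg_pair c1 ca (near_act_dom Mz)).
have h3 : \forall q \near (e, e), act_dom A (match act_side A with
    LeftAction => (ci q.1 * ci q.2)%g | RightAction => (ci q.2 * ci q.1)%g end, z).
  have c3 : (match act_side A with LeftAction => (ci q.1 * ci q.2)%g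
      | RightAction => (ci q.2 * ci q.1)%g end) @[q --> (e, e)] --> (1%g : G).
    by case: (act_side A); rewrite -[1%g in X in _ --> X]mulg1; exact: mulg_cvg.
  exact: (cvg_pair c3 cz (near_act_dom Mz)).
apply: filter_app h0; apply: filter_app h1; apply: filterS2 h2 h3 => q h2 h3 h1 h0.
rewrite {1}/chart_action /= h0 {1}/chart_action /= /chart_action /=.
exact: esym (actM h1 h2 h3).
Qed.

Lemma mixed_derivative_swap (v w : 'rV[R]_r) :
  mixed_derivative (fun q => m (q.2, q.1)) e v w = mixed_derivative m e w v.
Proof.
have dsw x : differentiable (fun q : 'rV[R]_r * 'rV[R]_r => (q.2, q.1)) x.
  exact: smooth_diff (fun k => Cn_swap k x).
have Dsw x h : 'D_h (fun q : 'rV[R]_r * 'rV[R]_r => (q.2, q.1)) x = (h.2, h.1).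
  have d2 := smooth_diff (fun k => Cn_snd k x); have d1 := smooth_diff (fun k => Cn_fst k x).
  rewrite (derive_pair h d2 d1); case: x h d1 d2 => [a b] [h l] d1 d2 /=.
  rewrite (derive_pair_split h l d1) (derive_pair_split h l d2) /=.
  by rewrite !derive_cst !derive_id add0r addr0.
have N : \forall q \near (e, e), 'D_(v, 0) (fun q => m (q.2, q.1)) q = 'D_(0, v) m (q.2, q.1).
  apply: filterS (near_swap (smooth_near_diff (smooth_lie_op (G := G)))) => q dq.
  by rewrite (derive_comp (v, 0) (dsw q) dq) Dsw.
have sv := smooth_derive (0, v) (smooth_lie_op (G := G)).
apply: etrans (near_eq_derive (0, w) N) _.
apply: etrans (@derive_comp _ _ _ _ (fun q => (q.2, q.1)) (fun q => 'D_(0, v) m q) (e, e) (0, w)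
  (dsw (e, e)) (smooth_diff sv)) _.
rewrite Dsw; exact: (derive_sym (w, 0) (0, v) smooth_lie_op).
Qed.

Lemma mixed_action_op (v w : 'rV[R]_r) :
  mixed_derivative action_op e v w =
  match act_side A with LeftAction => mixed_derivative m e v w
                      | RightAction => mixed_derivative m e w v end.
Proof.
by rewrite /action_op; case: (act_side A); [exact: erefl | exact: mixed_derivative_swap].
Qed.

Lemma action_fieldE (v : 'rV[R]_r) (z : 'rV[R]_p) : M z ->
  action_field A v z = match act_side A with
    | LeftAction => 'D_(v, 0) chart_action (e, z)
    | RightAction => - 'D_(v, 0) chart_action (e, z) end.
Proof. by move=> Mz; rewrite /action_field inf_generatorE. Qed.

Lemma smooth_action_field (v : 'rV[R]_r) (z : 'rV[R]_p) : M z -> smooth (action_field A v) z.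
Proof.
move=> Mz.
have s : smooth (fun z => 'D_(v, 0) chart_action (e, z)) z.
  exact: (smooth_snd_arg (smooth_derive (v, 0) (smooth_chart_action Mz))).
apply: smooth_near_eq (fun y => match act_side A with
    | LeftAction => 'D_(v, 0) chart_action (e, y)
    | RightAction => - 'D_(v, 0) chart_action (e, y) end) _ _ _ _.
  by apply: filterS (near_open Mz) => y /action_fieldE ->.
by case: (act_side A) => // k; exact: Cn_N.
Qed.

Lemma action_field_lin (z : 'rV[R]_p) (a : R) (v w : 'rV[R]_r) : M z ->
  action_field A (a *: v + w) z = a *: action_field A v z + action_field A w z.
Proof.
move=> Mz; rewrite !action_fieldE // (derive_fst_lin _ _ _ (smooth_diff (smooth_chart_action Mz))).
by case: (act_side A) => //; rewrite opprD scalerN.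
Qed.

Lemma field_bracketNN n (X Y : 'rV[R]_n -> 'rV[R]_n) (z : 'rV[R]_n) :
  differentiable X z -> differentiable Y z ->
  field_bracket (fun y => - X y) (fun y => - Y y) z = field_bracket X Y z.
Proof.
move=> dX dY; have dX' : differentiable (fun y => - X y) z by exact: differentiableN.
by rewrite field_bracketNr // field_bracket_antisym opprK field_bracketNr // -field_bracket_antisym.
Qed.

(** For a right action the group law is the opposite one, its mixed derivatives are exchanged, and
    the fields Y v satisfy [Y v, Y w] = Y [v, w]. Passing to - Y leaves the left side unchanged and
    gives the same sign as for a left action. *)
Lemma action_field_bracket (v w : 'rV[R]_r) (z : 'rV[R]_p) : M z ->
  field_bracket (action_field A v) (action_field A w) z =
  - action_field A (lie_bracket G v w) z.
Proof.
move=> Mz; pose Y v z := 'D_(v, 0) chart_action (e, z).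
have sY x : differentiable (Y x) z.
  exact: smooth_diff (smooth_snd_arg (smooth_derive (x, 0) (smooth_chart_action Mz))).
have Ne : \forall z' \near z, chart_action (e, z') = z'.
  by apply: filterS (near_open Mz) => y; exact: chart_action_e.
have B := @infinitesimal_action_bracket R _ _ action_op chart_action e z v w
  smooth_action_op (smooth_chart_action Mz) near_action_ope near_action_eop
  Ne (near_chart_actionM Mz).
have dA := smooth_diff (smooth_chart_action Mz).
have E x : \forall y \near z, action_field A x y = match act_side A with
    | LeftAction => Y x y | RightAction => - Y x y end.
  by apply: filterS (near_open Mz) => y /action_fieldE ->.
rewrite (field_bracket_near_eq (E v) (E w)) (nbhs_singleton (E _)) lie_bracketE.
move: B; rewrite !mixed_action_op; case: (act_side A) => // B.
rewrite (field_bracketNN (sY v) (sY w)) opprK; apply: etrans B _.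
by rewrite (derive_fst_sub _ _ dA) opprB /Y (derive_fst_sub _ _ dA).
Qed.

End ActionFields.

(** * Poisson brackets given by a matrix *)

Section PoissonStructures.
Context {R : realType}.

Definition mxform n (Q : 'M[R]_n) (h k : 'rV[R]_n) : R := (h *m Q *m k^T) 0 0.

Lemma mxformE n (Q : 'M[R]_n) (h k : 'rV[R]_n) :
  mxform Q h k = \sum_i \sum_j h 0 i * Q i j * k 0 j.
Proof.
rewrite /mxform mxE exchange_big /=; apply: eq_bigr => j _.
by rewrite !mxE mulr_suml.
Qed.

Lemma mxformD n (Q Q' : 'M[R]_n) (h k : 'rV[R]_n) :
  mxform (Q + Q') h k = mxform Q h k + mxform Q' h k.
Proof. by rewrite /mxform mulmxDr mulmxDl mxE. Qed.

Lemma mxform_linl n (Q : 'M[R]_n) (a : R) (h h' k : 'rV[R]_n) :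
  mxform Q (a *: h + h') k = a * mxform Q h k + mxform Q h' k.
Proof. by rewrite /mxform !mulmxDl -!scalemxAl !mxE. Qed.

Lemma mxform_antisym n (Q : 'M[R]_n) (h k : 'rV[R]_n) :
  Q^T = - Q -> mxform Q h k = - mxform Q k h.
Proof.
move=> QT; rewrite /mxform.
have -> : h *m Q *m k^T = (k *m Q^T *m h^T)^T by rewrite !trmx_mul !trmxK mulmxA.
by rewrite QT mulmxN mulNmx !mxE.
Qed.

Lemma derive_mul (V : normedModType R) (a b : V -> R) (x u : V) :
  differentiable a x -> differentiable b x ->
  'D_u (fun y => a y * b y) x = a x * 'D_u b x + 'D_u a x * b x.
Proof.
move=> da db; apply: etrans (deriveM (diff_derivable da) (diff_derivable db)) _.
by rewrite [_ *: 'D_u a x]mulrC.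
Qed.

Lemma mul3_rule (a b c da db dc : R) :
  a * b * dc + (a * db + da * b) * c = da * b * c + a * db * c + a * b * dc.
Proof. by ring. Qed.

Lemma derive_mul3 (V : normedModType R) (a b c : V -> R) (x u : V) :
  smooth a x -> smooth b x -> smooth c x ->
  'D_u (fun y => a y * b y * c y) x =
  'D_u a x * b x * c x + a x * 'D_u b x * c x + a x * b x * 'D_u c x.
Proof.
move=> sa sb sc; have da := smooth_diff sa; have db := smooth_diff sb; have dc := smooth_diff sc.
have dab := smooth_diff (fun k => Cn_M (sa k) (sb k)).
rewrite (derive_mul u dab dc) (derive_mul u da db); exact: mul3_rule.
Qed.

Lemma derive_mxform n (V : normedModType R) (Q : V -> 'M[R]_n) (h k : V -> 'rV[R]_n) (x u : V) :
  smooth Q x -> smooth h x -> smooth k x ->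
  'D_u (fun y => mxform (Q y) (h y) (k y)) x =
  mxform (Q x) ('D_u h x) (k x) + mxform ('D_u Q x) (h x) (k x) + mxform (Q x) (h x) ('D_u k x).
Proof.
move=> sQ sh sk.
have shi i : smooth (fun y => h y 0 i) x by move=> l; exact: Cn_coord.
have ski i : smooth (fun y => k y 0 i) x by move=> l; exact: Cn_coord.
have sQij i j : smooth (fun y => Q y i j) x by move=> l; exact: Cn_coord.
have sij i j : smooth (fun y => h y 0 i * Q y i j * k y 0 j) x.
  by move=> l; apply: Cn_M; [apply: Cn_M; [exact: shi | exact: sQij] | exact: ski].
have si i : smooth (fun y => \sum_j h y 0 i * Q y i j * k y 0 j) x.
  by move=> l; apply: Cn_sum => j _; exact: sij.
under eq_fun do rewrite mxformE.
rewrite (derive_bigsum u (fun i => smooth_diff (si i))) !mxformE -!big_split.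
apply: eq_bigr => i _.
apply: etrans (derive_bigsum u (fun j => smooth_diff (sij i j))) _.
rewrite -!big_split; apply: eq_bigr => j _.
rewrite (derive_mul3 u (shi i) (sQij i j) (ski j)).
by rewrite (derive_coord u _ _ (smooth_diff sh)) (derive_coord u _ _ (smooth_diff sQ))
   (derive_coord u _ _ (smooth_diff sk)).
Qed.

Section Gradient.
Context {n : nat}.
Implicit Types F H K : 'rV[R]_n -> R.

Lemma smooth_gradient F (x : 'rV[R]_n) : smooth F x -> smooth (gradient F) x.
Proof.
move=> sF k; apply: Cn_mx => i j.
apply: (@Cn_ext _ _ _ _ (fun y => 'D_(delta_mx 0 j) F y)) => [y|]; first by rewrite mxE.
exact: smooth_derive.
Qed.

Lemma gradient_dot F (x u : 'rV[R]_n) : differentiable F x ->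
  (gradient F x *m u^T) 0 0 = 'D_u F x.
Proof.
move=> dF; rewrite (derive_sum_coord u dF) mxE; apply: eq_bigr => i _.
by rewrite !mxE mulrC.
Qed.

Lemma derive_gradient_dot F (x u w : 'rV[R]_n) : smooth F x ->
  ('D_u (gradient F) x *m w^T) 0 0 = 'D_u (fun y => 'D_w F y) x.
Proof.
move=> sF; rewrite (derive_sym_scalar u w sF).
rewrite (derive_sum_coord w (smooth_diff (smooth_derive u sF))) mxE; apply: eq_bigr => i _.
rewrite mxE mulrC -(derive_coord u 0 i (smooth_diff (smooth_gradient sF))).
rewrite (_ : (fun y => gradient F y 0 i) = fun y => 'D_(delta_mx 0 i) F y).
  by rewrite (derive_sym_scalar u _ sF).
by apply/funext => y; rewrite mxE.
Qed.

Lemma gradient_near_eq F F' (x : 'rV[R]_n) :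
  (\forall y \near x, F y = F' y) -> gradient F x = gradient F' x.
Proof. by move=> E; apply/rowP => i; rewrite !mxE (near_eq_derive _ E). Qed.

Lemma gradient_lin (a : R) F H (x : 'rV[R]_n) : differentiable F x -> differentiable H x ->
  gradient (fun y => a * F y + H y) x = a *: gradient F x + gradient H x.
Proof.
move=> dF dH; apply/rowP => i; rewrite !mxE.
have da : differentiable (fun y => a * F y) x by exact: differentiableZ.
rewrite (deriveD (diff_derivable da) (diff_derivable dH)).
by rewrite (deriveZ a (diff_derivable dF)).
Qed.

Lemma gradient_mul F H (x : 'rV[R]_n) : differentiable F x -> differentiable H x ->
  gradient (fun y => F y * H y) x = F x *: gradient H x + H x *: gradient F x.
Proof.
move=> dF dH; apply/rowP => i; rewrite !mxE (derive_mul _ dF dH).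
by rewrite [_ * H x]mulrC.
Qed.

Lemma gradient_linear (f x : 'rV[R]_n) : gradient (fun y => (f *m y^T) 0 0) x = f.
Proof.
apply/rowP => i; rewrite mxE.
have L : linear (fun y : 'rV[R]_n => (f *m y^T) 0 0).
  by move=> a y z; rewrite linearP /= mulmxDr -scalemxAr !mxE.
pose L' := HB.pack_for {linear 'rV[R]_n -> R} (fun y : 'rV[R]_n => (f *m y^T) 0 0)
  (GRing.isLinear.Build R 'rV[R]_n R _ _ L).
have s : smooth (L' : _ -> R) x by move=> k; exact: Cn_linmx.
rewrite (deriveE _ (smooth_diff s)) (diff_lin (f := L')); last first.
  by move=> y; exact: Cn_continuous (Cn_linmx 0 L' y).
rewrite /= mxE (bigD1 i) //= big1 ?addr0 ?mxE ?eqxx ?mulr1 // => j ji.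
by rewrite !mxE eqxx /= (negbTE ji) mulr0.
Qed.

End Gradient.

Lemma smooth_mxform n (V : normedModType R) (Q : V -> 'M[R]_n) (h k : V -> 'rV[R]_n) (x : V) :
  smooth Q x -> smooth h x -> smooth k x -> smooth (fun y => mxform (Q y) (h y) (k y)) x.
Proof.
move=> sQ sh sk l.
apply: (@Cn_ext _ _ _ _ (fun y => \sum_i \sum_j h y 0 i * Q y i j * k y 0 j)).
  by move=> y; rewrite mxformE.
apply: Cn_sum => i _; apply: Cn_sum => j _.
by apply: Cn_M; [apply: Cn_M | ]; exact: Cn_coord.
Qed.

(** * The Jacobi identity for an antisymmetric matrix of functions *)

Section PoissonForm.
Context {n : nat}.
Context (U : set 'rV[R]_n) (P : 'rV[R]_n -> 'M[R]_n).
Context (U_open : open U).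
Context (P_smooth : forall x, U x -> smooth P x).
Context (P_antisym : forall x, U x -> (P x)^T = - P x).
Implicit Types F H K : 'rV[R]_n -> R.

Definition poisson_form F H (x : 'rV[R]_n) : R := mxform (P x) (gradient F x) (gradient H x).

Definition second_derivative F (x u w : 'rV[R]_n) : R := 'D_u (fun y => 'D_w F y) x.

(** Up to a constant factor, the Schouten bracket of the bivector P with itself, evaluated on three
    covectors. *)
Definition jacobiator (x f h k : 'rV[R]_n) : R :=
  mxform ('D_(f *m P x) P x) h k + mxform ('D_(h *m P x) P x) k f +
  mxform ('D_(k *m P x) P x) f h.

Lemma smooth_poisson_form F H (x : 'rV[R]_n) : U x -> smooth F x -> smooth H x ->
  smooth (poisson_form F H) x.
Proof.
by move=> Ux sF sH; apply: smooth_mxform; [exact: P_smooth | |]; exact: smooth_gradient.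
Qed.

Lemma mxform_gradient_derivative_l H (x u k : 'rV[R]_n) : U x -> smooth H x ->
  mxform (P x) ('D_u (gradient H) x) k = - second_derivative H x u (k *m P x).
Proof.
move=> Ux sH; rewrite /second_derivative -(derive_gradient_dot _ _ sH).
rewrite trmx_mul P_antisym // mulNmx mulmxN mulmxA.
by rewrite [in RHS]mxE opprK.
Qed.

Lemma mxform_gradient_derivative_r K (x u h : 'rV[R]_n) : U x -> smooth K x ->
  mxform (P x) h ('D_u (gradient K) x) = second_derivative K x u (h *m P x).
Proof.
move=> Ux sK; rewrite mxform_antisym; last exact: P_antisym.
by rewrite mxform_gradient_derivative_l // opprK.
Qed.

Lemma poisson_form2 F H K (x : 'rV[R]_n) : U x -> smooth F x -> smooth H x -> smooth K x ->
  poisson_form F (poisson_form H K) x =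
  mxform ('D_(gradient F x *m P x) P x) (gradient H x) (gradient K x) -
  second_derivative H x (gradient F x *m P x) (gradient K x *m P x) +
  second_derivative K x (gradient F x *m P x) (gradient H x *m P x).
Proof.
move=> Ux sF sH sK.
rewrite {1}/poisson_form mxform_antisym; last exact: P_antisym.
rewrite /mxform -mulmxA.
have -> : (gradient (poisson_form H K) x *m (P x *m (gradient F x)^T)) 0 0 =
    - 'D_(gradient F x *m P x) (poisson_form H K) x.
  rewrite -(gradient_dot _ (smooth_diff (smooth_poisson_form Ux sH sK))).
  by rewrite trmx_mul P_antisym // mulNmx mulmxN [in RHS]mxE opprK.
rewrite opprK.
apply: etrans (derive_mxform _ (P_smooth Ux) (smooth_gradient sH) (smooth_gradient sK)) _.
rewrite (mxform_gradient_derivative_l _ _ Ux sH) (mxform_gradient_derivative_r _ _ Ux sK).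
by rewrite [X in X + _ = _]addrC.
Qed.

Lemma jacobi_second_order (a b c p q s p' q' s' : R) : p = p' -> q = q' -> s = s' ->
  a - p + q + (b - q' + s) + (c - s' + p') = a + b + c.
Proof. by move=> -> -> ->; ring. Qed.

(* By symmetry of the Hessians, the second-order terms cancel in the cyclic sum. *)
Lemma poisson_form_jacobiator F H K (x : 'rV[R]_n) : U x -> smooth F x -> smooth H x -> smooth K x ->
  poisson_form F (poisson_form H K) x + poisson_form H (poisson_form K F) x +
  poisson_form K (poisson_form F H) x =
  jacobiator x (gradient F x) (gradient H x) (gradient K x).
Proof.
move=> Ux sF sH sK; rewrite !poisson_form2 //; apply: jacobi_second_order.
- exact: (derive_sym_scalar _ _ sH).
- exact: (derive_sym_scalar _ _ sK).
- exact: (derive_sym_scalar _ _ sF).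
Qed.

Lemma smooth_on_at F (x : 'rV[R]_n) : smooth_on U F -> U x -> smooth F x.
Proof. by move=> sF Ux; exact: (smooth_on_smooth_scalar U_open sF). Qed.

Lemma near_in F F' (x : 'rV[R]_n) : U x -> {in U, F =1 F'} -> \forall y \near x, F y = F' y.
Proof.
move=> Ux E; have : \forall y \near x, U y by apply: open_nbhs_nbhs; split.
by apply: filterS => y Uy; apply: E; exact: mem_set.
Qed.

(** Linear functions realise every triple of covectors as gradients, so the Jacobi identity on them
    already forces the jacobiator to vanish. The other axioms follow from the product rule and from
    smoothness and antisymmetry of P. *)
Lemma poisson_form_poisson_bracket :
  poisson_bracket U poisson_form <->
  forall x f h k, U x -> jacobiator x f h k = 0.
Proof.
split=> [B x f h k Ux|J].
  have lin (g : 'rV[R]_n) y : smooth (fun y : 'rV[R]_n => (g *m y^T) 0 0) y.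
    move=> l; apply: (@Cn_ext _ _ _ _ (fun y : 'rV[R]_n => \sum_i g 0 i * y 0 i)).
      by move=> z; rewrite mxE; apply: eq_bigr => i _; rewrite !mxE.
    apply: Cn_sum => i _; apply: Cn_M; [exact: Cn_cst | exact/Cn_coord/Cn_id].
  have son (g : 'rV[R]_n) : smooth_on U (fun y : 'rV[R]_n => (g *m y^T) 0 0).
    by apply: smooth_smooth_on => y _; exact: lin.
  have := pb_jacobi B (son f) (son h) (son k) (mem_set Ux).
  by rewrite poisson_form_jacobiator // !gradient_linear.
split.
- move=> F F' H H' sF sH EF EH x /set_mem Ux; rewrite /poisson_form.
  by rewrite (gradient_near_eq (near_in Ux EF)) (gradient_near_eq (near_in Ux EH)).
- move=> F H sF sH; apply: smooth_smooth_on => x Ux.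
  by apply: smooth_poisson_form => //; exact: smooth_on_at.
- move=> a F H K sF sH sK x /set_mem Ux; rewrite /poisson_form.
  rewrite (gradient_lin a (smooth_diff (smooth_on_at sF Ux)) (smooth_diff (smooth_on_at sH Ux))).
  exact: mxform_linl.
- move=> F H sF sH x /set_mem Ux; apply: mxform_antisym; exact: P_antisym.
- move=> F H K sF sH sK x /set_mem Ux; rewrite /poisson_form.
  rewrite (gradient_mul (smooth_diff (smooth_on_at sF Ux)) (smooth_diff (smooth_on_at sH Ux))).
  rewrite mxform_linl -[H x *: _]addr0 mxform_linl.
  by rewrite {3}/mxform !mul0mx mxE addr0 [H x * _]mulrC.
- move=> F H K sF sH sK x /set_mem Ux.
  by rewrite poisson_form_jacobiator //; [exact: J | exact: smooth_on_at ..].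
Qed.

End PoissonForm.

End PoissonStructures.

(** * Poisson brackets determined by two actions *)

Section ActionPoisson.
Context {R : realType}.

Definition dotp n (a b : 'rV[R]_n) : R := (a *m b^T) 0 0.

Lemma dotpE n (a b : 'rV[R]_n) : dotp a b = \sum_i a 0 i * b 0 i.
Proof. by rewrite /dotp mxE; apply: eq_bigr => i _; rewrite mxE. Qed.

Lemma dotpC n (a b : 'rV[R]_n) : dotp a b = dotp b a.
Proof. by rewrite !dotpE; apply: eq_bigr => i _; rewrite mulrC. Qed.

Lemma dotp_linr n (a : 'rV[R]_n) (t : R) (b c : 'rV[R]_n) :
  dotp a (t *: b + c) = t * dotp a b + dotp a c.
Proof. by rewrite /dotp linearP /= mulmxDr -scalemxAr !mxE. Qed.

Lemma dotp0r n (a : 'rV[R]_n) : dotp a 0 = 0.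
Proof. by rewrite /dotp trmx0 mulmx0 mxE. Qed.

Lemma dotp0l n (a : 'rV[R]_n) : dotp 0 a = 0.
Proof. by rewrite /dotp mul0mx mxE. Qed.

Lemma dotpDr n (a b c : 'rV[R]_n) : dotp a (b + c) = dotp a b + dotp a c.
Proof. by have := dotp_linr a 1 b c; rewrite scale1r mul1r. Qed.

Lemma dotpZr n (a b : 'rV[R]_n) (t : R) : dotp a (t *: b) = t * dotp a b.
Proof. by have := dotp_linr a t b 0; rewrite !addr0 dotp0r addr0. Qed.

Lemma dotpNr n (a b : 'rV[R]_n) : dotp a (- b) = - dotp a b.
Proof. by rewrite -scaleN1r dotpZr mulN1r. Qed.

Lemma dotp_delta n (a : 'rV[R]_n) (i : 'I_n) : dotp (delta_mx 0 i) a = a 0 i.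
Proof.
rewrite dotpE (bigD1 i) //= big1 ?addr0 ?mxE ?eqxx ?mul1r // => j ji.
by rewrite !mxE eqxx /= (negbTE ji) mul0r.
Qed.

Lemma scaler_addr_add (Z : lmodType R) (t : R) (a b c d : Z) :
  t *: a + b + (t *: c + d) = t *: (a + c) + (b + d).
Proof. by rewrite scalerDr addrACA. Qed.

Lemma dotp_row m n (a c : 'rV[R]_m) (b d : 'rV[R]_n) :
  dotp (row_mx a b) (row_mx c d) = dotp a c + dotp b d.
Proof. by rewrite /dotp tr_row_mx mul_row_col mxE. Qed.

Lemma dotp_sum3 n (h k f f' X Y Z Z' : 'rV[R]_n) : h = 0 -> k = 0 -> f = f' -> Z = Z' ->
  dotp h X + dotp k Y + dotp f Z = dotp f' Z'.
Proof. by move=> -> -> -> ->; rewrite !dotp0l !add0r. Qed.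

Lemma derive_dotp n (V : normedModType R) (a : 'rV[R]_n) (f : V -> 'rV[R]_n) (x u : V) :
  smooth f x -> 'D_u (fun y => dotp a (f y)) x = dotp a ('D_u f x).
Proof.
move=> sf.
have s i : smooth (fun y => a 0 i * f y 0 i) x.
  by move=> l; apply: Cn_M; [exact: Cn_cst | exact: Cn_coord].
under eq_fun do rewrite dotpE.
rewrite (derive_bigsum u (fun i => smooth_diff (s i))) dotpE; apply: eq_bigr => i _.
have dc : differentiable (fun _ : V => a 0 i) x by exact: differentiable_cst.
have df : differentiable (fun y => f y 0 i) x by exact: smooth_diff (fun l => Cn_coord 0 i (sf l)).
rewrite (derive_mul u dc df) derive_cst mul0r addr0.
by rewrite (derive_coord u 0 i (smooth_diff sf)).
Qed.

Lemma smooth_dotp n (V : normedModType R) (a : 'rV[R]_n) (f : V -> 'rV[R]_n) (x : V) :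
  smooth f x -> smooth (fun y => dotp a (f y)) x.
Proof.
move=> sf l; apply: (@Cn_ext _ _ _ _ (fun y => \sum_i a 0 i * f y 0 i)) => [y|].
  by rewrite dotpE.
by apply: Cn_sum => i _; apply: Cn_M; [exact: Cn_cst | exact: Cn_coord].
Qed.

Context {r p : nat} {G : lieGroupType R r} (v : r.-tuple 'rV[R]_r).
Context (v_basis : basis_of fullv v).

Definition coords (w : 'rV[R]_r) : 'rV[R]_r := \row_k coord v k w.

Definition combination (a : 'rV[R]_r) : 'rV[R]_r := \sum_k a 0 k *: tnth v k.

Lemma combination_coords (w : 'rV[R]_r) : combination (coords w) = w.
Proof.
rewrite [RHS](coord_basis v_basis (memvf w)); apply: eq_bigr => k _.
by rewrite mxE (tnth_nth 0).
Qed.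

Lemma combination0 : combination 0 = 0.
Proof. by rewrite /combination big1 // => k _; rewrite mxE scale0r. Qed.

Lemma coords_lin (t : R) (a b : 'rV[R]_r) : coords (t *: a + b) = t *: coords a + coords b.
Proof. by apply/rowP => k; rewrite !mxE linearP. Qed.

Lemma coords0 : coords 0 = 0.
Proof. by apply/rowP => k; rewrite !mxE linear0. Qed.

Lemma coordsD (a b : 'rV[R]_r) : coords (a + b) = coords a + coords b.
Proof. by have := coords_lin 1 a b; rewrite !scale1r. Qed.

Lemma lin_sum (V W : lmodType R) (T : V -> W) n (a : 'I_n -> R) (w : 'I_n -> V) :
  (forall (t : R) x y, T (t *: x + y) = t *: T x + T y) ->
  T (\sum_i a i *: w i) = \sum_i a i *: T (w i).
Proof.
move=> lT; have T0 : T 0 = 0.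
  by have := lT (-1) 0 0; rewrite scaler0 addr0 scaleN1r addNr.
elim: n a w => [|n IH] a w; first by rewrite !big_ord0.
by rewrite !big_ord_recl lT IH.
Qed.

Lemma lie_bracket0r (w : 'rV[R]_r) : lie_bracket G w 0 = 0.
Proof.
by have := lie_bracket_linr w (-1) 0 0 (G := G); rewrite scaler0 addr0 scaleN1r addNr.
Qed.

Lemma lie_bracket_combination (a b : 'rV[R]_r) :
  lie_bracket G (combination a) (combination b) =
  \sum_i \sum_j (a 0 i * b 0 j) *: lie_bracket G (tnth v i) (tnth v j).
Proof.
rewrite (@lin_sum _ _ (fun x => lie_bracket G x (combination b))) => [|t x y]; last first.
  exact: lie_bracket_linl.
apply: eq_bigr => i _; rewrite /combination lin_sum => [|t x y]; last exact: lie_bracket_linr.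
by rewrite scaler_sumr; apply: eq_bigr => j _; rewrite scalerA.
Qed.

(** This is the Lie-Poisson form, the pairing of xi with [a, b], and it removes the structure
    constants from all later computations. *)
Lemma mxform_lie_Lambda (xi a b : 'rV[R]_r) :
  mxform (lie_Lambda G v xi) a b =
  dotp xi (coords (lie_bracket G (combination a) (combination b))).
Proof.
have TD : {morph (fun w => dotp xi (coords w)) : x y / x + y >-> x + y}.
  by move=> x y; rewrite coordsD dotpDr.
have T0 : dotp xi (coords 0) = 0 by rewrite coords0 dotp0r.
rewrite mxformE lie_bracket_combination (big_morph _ TD T0); apply: eq_bigr => i _.
rewrite (big_morph _ TD T0); apply: eq_bigr => j _.
rewrite -[_ *: _]addr0 coords_lin coords0 addr0 dotpZr dotpE mxE mulrAC; congr (_ * _).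
by apply: eq_bigr => k _; rewrite mxE mulrC.
Qed.

(** * The block matrix attached to a family of fields *)

Section BlockStructure.
Context (M : set 'rV[R]_p) (S : 'rV[R]_r -> 'rV[R]_p -> 'rV[R]_p) (lam : R).
Context (S_lin : forall z (t : R) a b, M z -> S (t *: a + b) z = t *: S a z + S b z).
Context (S_smooth : forall a z, M z -> smooth (S a) z).

Definition field_matrix (z : 'rV[R]_p) : 'M[R]_(p, r) :=
  \matrix_(a < p, k < r) S (tnth v k) z 0 a.

(** The matrix of the bracket of one action has lam = 1; the sum of the two brackets has lam = 2 and
    S equal to the sum of the two families of fields. *)
Definition block_structure (x : 'rV[R]_(p + r)) : 'M[R]_(p + r) :=
  block_mx 0 (field_matrix (lsubmx x)) (- (field_matrix (lsubmx x))^T)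
    (lam *: lie_Lambda G v (rsubmx x)).

Lemma field_matrix_mul (z : 'rV[R]_p) (a : 'rV[R]_r) : M z ->
  a *m (field_matrix z)^T = S (combination a) z.
Proof.
move=> Mz; rewrite /combination (@lin_sum _ _ (S^~ z)) => [|t x y]; last exact: S_lin.
apply/rowP => i; rewrite mxE summxE; apply: eq_bigr => k _.
by rewrite !mxE.
Qed.

(** A covector of the phase space is a covector of M together with an element of the Lie algebra,
    given here by its coordinates in the basis v. *)
Lemma mxform_block (x h k : 'rV[R]_(p + r)) : M (lsubmx x) ->
  mxform (block_structure x) h k =
  dotp (lsubmx h) (S (combination (rsubmx k)) (lsubmx x)) -
  dotp (lsubmx k) (S (combination (rsubmx h)) (lsubmx x)) +
  lam * dotp (rsubmx x) (coords
    (lie_bracket G (combination (rsubmx h)) (combination (rsubmx k)))).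
Proof.
move=> Mz; rewrite -mxform_lie_Lambda -!(field_matrix_mul _ Mz) /mxform.
rewrite -{1}(hsubmxK h) -{1}(hsubmxK k) /block_structure mul_row_block tr_row_mx mul_row_col.
rewrite mulmx0 add0r mulmxN mulNmx mulmxDl -scalemxAr -scalemxAl.
rewrite (dotpC (lsubmx k)) /dotp trmx_mul trmxK mulmxA !mxE.
by rewrite addrA [X in X + _ = _]addrC.
Qed.

Lemma mxform_mul n (Q : 'M[R]_n) (h k : 'rV[R]_n) : mxform Q h k = dotp k (h *m Q).
Proof. by rewrite dotpC. Qed.

(** The row [f *m P] is the direction along which the jacobiator differentiates; its component along
    M is read off by pairing with the covectors of M. *)
Lemma lsubmx_mul_block (x f : 'rV[R]_(p + r)) : M (lsubmx x) ->
  lsubmx (f *m block_structure x) = - S (combination (rsubmx f)) (lsubmx x).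
Proof.
move=> Mz; apply/rowP => i.
have S0 : S 0 (lsubmx x) = 0.
  by have := S_lin (-1) 0 0 Mz; rewrite scaler0 addr0 scaleN1r addNr.
have := mxform_block f (row_mx (delta_mx 0 i) 0) Mz.
rewrite mxform_mul -{1}[f *m _]hsubmxK row_mxKl row_mxKr dotp_row dotp0l addr0 !dotp_delta => ->.
by rewrite combination0 S0 dotp0r lie_bracket0r coords0 dotp0r mulr0 sub0r addr0 mxE.
Qed.

(** The component along the dual of the Lie algebra is described by its pairings with [coords w],
    the form in which the derivative of Lambda uses it. *)
Lemma rsubmx_mul_block (x f : 'rV[R]_(p + r)) (w : 'rV[R]_r) : M (lsubmx x) ->
  dotp (coords w) (rsubmx (f *m block_structure x)) =
  dotp (lsubmx f) (S w (lsubmx x)) +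
  lam * dotp (rsubmx x) (coords (lie_bracket G (combination (rsubmx f)) w)).
Proof.
move=> Mz; have := mxform_block f (row_mx 0 (coords w)) Mz.
rewrite mxform_mul -{1}[f *m _]hsubmxK row_mxKl row_mxKr dotp_row !dotp0l add0r => ->.
by rewrite combination_coords subr0.
Qed.

Lemma smooth_lsubmx m n (x : 'rV[R]_(m + n)) : smooth (lsubmx : 'rV[R]_(m + n) -> 'rV[R]_m) x.
Proof. by move=> k; apply: Cn_lsubmx; exact: Cn_id. Qed.

Lemma smooth_rsubmx m n (x : 'rV[R]_(m + n)) : smooth (rsubmx : 'rV[R]_(m + n) -> 'rV[R]_n) x.
Proof. by move=> k; apply: Cn_rsubmx; exact: Cn_id. Qed.

Lemma smooth_field_lsubmx (a : 'rV[R]_r) (x : 'rV[R]_(p + r)) : M (lsubmx x) ->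
  smooth (fun y : 'rV[R]_(p + r) => S a (lsubmx y)) x.
Proof. by move=> Mz; apply: smooth_comp (smooth_lsubmx x) (S_smooth a Mz). Qed.

Lemma smooth_block_structure (x : 'rV[R]_(p + r)) : M (lsubmx x) -> smooth block_structure x.
Proof.
move=> Mz l; apply: Cn_mx => i j.
case: (split_ordP i) => i' ->; case: (split_ordP j) => j' ->.
- apply: (@Cn_ext _ _ _ _ (fun _ : 'rV[R]_(p + r) => 0 : R)) => [y|]; last exact: Cn_cst.
  by rewrite /block_structure block_mxEul mxE.
- apply: (@Cn_ext _ _ _ _ (fun y : 'rV[R]_(p + r) => S (tnth v j') (lsubmx y) 0 i')) => [y|].
    by rewrite /block_structure block_mxEur mxE.
  by apply: Cn_coord; exact: smooth_field_lsubmx.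
- apply: (@Cn_ext _ _ _ _ (fun y : 'rV[R]_(p + r) => - S (tnth v i') (lsubmx y) 0 j')) => [y|].
    by rewrite /block_structure block_mxEdl !mxE.
  by apply: Cn_N; apply: Cn_coord; exact: smooth_field_lsubmx.
- apply: (@Cn_ext _ _ _ _ (fun y : 'rV[R]_(p + r) =>
      lam * \sum_k struct_const G v i' j' k * rsubmx y 0 k)) => [y|].
    by rewrite /block_structure block_mxEdr !mxE.
  apply: Cn_M; first exact: Cn_cst.
  apply: Cn_sum => k _; apply: Cn_M; first exact: Cn_cst.
  by apply: Cn_coord; exact: smooth_rsubmx.
Qed.

Lemma lie_Lambda_tr (xi : 'rV[R]_r) : (lie_Lambda G v xi)^T = - lie_Lambda G v xi.
Proof.
apply/matrixP => i j; rewrite !mxE -sumrN; apply: eq_bigr => k _.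
by rewrite /struct_const lie_bracket_antisym linearN mulNr.
Qed.

Lemma block_structure_tr (x : 'rV[R]_(p + r)) : (block_structure x)^T = - block_structure x.
Proof.
rewrite /block_structure tr_block_mx opp_block_mx trmx0 !linearN /= trmxK linearZ /=.
by rewrite lie_Lambda_tr scalerN oppr0 opprK.
Qed.

Lemma derive_block_structure (x u h k : 'rV[R]_(p + r)) : M (lsubmx x) -> open M ->
  mxform ('D_u block_structure x) h k =
  dotp (lsubmx h) ('D_(lsubmx u) (S (combination (rsubmx k))) (lsubmx x)) -
  dotp (lsubmx k) ('D_(lsubmx u) (S (combination (rsubmx h))) (lsubmx x)) +
  lam * dotp (coords (lie_bracket G (combination (rsubmx h)) (combination (rsubmx k)))) (rsubmx u).
Proof.
move=> Mz M_open.
set a := combination (rsubmx h); set b := combination (rsubmx k).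
have scst (y : 'rV[R]_(p + r)) : smooth (fun _ : 'rV[R]_(p + r) => y) x by move=> l; exact: Cn_cst.
have := derive_mxform u (smooth_block_structure Mz) (scst h) (scst k).
rewrite !derive_cst.
have m0r (Q : 'M[R]_(p + r)) y : mxform Q y 0 = 0 by rewrite /mxform trmx0 mulmx0 mxE.
have m0l (Q : 'M[R]_(p + r)) y : mxform Q 0 y = 0 by rewrite /mxform !mul0mx mxE.
rewrite m0r m0l addr0 add0r => <-.
have N : \forall y \near x, mxform (block_structure y) h k =
    dotp (lsubmx h) (S b (lsubmx y)) - dotp (lsubmx k) (S a (lsubmx y)) +
    lam * dotp (coords (lie_bracket G a b)) (rsubmx y).
  have Nz : \forall z \near lsubmx x, M z by apply: open_nbhs_nbhs; split.
  have Nx : \forall y \near x, M (lsubmx y) by exact: (smooth_continuous (smooth_lsubmx x) Nz).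
  by apply: filterS Nx => y My; rewrite mxform_block // [dotp (rsubmx y) _]dotpC.
rewrite (near_eq_derive u N).
have dS c : 'D_u (fun y : 'rV[R]_(p + r) => S c (lsubmx y)) x = 'D_(lsubmx u) (S c) (lsubmx x).
  rewrite (derive_comp u (smooth_diff (smooth_lsubmx x)) (smooth_diff (S_smooth c Mz))).
  congr ('D_ _ _ _).
  have did : differentiable (fun y : 'rV[R]_(p + r) => y) x by exact: smooth_diff (fun k => Cn_id k x).
  by rewrite (derive_lsubmx u did) derive_id.
have s1 := smooth_dotp (lsubmx h) (smooth_field_lsubmx b Mz).
have s2 := smooth_dotp (lsubmx k) (smooth_field_lsubmx a Mz).
have s3 := smooth_dotp (coords (lie_bracket G a b)) (smooth_rsubmx x).
have d1 := smooth_diff s1; have d2 := smooth_diff s2; have d3 := smooth_diff s3.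
have dl : differentiable (fun _ : 'rV[R]_(p + r) => lam) x by exact: differentiable_cst.
have d12 := smooth_diff (fun l => Cn_B (s1 l) (s2 l)).
have d3' := smooth_diff (fun l => Cn_M (Cn_cst l lam x) (s3 l)).
apply: etrans (deriveD (diff_derivable d12) (diff_derivable d3')) _.
apply: (f_equal2 (fun a b => a + b)).
  apply: etrans (deriveB (diff_derivable d1) (diff_derivable d2)) _.
  rewrite (derive_dotp _ _ (smooth_field_lsubmx b Mz)) (derive_dotp _ _ (smooth_field_lsubmx a Mz)).
  by rewrite !dS.
apply: etrans (derive_mul u dl d3) _.
rewrite derive_cst mul0r addr0 (derive_dotp _ _ (smooth_rsubmx x)).
have did : differentiable (fun y : 'rV[R]_(p + r) => y) x by exact: smooth_diff (fun k => Cn_id k x).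
by rewrite (derive_rsubmx u did) derive_id.
Qed.

Lemma derive_oppl (V W : normedModType R) (f : V -> W) (x u : V) : differentiable f x ->
  'D_(- u) f x = - 'D_u f x.
Proof. by move=> df; rewrite -[- u]sub0r (deriveBl _ _ df) derive0 sub0r. Qed.

Lemma jacobiator_rearrange (a1 a2 a3 a4 a5 a6 s1 s2 s3 j1 j2 j3 t : R) : j1 + j2 + j3 = 0 ->
  - a1 + a2 + t * (s1 + t * j1) + (- a3 + a4 + t * (s2 + t * j2)) +
  (- a5 + a6 + t * (s3 + t * j3)) =
  a6 - a1 + t * s2 + (a2 - a3 + t * s3) + (a4 - a5 + t * s1).
Proof. by move=> J; rewrite -[LHS]subr0 -(mulr0 (t * t)) -J; ring. Qed.

(** Measures the failure of S to satisfy [S(a), S(b)] = - lam S([a, b]); the Jacobi identity reduces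
    to its vanishing. *)
Definition bracket_defect (a b : 'rV[R]_r) (z : 'rV[R]_p) : 'rV[R]_p :=
  field_bracket (S a) (S b) z + lam *: S (lie_bracket G a b) z.

Lemma derive_block_structure_ham (x f h k : 'rV[R]_(p + r)) : M (lsubmx x) -> open M ->
  mxform ('D_(f *m block_structure x) block_structure x) h k =
  - dotp (lsubmx h) ('D_(S (combination (rsubmx f)) (lsubmx x)) (S (combination (rsubmx k))) (lsubmx x)) +
  dotp (lsubmx k) ('D_(S (combination (rsubmx f)) (lsubmx x)) (S (combination (rsubmx h))) (lsubmx x)) +
  lam * (dotp (lsubmx f) (S (lie_bracket G (combination (rsubmx h)) (combination (rsubmx k))) (lsubmx x)) +
    lam * dotp (rsubmx x) (coords (lie_bracket G (combination (rsubmx f))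
      (lie_bracket G (combination (rsubmx h)) (combination (rsubmx k)))))).
Proof.
move=> Mz M_open.
have dS w := smooth_diff (S_smooth w Mz).
apply: etrans (derive_block_structure (f *m block_structure x) h k Mz M_open) _.
rewrite (rsubmx_mul_block f _ Mz) (lsubmx_mul_block f Mz).
rewrite (derive_oppl _ (dS (combination (rsubmx k)))) (derive_oppl _ (dS (combination (rsubmx h)))).
by rewrite !dotpNr opprK.
Qed.

Lemma dotp_bracket_defect (h : 'rV[R]_p) (a b : 'rV[R]_r) (z : 'rV[R]_p) :
  dotp h (bracket_defect a b z) =
  dotp h ('D_(S a z) (S b) z) - dotp h ('D_(S b z) (S a) z) + lam * dotp h (S (lie_bracket G a b) z).
Proof. by rewrite /bracket_defect /field_bracket dotpDr dotpZr dotpDr dotpNr. Qed.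

#[local] Opaque mxform dotp lie_bracket combination coords block_structure bracket_defect.

(** In the cyclic sum the derivatives of the fields combine into Lie brackets, while the terms
    containing the point of the dual add up to lam * lam times its pairing with a cyclic sum of
    double brackets, which is zero. *)
Lemma jacobiator_block_structure (x f h k : 'rV[R]_(p + r)) : M (lsubmx x) -> open M ->
  jacobiator block_structure x f h k =
  dotp (lsubmx h) (bracket_defect (combination (rsubmx k)) (combination (rsubmx f)) (lsubmx x)) +
  dotp (lsubmx k) (bracket_defect (combination (rsubmx f)) (combination (rsubmx h)) (lsubmx x)) +
  dotp (lsubmx f) (bracket_defect (combination (rsubmx h)) (combination (rsubmx k)) (lsubmx x)).
Proof.
move=> Mz M_open; have E := derive_block_structure_ham _ _ _ Mz M_open.
apply: etrans (f_equal2 +%R (f_equal2 +%R (E f h k) (E h k f)) (E k f h)) _.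
rewrite !dotp_bracket_defect; apply: jacobiator_rearrange.
by rewrite -!dotpDr -!coordsD lie_bracket_jacobi coords0 dotp0r.
Qed.

Lemma jacobiator_block_structure_eq0 : open M ->
  (forall x f h k, phase_space M x -> jacobiator block_structure x f h k = 0) <->
  (forall a b z, M z -> bracket_defect a b z = 0).
Proof.
move=> M_open; split=> [J a b z Mz|E x f h k Mz]; last first.
  rewrite (jacobiator_block_structure f h k Mz M_open).
  by rewrite (E _ _ _ Mz) (E _ _ _ Mz) (E _ _ _ Mz) !dotp0r !addr0.
apply/rowP => i; rewrite [RHS]mxE -dotp_delta.
have Mx : M (lsubmx (row_mx z 0 : 'rV[R]_(p + r))) by rewrite row_mxKl.
(* The test covectors are the i-th coordinate covector of M and the elements a and b of the Lie
   algebra: a single term of the cyclic sum survives, the i-th coordinate of the defect. *)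
apply: etrans _ (J (row_mx z 0) (row_mx (delta_mx 0 i) 0) (row_mx 0 (coords a)) (row_mx 0 (coords b)) Mx).
apply: esym; apply: etrans (jacobiator_block_structure _ _ _ Mx M_open) _.
apply: dotp_sum3; rewrite ?row_mxKl ?row_mxKr ?combination_coords; exact: erefl.
Qed.

Lemma block_structure_poisson_bracket : open M ->
  poisson_bracket (@phase_space R r p M) (poisson_form block_structure) <->
  (forall a b z, M z -> bracket_defect a b z = 0).
Proof.
move=> M_open.
have oU : open (@phase_space R r p M).
  apply: (open_comp (f := lsubmx)) => // x _; exact: smooth_continuous (smooth_lsubmx x).
apply: iff_trans (poisson_form_poisson_bracket oU smooth_block_structure
  (fun x _ => block_structure_tr x)) _.
apply: iff_trans _ (jacobiator_block_structure_eq0 M_open).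
by split=> H x f h k; exact: H.
Qed.

End BlockStructure.

Lemma field_bracket_parallelogram (X Y X' Y' : 'rV[R]_p -> 'rV[R]_p) (z : 'rV[R]_p) :
  differentiable X z -> differentiable Y z -> differentiable X' z -> differentiable Y' z ->
  field_bracket (fun y => X y + Y y) (fun y => X' y + Y' y) z +
  field_bracket (fun y => X y - Y y) (fun y => X' y - Y' y) z =
  2 *: (field_bracket X X' z + field_bracket Y Y' z).
Proof.
move=> dX dY dX' dY'; rewrite /field_bracket.
have D1 F H u : differentiable F z -> differentiable H z ->
    'D_u (fun y : 'rV[R]_p => F y + H y : 'rV[R]_p) z = 'D_u F z + 'D_u H z.
  by move=> dF dH; exact: deriveD (diff_derivable dF) (diff_derivable dH).
have D2 F H u : differentiable F z -> differentiable H z ->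
    'D_u (fun y : 'rV[R]_p => F y - H y : 'rV[R]_p) z = 'D_u F z - 'D_u H z.
  by move=> dF dH; exact: deriveB (diff_derivable dF) (diff_derivable dH).
rewrite (D1 _ _ _ dX' dY') (D1 _ _ _ dX dY) (D2 _ _ _ dX' dY') (D2 _ _ _ dX dY).
rewrite !(deriveBl _ _ dX) !(deriveBl _ _ dY) !(deriveBl _ _ dX') !(deriveBl _ _ dY').
rewrite !(deriveDl _ _ dX) !(deriveDl _ _ dY) !(deriveDl _ _ dX') !(deriveDl _ _ dY').
move: ('D_(X z) X' z) ('D_(Y z) X' z) ('D_(X z) Y' z) ('D_(Y z) Y' z).
move: ('D_(X' z) X z) ('D_(Y' z) X z) ('D_(X' z) Y z) ('D_(Y' z) Y z).
by move=> b1 b2 b3 b4 a1 a2 a3 a4; apply/rowP => i; rewrite !mxE; ring.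
Qed.

Lemma action_brackets_compatible (M : set 'rV[R]_p) (A1 A2 : local_action G M) : open M ->
  poisson_compatible (@phase_space R r p M) (action_bracket v A1) (action_bracket v A2) <->
  commutative_fields M (fun w z => action_field A1 w z - action_field A2 w z).
Proof.
move=> M_open.
pose S (w : 'rV[R]_r) (z : 'rV[R]_p) : 'rV[R]_p := action_field A1 w z + action_field A2 w z.
have S_lin z (t : R) a b : M z -> S (t *: a + b) z = t *: S a z + S b z.
  move=> Mz; rewrite /S (action_field_lin A1 _ _ _ Mz) (action_field_lin A2 _ _ _ Mz).
  exact: scaler_addr_add.
have S_smooth a z : M z -> smooth (S a) z.
  by move=> Mz k; apply: Cn_D; exact: smooth_action_field.
rewrite /poisson_compatible.
have -> : (fun F H x => action_bracket v A1 F H x + action_bracket v A2 F H x) =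
    poisson_form (block_structure S 2).
  apply/funext => F; apply/funext => H; apply/funext => x.
  rewrite /action_bracket -mxformD /poisson_form; congr (mxform _ _ _).
  rewrite add_block_mx addr0 -opprD -linearD /block_structure.
  have -> : action_Phi v A1 (lsubmx x) + action_Phi v A2 (lsubmx x) = field_matrix S (lsubmx x).
    by apply/matrixP => i j; rewrite !mxE.
  by rewrite scaler_nat mulr2n.
have B := block_structure_poisson_bracket 2 S_lin S_smooth M_open.
apply: iff_trans B _.
have E a b z : M z -> bracket_defect S 2 a b z =
    - field_bracket (fun z => action_field A1 a z - action_field A2 a z)
      (fun z => action_field A1 b z - action_field A2 b z) z.
  move=> Mz; have d1 w := smooth_diff (smooth_action_field M_open A1 w Mz).
  have d2 w := smooth_diff (smooth_action_field M_open A2 w Mz).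
  have := field_bracket_parallelogram (d1 a) (d2 a) (d1 b) (d2 b).
  (* The right-hand side of the parallelogram identity becomes - 2 S([a, b]), so the defect with lam
     = 2 is minus the bracket of the differences. *)
  rewrite !action_field_bracket // -opprD scalerN => H.
  by apply/eqP; rewrite -subr_eq0 opprK addrAC H addNr.
split=> H a b z Mz; last by rewrite E // H // oppr0.
by apply: oppr_inj; rewrite oppr0 -E // H.
Qed.

End ActionPoisson.

(** * Translations *)

Lemma dim_row (R : realType) (n : nat) : dim 'rV[R]_n = n.
Proof. by rewrite dim_matrix; exact: mul1n. Qed.

Section Translations.
Context {R : realType} {r p : nat}.
Context (M : set 'rV[R]_p) (X : 'rV[R]_r -> 'rV[R]_p -> 'rV[R]_p).
Context (X_lin : forall z (t : R) (a b : 'rV[R]_r), M z -> X (t *: a + b) z = t *: X a z + X b z).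

Lemma field0 z : M z -> X 0 z = 0.
Proof. by move=> Mz; have := X_lin (-1) 0 0 Mz; rewrite scaler0 addr0 scaleN1r addNr. Qed.

Lemma field_sum n (a : 'I_n -> R) (w : 'I_n -> 'rV[R]_r) z : M z ->
  X (\sum_i a i *: w i) z = \sum_i a i *: X (w i) z.
Proof. by move=> Mz; apply: (@lin_sum _ _ _ (X^~ z)) => t x y; exact: X_lin. Qed.

(** The condition ranges over all points of M, so the kernel is obtained as a subspace of largest
    dimension on which the fields vanish: a further element of the kernel could be added to it. *)
Lemma field_kernel : exists K : {vspace 'rV[R]_r},
  forall v, v \in K <-> (forall z, M z -> X v z = 0).
Proof.
pose Q (d : nat) := `[< exists2 K : {vspace 'rV[R]_r},
  (forall v, v \in K -> forall z, M z -> X v z = 0) & \dim K = d >].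
have Q0 : exists d, Q d.
  exists 0%N; apply/asboolP; exists 0%VS; last by rewrite dimv0.
  by move=> v; rewrite memv0 => /eqP -> z; exact: field0.
have Qle d : Q d -> (d <= r)%N.
  by move=> /asboolP [K _ <-]; have := dimvS (subvf K); rewrite dimvf dim_row.
case: (ex_maxnP Q0 Qle) => d /asboolP [K KX dK] dmax; exists K => v; split; first exact: KX.
move=> Xv; apply: contrapT => /negP vK.
have sub : (K <= K + <[v]>)%VS by exact: addvSl.
have : (\dim (K + <[v]>) <= \dim K)%N.
  rewrite dK; apply: dmax; apply/asboolP; exists (K + <[v]>)%VS => // u.
  move=> /memv_addP [k kK [w /vlineP [t ->] ->]] z Mz.
  by rewrite addrC X_lin // Xv // KX // scaler0 addr0.
move=> le; have : (K == K + <[v]>)%VS by rewrite eqEdim sub.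
move=> /eqP E; move: vK; rewrite E => /negP; apply.
by rewrite -{1}[v]add0r memv_add ?mem0v ?memv_line.
Qed.

(** The fields of a complement of the kernel are free, since a relation among them gives an element
    of both subspaces, and they span, since the kernel contributes nothing. *)
Lemma fields_dim_compl (K : {vspace 'rV[R]_r}) :
  (forall v, v \in K <-> (forall z, M z -> X v z = 0)) ->
  (forall a : 'I_(\dim (K^C)) -> R,
     (forall z, M z -> \sum_i a i *: X (tnth (vbasis K^C) i) z = 0) -> forall i, a i = 0) /\
  (forall v, exists a : 'I_(\dim (K^C)) -> R,
     forall z, M z -> X v z = \sum_i a i *: X (tnth (vbasis K^C) i) z).
Proof.
move=> HK; split=> [a Ha|v].
  have inK : \sum_i a i *: tnth (vbasis K^C) i \in K.
    by apply/HK => z Mz; rewrite field_sum // Ha.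
  have inC : \sum_i a i *: tnth (vbasis K^C) i \in (K^C)%VS.
    by apply: memv_suml => i _; apply: memvZ; apply: vbasis_mem; exact: mem_tnth.
  have : \sum_i a i *: tnth (vbasis K^C) i \in (K :&: K^C)%VS by rewrite memv_cap inK inC.
  rewrite capv_compl memv0 => /eqP s0.
  have /freeP fr := basis_free (vbasisP K^C); apply: fr.
  by rewrite -[RHS]s0; apply: eq_bigr => i _; rewrite (tnth_nth 0).
have : v \in (K + K^C)%VS by rewrite addv_complf memvf.
move=> /memv_addP [k /HK kK [w wC ->]].
exists (fun i => coord (vbasis K^C) i w) => z Mz.
rewrite -[k]scale1r X_lin // kK // scaler0 add0r -field_sum //.
rewrite {1}(coord_vbasis wC); congr (X _ z); apply: eq_bigr => i _.
by rewrite (tnth_nth 0).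
Qed.

Lemma free_extend n (b : n.-tuple 'rV[R]_p) : free b ->
  (n <= p)%N /\ exists c : 'I_p -> 'rV[R]_p,
    (forall i : 'I_p, (i < n)%N -> c i = b`_i) /\
    (forall a : 'rV[R]_p, \sum_i a 0 i *: c i = 0 -> a = 0).
Proof.
move=> fb; pose B := <<b>>%VS; pose s := b ++ vbasis B^C.
have bB : basis_of B b by rewrite /basis_of eqxx fb.
have dB : \dim B = n by exact: size_basis bB.
have np : (n <= p)%N by rewrite -dB; have := dimvS (subvf B); rewrite dimvf dim_row.
have bs : basis_of fullv s.
  rewrite -(addv_complf B); apply: cat_basis => //; last exact: vbasisP.
  by apply/directv_addP; exact: capv_compl.
have ss : size s == p.
  by rewrite size_cat !size_tuple dimv_compl dB dimvf dim_row subnKC.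
split=> //; exists (fun i => s`_i); split=> [i ni|a Ha].
  by rewrite nth_cat size_tuple ni.
have /(@freeP _ _ _ (Tuple ss)) fr : free (Tuple ss) by exact: basis_free bs.
by apply/rowP => i; rewrite mxE; apply: fr.
Qed.

End Translations.

Lemma commuting_fields_translation (R : realType) (r p : nat) (M : set 'rV[R]_p)
    (X1 X2 : 'rV[R]_r -> 'rV[R]_p -> 'rV[R]_p) : open M ->
  (forall z (t : R) (a b : 'rV[R]_r), M z -> X1 (t *: a + b) z = t *: X1 a z + X1 b z) ->
  (forall z (t : R) (a b : 'rV[R]_r), M z -> X2 (t *: a + b) z = t *: X2 a z + X2 b z) ->
  (forall a z, M z -> smooth (X1 a) z) -> (forall a z, M z -> smooth (X2 a) z) ->
  commutative_fields M (fun w z => X1 w z - X2 w z) ->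
  differ_by_translation M X1 X2.
Proof.
move=> M_open L1 L2 s1 s2 comm.
pose X (w : 'rV[R]_r) (z : 'rV[R]_p) : 'rV[R]_p := X1 w z - X2 w z.
have X_lin z (t : R) (a b : 'rV[R]_r) : M z -> X (t *: a + b) z = t *: X a z + X b z.
  by move=> Mz; rewrite /X L1 // L2 // scaler_subr_add.
have X_smooth a z : M z -> smooth (X a) z by move=> Mz k; apply: Cn_B; [exact: s1 | exact: s2].
have [K HK] := field_kernel X_lin.
have [fr sp] := fields_dim_compl X_lin HK.
pose l := \dim (K^C); pose y := vbasis K^C.
exists l; first by exists y.
move=> z0 Mz0 [S [SX Smin dS]].
have size_w : size (y ++ vbasis K) == r.
  rewrite size_cat !size_tuple dimv_compl dimvf dim_row subnK //.
  by have := dimvS (subvf K); rewrite dimvf dim_row.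
(* The basis of the complement precedes that of the kernel: indices below l carry the translations,
   the others the elements on which both actions agree. *)
pose w : r.-tuple 'rV[R]_r := Tuple size_w.
have w_basis : basis_of fullv w.
  rewrite -(addv_complf K) addvC; apply: cat_basis (vbasisP _) (vbasisP _).
  by apply/directv_addP; rewrite capvC capv_compl.
have wlt (i : 'I_r) : (i < l)%N -> tnth w i = y`_i.
  by move=> il; rewrite (tnth_nth 0) /= nth_cat size_tuple il.
have wge (j : 'I_r) : (l <= j)%N -> tnth w j \in K.
  move=> lj; rewrite (tnth_nth 0) /= nth_cat size_tuple ltnNge lj /=.
  apply: vbasis_mem; apply: mem_nth; rewrite size_tuple ltn_subLR //.
  by apply: leq_trans (ltn_ord j) _; rewrite -{1}(eqP size_w) size_cat !size_tuple.
pose b : l.-tuple 'rV[R]_p := [tuple X (tnth y i) z0 | i < l].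
(* At a generic point the values of the l fields span a space of dimension l, hence they are
   independent. *)
have fb : free b.
  rewrite /free size_tuple eqn_leq; apply/andP; split.
    by rewrite -[X in (_ <= X)%N](size_tuple b) dim_span.
  rewrite -[leqLHS]dS; apply: dimvS; apply: Smin => v.
  have [a /(_ z0 Mz0) E] := sp v; rewrite -/(X v z0) E.
  apply: memv_suml => i _; apply: memvZ; apply: memv_span.
  by apply/mapP; exists i; rewrite ?mem_enum.
have [lp [c [cb cfree]]] := free_extend fb.
(* The rectification takes one field for each coordinate, so the family is completed by zero
   fields. *)
pose Y (i : 'I_p) : 'rV[R]_p -> 'rV[R]_p := if (i < l)%N then X y`_i else fun=> 0.
have [i z Mz|i j z Mz|i il|i il z|a Ha|u [uz0 uM uY]] :=
    @commuting_fields_rectify R p (fun i => (i < l)%N) Y c M z0 M_open Mz0.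
- by rewrite /Y; case: ifP => _; [exact: X_smooth | move=> k; exact: Cn_cst].
- rewrite /Y; case: ifP => _; case: ifP => _; last by [].
  + by apply/eqP; rewrite -subr_eq0; apply/eqP; exact: comm Mz.
  + by rewrite derive_cst derive0.
  + by rewrite derive_cst derive0.
- rewrite cb // /Y il -[b`_i]/(b`_(Ordinal il)) -tnth_nth tnth_mktuple.
  by rewrite (tnth_nth 0).
- by rewrite /Y (negbTE il).
- exact: cfree Ha.
exists u, w; split=> //.
- move=> i il; have ip : (i < p)%N by exact: leq_trans il lp.
  exists (Ordinal ip) => // z uz.
  rewrite (uY (Ordinal ip) z) // /Y /= il wlt //.
  by rewrite addrC subrK.
- move=> j lj z uz; apply/eqP; rewrite -subr_eq0; apply/eqP.
  by apply: (HK _).1 (wge j lj) _ _; exact: uM.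
Qed.

Theorem theorem3p4 (R : realType) (r p : nat) (G : lieGroupType R r)
    (v : r.-tuple 'rV[R]_r) (v_basis : basis_of fullv v)
    (M : set 'rV[R]_p) (M_open : open M) (A1 A2 : local_action G M) :
  poisson_compatible (@phase_space R r p M)
    (action_bracket v A1) (action_bracket v A2)
  <->
  commutative_fields M
    (fun (w : 'rV[R]_r) z => action_field A1 w z - action_field A2 w z) /\
  differ_by_translation M (action_field A1) (action_field A2).
Proof.
have C := action_brackets_compatible v_basis A1 A2 M_open.
split=> [/C comm|[comm _]]; last exact/C.
split=> //; apply: commuting_fields_translation comm => //.
- by move=> z t a b; exact: action_field_lin.
- by move=> z t a b; exact: action_field_lin.
- by move=> a z; exact: smooth_action_field.
- by move=> a z; exact: smooth_action_field.
Qed.
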